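(* Given $f\in H^\infty(\mathbb{D})$, there is a function $f^*\in L^\infty(\mathbb{T})$ such that for every $re^{i\sigma}\in\mathbb{D}$ (with $0\le r<1$, $\sigma\in\mathbb{R}$) it holds that $$f(re^{i\sigma})=\frac{1}{2\pi}\int_{-\pi}^{\pi} f^*(e^{it})\,P_r(\sigma-t)\,dt.$$ The mapping $f\mapsto f^*$ defines an isometric algebra homomorphism from $H^\infty(\mathbb{D})$ into $L^\infty(\mathbb{T})$.
   Context: $\mathbb{D}$ is the open unit disk in $\mathbb{C}$ and $\mathbb{T}=\partial\mathbb{D}$ is the unit circle. $H^\infty(\mathbb{D})$ is the algebra (with pointwise operations) of bounded complex-valued analytic functions on $\mathbb{D}$, with the norm $\|f\|=\sup_{z\in\mathbb{D}}|f(z)|$. $L^\infty(\mathbb{T})$ is the algebra (with pointwise almost everywhere operations) of essentially bounded complex-valued measurable functions on $\mathbb{T}$, modulo almost everywhere equality, with the essential supremum norm. For $0\le r<1$ and $\theta\in\mathbb{R}$, the Poisson kernel is $$P_r(\theta)=\frac{1-r^2}{1-2r\cos(\theta)+r^2}.$$ *)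

(* Defs.v *)
From HB Require Import structures.
From mathcomp Require Import all_boot all_order all_algebra.
From mathcomp Require Import generic_quotient ring_quotient.
From mathcomp.real_closed Require Export complex.
From mathcomp Require Import all_classical all_reals all_analysis.
From mathcomp Require Import measurable_realfun ess_sup_inf.
From mathcomp Require Import lra.

Set Implicit Arguments.
Unset Strict Implicit.
Unset Printing Implicit Defensive.
Set Warnings "-redundant-canonical-projection,-projection-no-head-constant".

Import Order.TTheory GRing.Theory Num.Theory.
Import numFieldNormedType.Exports Normc.

Local Open Scope classical_set_scope.
Local Open Scope quotient_scope.
Local Open Scope ring_scope.
Local Open Scope complex_scope.

Section function_algebra.
Context (T : pointedType) (K : comNzRingType) (A : algType K).

Let fct_scalerAl (a : K) (f g : T -> A) : a *: (f * g) = (a *: f) * g.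
Proof. by apply/funext => x; exact: scalerAl. Qed.

Let fct_scalerAr (a : K) (f g : T -> A) : a *: (f * g) = f * (a *: g).
Proof. by apply/funext => x; exact: scalerAr. Qed.

HB.instance Definition _ :=
  GRing.LSemiModule_isLSemiAlgebra.Build K (T -> A) fct_scalerAl.
HB.instance Definition _ :=
  GRing.LSemiAlgebra_isSemiAlgebra.Build K (T -> A) fct_scalerAr.
End function_algebra.

(* R[i] as an algebra and a normed space over itself. *)
HB.instance Definition _ (R : rcfType) :=
  GRing.ComAlgebra.copy R[i] (R[i])^o.
HB.instance Definition _ (R : rcfType) :=
  NormedModule.copy R[i] (R[i])^o.

Section unit_disk.
Context (R : realType).

Record disk : Type := Disk { disk_val : R[i]; _ : `|disk_val| < 1 }.

HB.instance Definition _ := [isSub for disk_val].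
HB.instance Definition _ := [Choice of disk by <:].

Let disk0 : `|0 : R[i]| < 1. Proof. by rewrite normr0 ltr01. Qed.

HB.instance Definition _ := isPointed.Build disk (Disk disk0).

(* The disk is open, so complex differentiability at its points does not depend
   on the values chosen outside of it. *)
Definition extend_disk (f : disk -> R[i]) (z : R[i]) : R[i] :=
  oapp f 0 (insub z).

Definition analytic (f : disk -> R[i]) : Prop :=
  forall z : disk, derivable (extend_disk f) (val z) 1.

Definition bounded_on_disk (f : disk -> R[i]) : Prop :=
  exists M : R, forall z, normc (f z) <= M.

Definition hinf : {pred disk -> R[i]} :=
  [pred f | `[< analytic f /\ bounded_on_disk f >]].

Lemma nbhs_disk (z : disk) : \forall w \near (val z : R[i]), `|w| < 1.
Proof.
case: z => z z1 /=; rewrite -subr_gt0 in z1.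
near=> w; rewrite -(subrK z w) (le_lt_trans (ler_normD _ _))// -ltrBrDr.
rewrite distrC.
near: w; exact: cvgr_dist_lt.
Unshelve. all: by end_near. Qed.

Lemma extend_disk1 (z : disk) :
  {near val z, (cst 1 : R[i] -> R[i]) =1 extend_disk 1}.
Proof.
apply: filterS (nbhs_disk z) => w w1; rewrite /extend_disk.
by case: insubP => //; rewrite w1.
Qed.

Lemma analytic1 : analytic 1.
Proof.
move=> z; apply: (near_eq_derivable (extend_disk1 z)).
exact: derivable_cst.
Qed.

Lemma extend_diskM (f g : disk -> R[i]) :
  extend_disk (f * g) = extend_disk f * extend_disk g.
Proof.
have oappM (o : option disk) : oapp (f * g) 0 o = oapp f 0 o * oapp g 0 o.
  by case: o => [//|]; rewrite [RHS]mul0r.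
by apply/funext => z; exact: oappM.
Qed.

Lemma extend_diskP (a : R[i]) (f g : disk -> R[i]) :
  extend_disk (a *: f + g) = a *: extend_disk f + extend_disk g.
Proof.
have oappP (o : option disk) :
    oapp (a *: f + g) 0 o = a *: oapp f 0 o + oapp g 0 o.
  by case: o => [//|]; rewrite [RHS]addr0 scaler0.
by apply/funext => z; exact: oappP.
Qed.

Lemma analyticM f g : analytic f -> analytic g -> analytic (f * g).
Proof. by move=> af ag z; rewrite extend_diskM; exact: derivableM. Qed.

Lemma analyticP a f g : analytic f -> analytic g -> analytic (a *: f + g).
Proof.
move=> af ag z; rewrite extend_diskP; apply: derivableD => //.
exact: derivableZ.
Qed.

Lemma hinfP f : reflect (analytic f /\ bounded_on_disk f) (f \in hinf).
Proof. exact: asboolP. Qed.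

Lemma normc_ge0 (z : R[i]) : 0 <= normc z.
Proof. by case: z => a b; exact: sqrtr_ge0. Qed.

Lemma hinf_subalg_closed : subalg_closed hinf.
Proof.
split=> [|a f g /hinfP[af [M fM]] /hinfP[ag [N gN]]|
         f g /hinfP[af [M fM]] /hinfP[ag [N gN]]]; apply/hinfP; split.
- exact: analytic1.
- by exists 1 => z; rewrite normc1.
- exact: analyticP.
- exists (normc a * M + N) => z.
  rewrite (le_trans (le_normcD _ _))// lerD//.
  by rewrite [leLHS]normcM ler_wpM2l// normc_ge0.
- exact: analyticM.
- by exists (M * N) => z; rewrite [leLHS]normcM ler_pM// normc_ge0.
Qed.

HB.instance Definition _ :=
  GRing.isSubalgClosed.Build R[i] (disk -> R[i]) hinf hinf_subalg_closed.

Record Hinf : Type := MkHinf { Hinf_fun :> disk -> R[i]; _ : Hinf_fun \in hinf }.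

HB.instance Definition _ := [isSub for Hinf_fun].
HB.instance Definition _ := [Choice of Hinf by <:].
HB.instance Definition _ := [SubChoice_isSubComNzRing of Hinf by <:].
HB.instance Definition _ := [SubZmodule_isSubLmodule of Hinf by <:].
HB.instance Definition _ := [SubNzRing_SubLmodule_isSubLalgebra of Hinf by <:].
HB.instance Definition _ := [SubLSemiAlgebra_isSubSemiAlgebra of Hinf by <:].

(* The norm is taken in R (normc) rather than in R[i] (`|_|). *)
Definition Hinf_norm (f : Hinf) : R := sup (range (fun z => normc (f z))).

End unit_disk.

Section unit_circle.
Context (R : realType).

Record circle : Type := Circle { circle_val : R[i]; _ : `|circle_val| == 1 }.

HB.instance Definition _ := [isSub for circle_val].
HB.instance Definition _ := [Choice of circle by <:].

Let circle1 : `|1 : R[i]| == 1. Proof. by rewrite normr1. Qed.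

HB.instance Definition _ := isPointed.Build circle (Circle circle1).

(* Generators of the Borel sigma-algebra of the circle: its relatively open
   subsets. *)
Definition circle_open : set (set circle) :=
  [set circle_val @^-1` U | U in @open R[i]].

HB.instance Definition _ :=
  Measurable.copy circle (g_sigma_algebraType circle_open).

Let normc_expi (t : R) : `|cos t +i* sin t| == 1.
Proof. by rewrite normc_def /= cos2Dsin2 sqrtr1. Qed.

Definition expi (t : R) : circle := Circle (normc_expi t).

Lemma continuous_expi : continuous (circle_val \o expi : R -> R[i]).
Proof.
move=> t; apply/cvgrPdist_lt => e; rewrite ltcE /= => /andP[/eqP ime e0].
have e20 : 0 < complex.Re e / 2 by rewrite divr_gt0.
have c : cos u @[u --> t] --> cos t by exact: continuous_cos.
have s : sin u @[u --> t] --> sin t by exact: continuous_sin.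
move: c s => /cvgrPdist_lt/(_ _ e20) c /cvgrPdist_lt/(_ _ e20) s.
near=> u.
have cu : `|cos t - cos u| < complex.Re e / 2 by near: u.
have su : `|sin t - sin u| < complex.Re e / 2 by near: u.
rewrite -[X in `|X|]/((cos t - cos u) +i* (sin t - sin u)).
rewrite normc_def /= ltcE /= ime eqxx /=.
set a := cos t - cos u in cu *; set b := sin t - sin u in su *.
have ab0 : 0 <= `|a| + `|b| by rewrite addr_ge0.
have : `|a| + `|b| < complex.Re e by rewrite (splitr (complex.Re e)) ltrD.
apply: le_lt_trans.
rewrite -[leRHS](ger0_norm ab0) -sqrtr_sqr ler_sqrt ?sqr_ge0//.
rewrite -[a ^+ 2]real_normK ?num_real// -[b ^+ 2]real_normK ?num_real//.
by rewrite (sqrrD `|a|) lerD2r lerDl mulrn_wge0// mulr_ge0.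
Unshelve. all: by end_near. Qed.

Lemma measurable_expi : measurable_fun [set: measurableTypeR R] expi.
Proof.
apply: (@measurability _ _ _ _ _ _ circle_open) => //.
move=> _ [_ [U oU <-] <-]; rewrite setTI; apply: open_measurable.
rewrite -comp_preimage.
by apply: open_comp oU => t _; exact: continuous_expi.
Qed.

HB.instance Definition _ := isMeasurableFun.Build _ _ (measurableTypeR R) circle
  expi measurable_expi.

Let itv_pi : set (measurableTypeR R) := `[- pi, pi].

Let measurable_itv_pi : measurable itv_pi.
Proof. exact: measurable_itv. Qed.

Definition arc_length : set circle -> \bar R :=
  pushforward (mrestr (@lebesgue_measure R) measurable_itv_pi) expi.

Let arc_length0 : arc_length set0 = 0%E.
Proof. by rewrite /arc_length /pushforward preimage_set0 measure0. Qed.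

Let arc_length_ge0 A : (0 <= arc_length A)%E.
Proof. exact: (@measure_ge0 _ _ _ (mrestr lebesgue_measure _)). Qed.

Let arc_length_sigma_additive : semi_sigma_additive arc_length.
Proof.
move=> F mF tF mUF; rewrite /arc_length /pushforward preimage_bigcup.
apply: measure_semi_sigma_additive.
- by move=> n; rewrite -[X in measurable X]setTI; exact: measurable_expi.
- apply/trivIsetP => /= i j _ _ ij; rewrite -preimage_setI.
  by move/trivIsetP : tF => /(_ _ _ _ _ ij) ->//; rewrite preimage_set0.
- by rewrite -preimage_bigcup -[X in measurable X]setTI; exact: measurable_expi.
Qed.

HB.instance Definition _ := isMeasure.Build _ _ _ arc_length
  arc_length0 arc_length_ge0 arc_length_sigma_additive.

Lemma arc_lengthT : arc_length [set: circle] = (2 * pi)%:E.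
Proof.
rewrite /arc_length /pushforward /mrestr preimage_setT setTI.
rewrite /itv_pi lebesgue_measure_itv/= lte_fin gtrN ?pi_gt0//.
by rewrite -EFinB opprK mulr_natl mulr2n.
Qed.

End unit_circle.
Arguments arc_length {R}.

Section essentially_bounded.
Context (R : realType).
Local Notation T := (circle R).
Local Notation ess_sup_normc f :=
  (ess_sup (@arc_length R) (fun z => (normc (f z))%:E)).

Definition measurable_cfun (f : T -> R[i]) : Prop :=
  measurable_fun [set: T] (fun z => complex.Re (f z)) /\
  measurable_fun [set: T] (fun z => complex.Im (f z)).

Definition ess_bounded (f : T -> R[i]) : Prop := (ess_sup_normc f < +oo)%E.

Definition linf_fun : {pred T -> R[i]} :=
  [pred f | `[< measurable_cfun f /\ ess_bounded f >]].

Lemma linf_funP f :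
  reflect (measurable_cfun f /\ ess_bounded f) (f \in linf_fun).
Proof. exact: asboolP. Qed.

Lemma ess_boundedP f :
  ess_bounded f <-> exists M : R, \forall z \ae arc_length, normc (f z) <= M.
Proof.
split=> [fb|[M fM]]; last first.
  by apply: le_lt_trans (ltry M); apply/ess_supP.
have ae := @ess_sup_ge _ _ _ (@arc_length R) (fun z => (normc (f z))%:E).
rewrite /ess_bounded in fb.
case E : (ess_sup _ _) fb ae => [M||] //= _ ae; first by exists M.
by exists 0; apply: filterS ae => z; rewrite leeNy_eq.
Qed.

Lemma measurable_cfunM f g :
  measurable_cfun f -> measurable_cfun g -> measurable_cfun (f * g).
Proof.
move=> [f1 f2] [g1 g2]; split.
- rewrite [X in measurable_fun _ X](_ : _ = fun z =>
    complex.Re (f z) * complex.Re (g z) - complex.Im (f z) * complex.Im (g z)).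
    by apply: measurable_funB; exact: measurable_funM.
  apply/funext => z; rewrite -[(f * g) z]/(f z * g z).
  by case: (f z); case: (g z).
- rewrite [X in measurable_fun _ X](_ : _ = fun z =>
    complex.Re (f z) * complex.Im (g z) + complex.Im (f z) * complex.Re (g z)).
    by apply: measurable_funD; exact: measurable_funM.
  apply/funext => z; rewrite -[(f * g) z]/(f z * g z).
  by case: (f z); case: (g z).
Qed.

Lemma measurable_cfunP a f g : measurable_cfun f -> measurable_cfun g ->
  measurable_cfun (a *: f + g).
Proof.
move=> mf [g1 g2].
have ma : measurable_cfun (cst a) by split; exact: measurable_cst.
have [h1 h2] := measurable_cfunM ma mf.
split.
- rewrite [X in measurable_fun _ X](_ : _ = fun z =>
    complex.Re ((cst a * f) z) + complex.Re (g z)).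
    exact: measurable_funD.
  apply/funext => z; rewrite -[(_ + _) z]/((cst a * f) z + g z).
  by case: ((cst a * f) z); case: (g z).
- rewrite [X in measurable_fun _ X](_ : _ = fun z =>
    complex.Im ((cst a * f) z) + complex.Im (g z)).
    exact: measurable_funD.
  apply/funext => z; rewrite -[(_ + _) z]/((cst a * f) z + g z).
  by case: ((cst a * f) z); case: (g z).
Qed.

Lemma linf_fun_subalg_closed : subalg_closed linf_fun.
Proof.
split=> [|a f g /linf_funP[mf /ess_boundedP[M fM]]
              /linf_funP[mg /ess_boundedP[N gN]]
         |f g /linf_funP[mf /ess_boundedP[M fM]]
              /linf_funP[mg /ess_boundedP[N gN]]];
  apply/linf_funP; split.
- by split; exact: measurable_cst.
- by apply/ess_boundedP; exists 1; apply: aeW => z; rewrite normc1.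
- exact: measurable_cfunP.
- apply/ess_boundedP; exists (normc a * M + N).
  apply: filterS2 fM gN => z fM gN.
  rewrite (le_trans (le_normcD _ _))// lerD//.
  by rewrite [leLHS]normcM ler_wpM2l// normc_ge0.
- exact: measurable_cfunM.
- apply/ess_boundedP; exists (M * N).
  apply: filterS2 fM gN => z fM gN.
  by rewrite [leLHS]normcM ler_pM// normc_ge0.
Qed.

HB.instance Definition _ :=
  GRing.isSubalgClosed.Build R[i] (T -> R[i]) linf_fun linf_fun_subalg_closed.

Record Linf_fun : Type :=
  MkLinf_fun { Linf_fun_val :> T -> R[i]; _ : Linf_fun_val \in linf_fun }.

HB.instance Definition _ := [isSub for Linf_fun_val].
HB.instance Definition _ := [Choice of Linf_fun by <:].
HB.instance Definition _ := [SubChoice_isSubComNzRing of Linf_fun by <:].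
HB.instance Definition _ := [SubZmodule_isSubLmodule of Linf_fun by <:].
HB.instance Definition _ :=
  [SubNzRing_SubLmodule_isSubLalgebra of Linf_fun by <:].
HB.instance Definition _ :=
  [SubLSemiAlgebra_isSubSemiAlgebra of Linf_fun by <:].

Definition ae_zero : {pred Linf_fun} :=
  [pred f : Linf_fun | `[< \forall z \ae arc_length, f z = 0 >]].

Lemma ae_zeroP (f : Linf_fun) :
  reflect (\forall z \ae arc_length, f z = 0) (f \in ae_zero).
Proof. exact: asboolP. Qed.

Lemma ae_zero_idealr_closed : idealr_closed ae_zero.
Proof.
split=> [||a f g /ae_zeroP f0 /ae_zeroP g0].
- by apply/ae_zeroP; exact: aeW.
- apply/negP => /ae_zeroP [A [mA A0 sA]].
  have AT : A = [set: T].
    by apply/seteqP; split=> // z _; apply: sA => /= /eqP; rewrite oner_eq0.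
  have := arc_lengthT R; rewrite -AT A0 => -[] /eqP.
  by rewrite lt_eqF// mulr_gt0 ?pi_gt0.
- apply/ae_zeroP; apply: filterS2 f0 g0 => z f0 g0.
  by rewrite -[LHS]/(a z * f z + g z) f0 g0 mulr0 addr0.
Qed.

HB.instance Definition _ :=
  isIdealr.Build Linf_fun ae_zero ae_zero_idealr_closed.

(* L^oo(T): classes of essentially bounded measurable functions modulo almost
   everywhere equality; [repr] picks a representative of a class. *)
Definition Linf : Type := {ideal_quot ae_zero}.

HB.instance Definition _ := GRing.ComNzRing.on Linf.
HB.instance Definition _ := EqQuotient.on Linf.
HB.instance Definition _ := NzRingQuotient.on Linf.

Lemma Linf_piP (f g : Linf_fun) :
  \pi_Linf f = \pi_Linf g <-> \forall z \ae arc_length, f z = g z.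
Proof.
have e : (\pi_Linf f == \pi_Linf g) = (f - g \in ae_zero).
  by rewrite Quotient.idealrBE.
split=> [/eqP|fg]; last (apply/eqP; move: fg); rewrite e.
- by move=> /ae_zeroP; apply: filterS => z /eqP; rewrite subr_eq0 => /eqP.
- move=> fg; apply/ae_zeroP; apply: filterS fg => z fg.
  by rewrite -[LHS]/(f z - g z) fg subrr.
Qed.

Lemma pi_Linf_surj (v : Linf) : exists f : Linf_fun, v = \pi_Linf f.
Proof. by exists (repr v); rewrite reprK. Qed.

Lemma repr_Linf_pi (f : Linf_fun) :
  \forall z \ae arc_length, repr (\pi_Linf f) z = f z.
Proof. by apply/Linf_piP; rewrite reprK. Qed.

Definition Linf_scale (a : R[i]) (g : Linf) : Linf := \pi_Linf (a *: repr g).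

Lemma pi_Linf_scale a f : \pi_Linf (a *: f) = Linf_scale a (\pi_Linf f).
Proof.
apply/Linf_piP; apply: filterS (repr_Linf_pi f) => z fz.
by rewrite -[LHS]/(a * f z) -fz.
Qed.

Let Linf_scalerA a b v : Linf_scale a (Linf_scale b v) = Linf_scale (a * b) v.
Proof.
by have [f ->] := pi_Linf_surj v; rewrite -!pi_Linf_scale scalerA.
Qed.

Let Linf_scale1r : left_id 1 Linf_scale.
Proof.
by move=> v; have [f ->] := pi_Linf_surj v; rewrite -pi_Linf_scale scale1r.
Qed.

Let Linf_scalerDr : right_distributive Linf_scale +%R.
Proof.
move=> a u v; have [f ->] := pi_Linf_surj u; have [g ->] := pi_Linf_surj v.
by rewrite -rmorphD -!pi_Linf_scale scalerDr rmorphD.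
Qed.

Let Linf_scalerDl v : {morph Linf_scale^~ v : a b / a + b}.
Proof.
move=> a b; have [f ->] := pi_Linf_surj v.
by rewrite -!pi_Linf_scale scalerDl rmorphD.
Qed.

HB.instance Definition _ := GRing.Zmodule_isLmodule.Build R[i] Linf
  Linf_scalerA Linf_scale1r Linf_scalerDr Linf_scalerDl.

Lemma pi_LinfZ a f : \pi_Linf (a *: f) = a *: \pi_Linf f.
Proof. exact: pi_Linf_scale. Qed.

Let Linf_scalerAl (a : R[i]) (u v : Linf) : a *: (u * v) = (a *: u) * v.
Proof.
have [f ->] := pi_Linf_surj u; have [g ->] := pi_Linf_surj v.
by rewrite -rmorphM -!pi_LinfZ -rmorphM scalerAl.
Qed.

HB.instance Definition _ :=
  GRing.LSemiModule_isLSemiAlgebra.Build R[i] Linf Linf_scalerAl.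

Let Linf_scalerAr (a : R[i]) (u v : Linf) : a *: (u * v) = u * (a *: v).
Proof. by rewrite mulrC scalerAl mulrC. Qed.

HB.instance Definition _ :=
  GRing.LSemiAlgebra_isSemiAlgebra.Build R[i] Linf Linf_scalerAr.

Definition Linf_norm (g : Linf) : R := fine (ess_sup_normc (repr g)).

Lemma Linf_norm_pi (f : Linf_fun) :
  Linf_norm (\pi_Linf f) = fine (ess_sup_normc f).
Proof.
congr fine; apply: eq_ess_sup.
by apply: filterS (repr_Linf_pi f) => z ->.
Qed.

End essentially_bounded.

Section poisson.
Context (R : realType).

Definition poisson_kernel (r theta : R) : R :=
  (1 - r ^+ 2) / (1 - 2 * r * cos theta + r ^+ 2).

Definition Cintegral (D : set R) (F : R -> R[i]) : R[i] :=
  (\int[lebesgue_measure]_(t in D) complex.Re (F t)) +i*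
  (\int[lebesgue_measure]_(t in D) complex.Im (F t)).

Definition poisson_integral (g : circle R -> R[i]) (r sigma : R) : R[i] :=
  ((2 * pi)^-1)%:C *
  Cintegral `[- pi, pi]
    (fun t => g (expi t) * (poisson_kernel r (sigma - t))%:C).

Lemma continuous_poisson_kernel (r : R) : 0 <= r -> r < 1 ->
  continuous (poisson_kernel r).
Proof.
move=> r0 r1 t; have d0 : 1 - 2 * r * cos t + r ^+ 2 != 0.
  rewrite gt_eqF//.
  have : 0 < (1 - r) ^+ 2 by rewrite exprn_gt0// subr_gt0.
  have : 0 <= 2 * r * (1 - cos t).
    by rewrite mulr_ge0 ?mulr_ge0// subr_ge0 cos_le1.
  by rewrite !expr2; lra.
apply: cvgM; first exact: cvg_cst.
apply: cvgV => //; apply: cvgD; last exact: cvg_cst.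
apply: cvgB; first exact: cvg_cst.
by apply: cvgM; [exact: cvg_cst|exact: continuous_cos].
Qed.

Lemma poisson_integral_ae (f g : circle R -> R[i]) (r sigma : R) :
  0 <= r -> r < 1 -> measurable_cfun f -> measurable_cfun g ->
  (\forall z \ae arc_length, f z = g z) ->
  poisson_integral f r sigma = poisson_integral g r sigma.
Proof.
move=> r0 r1 [mf1 mf2] [mg1 mg2] [N [mN N0 fgN]].
have mNe : measurable (@expi R @^-1` N : set (measurableTypeR R)).
  by rewrite -[X in measurable X]setTI; exact: (@measurable_expi R).
have P_meas : measurable_fun `[- pi, pi]
    (fun t : measurableTypeR R => poisson_kernel r (sigma - t)).
  apply: measurable_funTS; apply: continuous_measurable_fun => t.
  apply: (@continuous_comp _ _ _ (fun t => sigma - t) (poisson_kernel r)).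
    by apply: cvgB; [exact: cvg_cst|exact: cvg_id].
  exact: continuous_poisson_kernel.
have meas (h : circle R -> R) : measurable_fun [set: circle R] h ->
    measurable_fun `[- pi, pi]
      (fun t => (h (expi t) * poisson_kernel r (sigma - t))%:E).
  move=> mh; apply/measurable_EFinP; apply: measurable_funM => //.
  by apply: measurable_funTS; exact: (measurableT_comp mh (@measurable_expi R)).
have ae_fg : \forall t \ae (@lebesgue_measure R),
    `[- pi, pi]%classic t -> f (expi t) = g (expi t).
  exists (@expi R @^-1` N `&` `[- pi, pi]); split => //.
    by apply: measurableI => //; exact: measurable_itv.
  by move=> t /= /not_implyP[tD ne]; split => //; exact: fgN.
have ReZ (a : R[i]) (b : R) : complex.Re (a * b%:C) = complex.Re a * b.
  by case: a => a1 a2 /=; rewrite mulr0 subr0.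
have ImZ (a : R[i]) (b : R) : complex.Im (a * b%:C) = complex.Im a * b.
  by case: a => a1 a2 /=; rewrite mulr0 add0r.
rewrite /poisson_integral /Cintegral /Rintegral; congr (_ * (fine _ +i* fine _)).
- under eq_integral do rewrite ReZ.
  under [RHS]eq_integral do rewrite ReZ.
  apply: ae_eq_integral; [exact: measurable_itv|exact: (meas _ mf1)|
    exact: (meas _ mg1)|].
  case: ae_fg => A [mA A0 sA]; exists A; split=> // t /= ne; apply: sA => /= fg.
  by apply: ne => /fg ->.
- under eq_integral do rewrite ImZ.
  under [RHS]eq_integral do rewrite ImZ.
  apply: ae_eq_integral; [exact: measurable_itv|exact: (meas _ mf2)|
    exact: (meas _ mg2)|].
  case: ae_fg => A [mA A0 sA]; exists A; split=> // t /= ne; apply: sA => /= fg.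
  by apply: ne => /fg ->.
Qed.

(* By [poisson_integral_ae] the choice of the representative is irrelevant. *)
Definition is_boundary_function (f : Hinf R) (g : Linf R) : Prop :=
  forall (r sigma : R) (z : disk R),
    0 <= r -> r < 1 -> val z = r%:C * val (expi sigma) ->
    f z = poisson_integral (repr g) r sigma.
End poisson.

(* Main.v *)
Require Import Defs.
From HB Require Import structures.
From mathcomp Require Import all_boot all_order all_algebra.
From mathcomp Require Import generic_quotient.
From mathcomp.real_closed Require Import complex.
From mathcomp Require Import all_classical all_reals all_analysis.
From mathcomp Require Import measurable_realfun ess_sup_inf.
From mathcomp Require Import ring lra.

(** Let [f] be bounded and analytic in the disk.  The analysis rests on Goursat's
    theorem for rectangles ([goursat_rectangle]).  In the coordinates
    z = exp (x + i t) it says that the integral of an analytic function over a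
    circle of radius exp x does not depend on x, as long as the circles sweep an
    annulus of analyticity ([circle_integral_constant]).  Two consequences carry
    the proof.

    First, Poisson's formula holds for [f] on every circle of radius less than 1
    ([circle_poisson_formula]): the Poisson kernel is the sum of
    zeta / (zeta - z) and conj z * zeta / (1 - conj z * zeta), where the first
    term is a Cauchy kernel and the second has mean zero against [f].

    Secondly, applied to [f z * conj (f (c / conj z))], it shows that the mean
    of the product of [f] on one circle and its conjugate on another depends only
    on the product of the two radii ([correlation]).  Hence the square mean phi of
    [f], as a function of the logarithm x of the radius, satisfies
    |f_x - f_y|^2 = phi x + phi y - 2 phi ((x + y) / 2) in mean
    ([square_distance]).  So phi is midpoint convex, and being bounded on the
    negative half-line it is nondecreasing ([midpoint_convex_nondecreasing]) and
    converges at 0.  The values of [f] on suitable circles of radii tending to 1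
    are therefore Cauchy in square mean, fast enough to converge almost
    everywhere; one sequence of radii can serve two functions
    ([common_radial_limits]).  The limit is the boundary function: by dominated
    convergence Poisson's formula passes to it ([poisson_of_radial_limit]).

    A bounded measurable function on the circle is determined by its Poisson
    integral ([poisson_integral_inj]): integrating a vanishing Poisson integral
    over an arc and letting the radius tend to 1 shows that the function has
    integral zero over every arc, hence is zero almost everywhere by Lebesgue
    differentiation.  So the boundary function is unique; and since along common
    radii the limits of a linear combination or product are the linear
    combination or product of the limits, the map is an algebra homomorphism.

    It is isometric: boundary values are limits of values of [f], and values of
    [f] are averages of boundary values against a nonnegative kernel of mass
    2 pi ([Linf_norm_boundary]). *)

Set Implicit Arguments.
Unset Strict Implicit.
Unset Printing Implicit Defensive.
Import Order.TTheory GRing.Theory Num.Theory.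
Import numFieldNormedType.Exports Normc.

Local Open Scope classical_set_scope.
Local Open Scope quotient_scope.
Local Open Scope ring_scope.
Local Open Scope complex_scope.

(** * Goursat's theorem for real differential forms *)

Section integrable_fct.
Context d (T : measurableType d) (R : realType).
Context (mu : {measure set T -> \bar R}) (D : set T).
Hypothesis mD : measurable D.
Implicit Types f g : T -> R.

Lemma integrable_fctD f g :
  mu.-integrable D (EFin \o f) -> mu.-integrable D (EFin \o g) ->
  mu.-integrable D (EFin \o (fun t => f t + g t)).
Proof.
move=> fi gi; rewrite (_ : EFin \o _ = (fun t => (EFin \o f) t + (EFin \o g) t)%E)//.
exact: integrableD.
Qed.

Lemma integrable_fctB f g :
  mu.-integrable D (EFin \o f) -> mu.-integrable D (EFin \o g) ->
  mu.-integrable D (EFin \o (fun t => f t - g t)).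
Proof.
move=> fi gi; rewrite (_ : EFin \o _ = (fun t => (EFin \o f) t - (EFin \o g) t)%E)//.
exact: integrableB.
Qed.

Lemma integrable_fctZ f (c : R) :
  mu.-integrable D (EFin \o f) -> mu.-integrable D (EFin \o (fun t => c * f t)).
Proof.
move=> fi; rewrite (_ : EFin \o _ = (fun t => c%:E * (EFin \o f) t)%E)//.
exact: integrableZl.
Qed.

End integrable_fct.

Section goursat.
Context {R : realType}.
Implicit Types (p q : R -> R -> R) (a b x y : R).
Notation mu := (@lebesgue_measure R).

Lemma integrable_itvcc (f : R -> R) a b :
  {in `[a, b], forall y, {for y, continuous f}} ->
  mu.-integrable `[a, b] (EFin \o f).
Proof.
move=> cf; apply: continuous_compact_integrable; first exact: segment_compact.
by apply: continuous_in_subspaceT => y /set_mem/= yab; exact: cf.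
Qed.

Lemma Rintegral_cst_itv a b (c : R) : a <= b ->
  \int[mu]_(_ in `[a, b]) c = c * (b - a).
Proof.
move=> ab; rewrite Rintegral_cst//= lebesgue_measure_itv /= lte_fin.
by case: ltgtP ab => // -> _; rewrite subrr.
Qed.

Lemma Rintegral_itv_split (f : R -> R) a b c : a <= b -> b <= c ->
  mu.-integrable `[a, c] (EFin \o f) ->
  \int[mu]_(t in `[a, c]) f t =
  \int[mu]_(t in `[a, b]) f t + \int[mu]_(t in `[b, c]) f t.
Proof.
move=> ab bc fi; have := @Rintegral_itvB _ f (BLeft a) (BRight c) b fi.
rewrite !bnd_simp => /(_ ab bc) h.
rewrite -(@Rintegral_itv_obnd_cbnd _ b (BRight c)); last first.
  by apply: integrableS fi => //; apply: subset_itvr; rewrite bnd_simp.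
by rewrite -h; lra.
Qed.

Lemma Rintegral_near_cst (f : R -> R) a b c k : a <= b ->
  mu.-integrable `[a, b] (EFin \o f) ->
  (forall y, a <= y <= b -> `|f y - c| <= k) ->
  `|\int[mu]_(t in `[a, b]) f t - c * (b - a)| <= k * (b - a).
Proof.
move=> ab fi fc.
have ci (d : R) : mu.-integrable `[a, b] (EFin \o cst d).
  by apply: integrable_itvcc => y _; exact: cvg_cst.
have fci : mu.-integrable `[a, b] (EFin \o (fun t => f t - c)).
  by apply: integrable_fctB => //; exact: ci.
rewrite -!Rintegral_cst_itv// -RintegralB//; last exact: ci.
apply: (le_trans (le_normr_Rintegral _ fci)) => //.
apply: le_Rintegral => //; [exact: integrable_norm fci|exact: ci].
Qed.

(** Pointwise first-order contact of [p dx + q dy] with a closed form: the shared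
    coefficient [B] is the condition p_y = q_x.  Complex differentiability gives
    exactly this, with no information on how the coefficients vary. *)
Definition closed_at p q x0 y0 := exists A B C : R, forall e : R, 0 < e ->
  exists2 d : R, 0 < d & forall x y, `|x - x0| < d -> `|y - y0| < d ->
    `|p x y - p x0 y0 - A * (x - x0) - B * (y - y0)|
       <= e * (`|x - x0| + `|y - y0|) /\
    `|q x y - q x0 y0 - B * (x - x0) - C * (y - y0)|
       <= e * (`|x - x0| + `|y - y0|).

(** The integral of [p dx + q dy] counterclockwise along the boundary of the
    rectangle. *)
Definition circulation p q x1 x2 y1 y2 : R :=
  (\int[mu]_(y in `[y1, y2]) q x2 y - \int[mu]_(y in `[y1, y2]) q x1 y) -
  (\int[mu]_(x in `[x1, x2]) p x y2 - \int[mu]_(x in `[x1, x2]) p x y1).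

Lemma closed_at_continuous p q x0 y0 : closed_at p q x0 y0 ->
  [/\ {for x0, continuous (p ^~ y0)}, {for y0, continuous (p x0)},
      {for x0, continuous (q ^~ y0)} & {for y0, continuous (q x0)}].
Proof.
have aux (f : R -> R) (c z0 : R) : (exists2 d : R, 0 < d & forall z, `|z - z0| < d ->
     `|f z - f z0 - c * (z - z0)| <= `|z - z0|) -> {for z0, continuous f}.
  move=> [d d0 fd]; apply/cvgrPdist_lt => e e0.
  have c1 : 0 < `|c| + 1 by rewrite ltr_wpDl.
  have ec : 0 < e / (`|c| + 1) by rewrite divr_gt0.
  near=> z.
  have zd : `|z - z0| < d by rewrite distrC; near: z; exact: cvgr_dist_lt.
  have ze : `|z - z0| < e / (`|c| + 1).
    by rewrite distrC; near: z; exact: cvgr_dist_lt.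
  have := fd z zd; rewrite ltr_pdivlMr// in ze => fz.
  rewrite distrC (_ : f z - f z0 = (f z - f z0 - c * (z - z0)) + c * (z - z0)); last ring.
  rewrite (le_lt_trans (ler_normD _ _))// normrM.
  by rewrite (le_lt_trans _ ze)// [leRHS]mulrDr mulr1 addrC (mulrC `|c|) lerD2l.
move=> [A [B [C /(_ 1 ltr01)[d d0 pq]]]].
have d0' (z : R) : `|z - z| < d by rewrite subrr normr0.
split; [apply: (aux _ A)|apply: (aux _ B)|
  apply: (aux _ B)|apply: (aux _ C)]; exists d => // z zd.
- have [] := pq z y0 zd (d0' y0); rewrite subrr normr0// !mulr0 !subr0 addr0 mul1r.
  by move=> + _.
- have [] := pq x0 z (d0' x0) zd; rewrite subrr normr0// !mulr0 !subr0 add0r mul1r.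
  by move=> + _.
- have [] := pq z y0 zd (d0' y0); rewrite subrr normr0// !mulr0 !subr0 addr0 mul1r.
  by move=> _.
- have [] := pq x0 z (d0' x0) zd; rewrite subrr normr0// !mulr0 !subr0 add0r mul1r.
  by move=> _.
Unshelve. all: by end_near. Qed.

Lemma le_dist_itv a b x y : a <= x <= a + b -> a <= y <= a + b -> `|x - y| <= b.
Proof.
by move=> /andP[? ?] /andP[? ?]; rewrite ler_norml; apply/andP; split; lra.
Qed.

Section rectangle.
Variables (p q : R -> R -> R) (X1 X2 Y1 Y2 : R).
Hypotheses (X12 : X1 <= X2) (Y12 : Y1 <= Y2).
Hypothesis pq_closed : forall x y,
  X1 <= x <= X2 -> Y1 <= y <= Y2 -> closed_at p q x y.

Let pi x1 x2 y : X1 <= x1 -> x2 <= X2 -> Y1 <= y <= Y2 ->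
  mu.-integrable `[x1, x2] (EFin \o p ^~ y).
Proof.
move=> h1 h2 hy; apply: integrable_itvcc => x; rewrite in_itv /= => /andP[h3 h4].
have hx : X1 <= x <= X2 by rewrite (le_trans h1 h3) (le_trans h4).
by have [] := closed_at_continuous (pq_closed hx hy).
Qed.

Let qi y1 y2 x : Y1 <= y1 -> y2 <= Y2 -> X1 <= x <= X2 ->
  mu.-integrable `[y1, y2] (EFin \o q x).
Proof.
move=> h1 h2 hx; apply: integrable_itvcc => y; rewrite in_itv /= => /andP[h3 h4].
have hy : Y1 <= y <= Y2 by rewrite (le_trans h1 h3) (le_trans h4).
by have [] := closed_at_continuous (pq_closed hx hy).
Qed.

Lemma circulation_split x1 x2 x3 y1 y2 y3 :
  X1 <= x1 -> x1 <= x2 -> x2 <= x3 -> x3 <= X2 ->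
  Y1 <= y1 -> y1 <= y2 -> y2 <= y3 -> y3 <= Y2 ->
  circulation p q x1 x3 y1 y3 =
  circulation p q x1 x2 y1 y2 + circulation p q x2 x3 y1 y2 +
  circulation p q x1 x2 y2 y3 + circulation p q x2 x3 y2 y3.
Proof.
move=> *; rewrite /circulation.
rewrite (@Rintegral_itv_split (q x3) y1 y2 y3)//; last by apply: qi; lra.
rewrite (@Rintegral_itv_split (q x1) y1 y2 y3)//; last by apply: qi; lra.
rewrite (@Rintegral_itv_split (p ^~ y3) x1 x2 x3)//; last by apply: pi; lra.
rewrite (@Rintegral_itv_split (p ^~ y1) x1 x2 x3)//; last by apply: pi; lra.
by lra.
Qed.

(** The affine parts of [p] and [q] have no circulation because they share the
    coefficient [B]; only the remainders are left, each of size
    [e * diameter * side]. *)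
Lemma circulation_local x0 y0 (e : R) : X1 <= x0 <= X2 -> Y1 <= y0 <= Y2 -> 0 < e ->
  exists2 d : R, 0 < d & forall x y a b,
    0 <= a < d -> 0 <= b < d ->
    X1 <= x -> x + a <= X2 -> x <= x0 <= x + a ->
    Y1 <= y -> y + b <= Y2 -> y <= y0 <= y + b ->
    `|circulation p q x (x + a) y (y + b)| <= e * (a + b) ^+ 2.
Proof.
move=> hx0 hy0 e0; have [A [B [C pqd]]] := pq_closed hx0 hy0.
have e20 : 0 < e / 2 by rewrite divr_gt0.
have [d d0 {}pqd] := pqd _ e20; exists d => // x y a b.
move=> /andP[a0 ad] /andP[b0 bd] xl xr x0x yl yr y0y.
have near1 x' y' : x <= x' <= x + a -> y <= y' <= y + b ->
    [/\ `|x' - x0| < d, `|y' - y0| < d & e / 2 * (`|x' - x0| + `|y' - y0|)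
      <= e / 2 * (a + b)].
  move=> hx hy; split.
  - exact: le_lt_trans (le_dist_itv hx x0x) ad.
  - exact: le_lt_trans (le_dist_itv hy y0y) bd.
  - by rewrite ler_pM2l// lerD ?(le_dist_itv hx) ?(le_dist_itv hy).
have Yt t : y <= t <= y + b -> Y1 <= t <= Y2.
  by move=> /andP[? ?]; rewrite (le_trans yl)//= (le_trans _ yr).
have Xt t : x <= t <= x + a -> X1 <= t <= X2.
  by move=> /andP[? ?]; rewrite (le_trans xl)//= (le_trans _ xr).
have x1 : x <= x <= x + a by rewrite lexx lerDl.
have x2 : x <= x + a <= x + a by rewrite lexx lerDl a0.
have y1 : y <= y <= y + b by rewrite lexx lerDl.
have y2 : y <= y + b <= y + b by rewrite lexx lerDl b0.
have [ix1 ix2] := (qi yl yr (Xt _ x1), qi yl yr (Xt _ x2)).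
have [iy1 iy2] := (pi xl xr (Yt _ y1), pi xl xr (Yt _ y2)).
have tri (u v w c : R) : `|u - w - c| <= e / 2 * (a + b) ->
    `|v - w - c| <= e / 2 * (a + b) -> `|u - v| <= e * (a + b).
  move=> h h'; rewrite (_ : u - v = (u - w - c) - (v - w - c)); last by ring.
  rewrite (le_trans (ler_normB _ _))// (le_trans (lerD h h'))//.
  by rewrite -mulrDl -splitr.
have qd : `|\int[mu]_(t in `[y, y + b]) (q (x + a) t - q x t)
     - B * a * (y + b - y)| <= e * (a + b) * (y + b - y).
  apply: Rintegral_near_cst; [by rewrite lerDl|exact: integrable_fctB|].
  move=> t ty.
  have [i1 i2 i3] := near1 _ _ x2 ty; have [j1 j2 j3] := near1 _ _ x1 ty.
  have [_ k1] := pqd _ _ i1 i2; have [_ k2] := pqd _ _ j1 j2.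
  rewrite (_ : q (x + a) t - q x t - B * a =
    (q (x + a) t - B * (x + a - x0)) - (q x t - B * (x - x0))); last by ring.
  apply: (tri _ _ (q x0 y0) (C * (t - y0))).
    by apply: le_trans i3; apply: le_trans k1; rewrite le_eqVlt; apply/orP; left;
       apply/eqP; congr `|_|; ring.
  by apply: le_trans j3; apply: le_trans k2; rewrite le_eqVlt; apply/orP; left;
       apply/eqP; congr `|_|; ring.
have pd : `|\int[mu]_(t in `[x, x + a]) (p t (y + b) - p t y)
     - B * b * (x + a - x)| <= e * (a + b) * (x + a - x).
  apply: Rintegral_near_cst; [by rewrite lerDl|exact: integrable_fctB|].
  move=> t tx.
  have [i1 i2 i3] := near1 _ _ tx y2; have [j1 j2 j3] := near1 _ _ tx y1.
  have [k1 _] := pqd _ _ i1 i2; have [k2 _] := pqd _ _ j1 j2.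
  rewrite (_ : p t (y + b) - p t y - B * b =
    (p t (y + b) - B * (y + b - y0)) - (p t y - B * (y - y0))); last by ring.
  apply: (tri _ _ (p x0 y0) (A * (t - x0))).
    by apply: le_trans i3; apply: le_trans k1; rewrite le_eqVlt; apply/orP; left;
       apply/eqP; congr `|_|; ring.
  by apply: le_trans j3; apply: le_trans k2; rewrite le_eqVlt; apply/orP; left;
       apply/eqP; congr `|_|; ring.
rewrite /circulation -(RintegralB _ ix2 ix1)//.
rewrite -(RintegralB _ iy2 iy1)//.
move: qd pd; set I := Rintegral _ _ _; set J := Rintegral _ _ _.
rewrite ![_ + _ - _]addrAC !subrr !add0r => qd pd.
rewrite (_ : I - J = (I - B * a * b) - (J - B * b * a)); last by ring.
rewrite (le_trans (ler_normB _ _))// (le_trans (lerD qd pd))//.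
by rewrite -mulrDr expr2 mulrA (addrC b).
Qed.

(** The circulations of the four quarters add up to the whole, so one of them
    carries at least a quarter of it. *)
Lemma circulation_quarter x y a b (m : R) : 0 <= a -> 0 <= b ->
  X1 <= x -> x + a + a <= X2 -> Y1 <= y -> y + b + b <= Y2 ->
  4 * m <= `|circulation p q x (x + a + a) y (y + b + b)| ->
  exists x' y', [/\ x' = x \/ x' = x + a, y' = y \/ y' = y + b &
    m <= `|circulation p q x' (x' + a) y' (y' + b)|].
Proof.
move=> a0 b0 h1 h2 h3 h4.
rewrite (@circulation_split _ (x + a) _ _ (y + b)) ?lerDl// => le4.
apply: contrapT => nex.
have good x' y' : x' = x \/ x' = x + a -> y' = y \/ y' = y + b ->
    `|circulation p q x' (x' + a) y' (y' + b)| < m.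
  by move=> xx yy; rewrite ltNge; apply/negP => mle; apply: nex; exists x', y'.
have g1 := good _ _ (or_introl erefl) (or_introl erefl).
have g2 := good _ _ (or_intror erefl) (or_introl erefl).
have g3 := good _ _ (or_introl erefl) (or_intror erefl).
have g4 := good _ _ (or_intror erefl) (or_intror erefl).
move: le4; rewrite leNgt => /negP; apply.
rewrite (_ : 4 * m = m + m + m + m); last by ring.
by do 3! (apply: le_lt_trans (ler_normD _ _) _; apply: ltrD => //).
Qed.

(** A circulation of modulus eta > 0 would leave, in suitably nested quarters, a
    circulation of at least eta / 4^n; but the local estimate at the common point
    of these rectangles makes it o(4^-n). *)
Lemma goursat_rectangle : circulation p q X1 X2 Y1 Y2 = 0.
Proof.
pose L := X2 - X1; pose T := Y2 - Y1.
have L0 : 0 <= L by rewrite subr_ge0.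
have T0 : 0 <= T by rewrite subr_ge0.
pose h n : R := 2^-1 ^+ n.
have h0 n : 0 < h n by rewrite exprn_gt0.
have hS n : h n = h n.+1 + h n.+1 by rewrite /h exprS; lra.
pose circ n (z : R * R) := circulation p q z.1 (z.1 + L * h n) z.2 (z.2 + T * h n).
apply/eqP; rewrite -normr_le0 leNgt; apply/negP => pq0.
set eta := `|_| in pq0.
pose inside n (z : R * R) := [/\ X1 <= z.1, z.1 + L * h n <= X2, Y1 <= z.2
  & z.2 + T * h n <= Y2].
pose bad n (z : R * R) := inside n z /\ eta * h n ^+ 2 <= `|circ n z|.
pose child n (z z' : R * R) := [/\ z.1 <= z'.1, z'.1 + L * h n.+1 <= z.1 + L * h n,
  z.2 <= z'.2 & z'.2 + T * h n.+1 <= z.2 + T * h n].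
have step n z : bad n z -> exists z', bad n.+1 z' /\ child n z z'.
  move=> [[i1 i2 i3 i4] bz]; apply: contrapT => nz.
  have Lh : 0 <= L * h n.+1 by rewrite mulr_ge0// ltW.
  have Th : 0 <= T * h n.+1 by rewrite mulr_ge0// ltW.
  move: i2 i4 bz nz; rewrite /bad /inside /child /circ hS !mulrDr !addrA.
  move=> i2 i4 bz; apply.
  have hh : 4 * (eta * h n.+1 ^+ 2) = eta * (h n.+1 + h n.+1) ^+ 2 by ring.
  rewrite -hh in bz.
  have [x' [y' [xx yy bz']]] := circulation_quarter Lh Th i1 i2 i3 i4 bz.
  exists (x', y') => /=; split; last by case: xx yy => -> [] ->; rewrite ?lerDl.
  have [k1 k2] : X1 <= x' /\ x' + L * h n.+1 <= X2.
    by case: xx => ->; split => //; [rewrite (le_trans _ i2)// lerDl|rewrite ler_wpDr].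
  have [k3 k4] : Y1 <= y' /\ y' + T * h n.+1 <= Y2.
    by case: yy => ->; split => //; [rewrite (le_trans _ i4)// lerDl|rewrite ler_wpDr].
  by [].
have [s [s0 sS]] : exists s : nat -> R * R, s 0%N = (X1, Y1) /\
    forall n, bad n (s n) /\ child n (s n) (s n.+1).
  have /choice[g gP] : forall nz : nat * (R * R), exists z',
      bad nz.1 nz.2 -> bad nz.1.+1 z' /\ child nz.1 nz.2 z'.
    move=> [n z]; have [/step[z' z'P]|nb] := pselect (bad n z).
      by exists z'.
    by exists z.
  pose s := fix s n := if n is n'.+1 then g (n', s n') else (X1, Y1).
  have sb n : bad n (s n).
    elim: n => [|n ih].
      rewrite /bad /inside /circ /= /h expr0 !mulr1 /L /T.
      by rewrite !(addrC _ (_ - _)) !subrK /eta; repeat split => //; rewrite expr1n mulr1.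
    by have /= [] := gP (n, s n) ih.
  by exists s; split => // n; split; [exact: sb|have /= [] := gP (n, s n) (sb n)].
(* a point common to nested intervals of left ends [f n] and lengths [c * h n] *)
have lim (f : nat -> R) (c : R) : 0 <= c ->
    (forall n, f n <= f n.+1 /\ f n.+1 + c * h n.+1 <= f n + c * h n) ->
    exists l, forall n, f n <= l <= f n + c * h n.
  move=> c0 fS.
  have ndf : nondecreasing_seq f by apply/nondecreasing_seqP => n; case: (fS n).
  have nif : nonincreasing_seq (fun n => f n + c * h n).
    by apply/nonincreasing_seqP => n; case: (fS n).
  have ub n m : f n <= f m + c * h m.
    have [nm|/ltnW mn] := leqP n m.
      by rewrite (le_trans (ndf _ _ nm))// lerDl mulr_ge0// ltW.
    by rewrite (le_trans _ (nif _ _ mn))// lerDl mulr_ge0// ltW.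
  exists (sup (range f)) => n; apply/andP; split.
    by apply: ub_le_sup; [exists (f 0%N + c * h 0%N) => _ [m _ <-]|exists n].
  by apply: ge_sup; [exists (f 0%N); exists 0%N|move=> _ [m _ <-]].
have [x0 x0P] : exists x0, forall n, (s n).1 <= x0 <= (s n).1 + L * h n.
  by apply: lim => // n; have [_ []] := sS n.
have [y0 y0P] : exists y0, forall n, (s n).2 <= y0 <= (s n).2 + T * h n.
  by apply: lim => // n; have [_ []] := sS n.
have hx0 : X1 <= x0 <= X2.
  have := x0P 0%N; rewrite s0 /= /h expr0 mulr1 /L; lra.
have hy0 : Y1 <= y0 <= Y2.
  have := y0P 0%N; rewrite s0 /= /h expr0 mulr1 /T; lra.
have c0 : 0 < (L + T + 1) ^+ 2 by rewrite exprn_gt0// ltr_wpDl// addr_ge0.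
have e0 : 0 < eta / ((L + T + 1) ^+ 2) by rewrite divr_gt0.
have [d d0 loc] := circulation_local hx0 hy0 e0.
have [n hn] : exists n, (L + T + 1) * h n < d.
  have cv : (L + T + 1) * h n @[n --> \oo] --> 0.
    rewrite -[0](mulr0 (L + T + 1)); apply: cvgM; first exact: cvg_cst.
    by apply: cvg_expr; rewrite gtr0_norm// invf_lt1// ltr1n.
  have /= := @cvgr_lt _ _ _ _ _ _ cv _ d0.
  by case=> N _ /(_ N (leqnn _)); exists N.
have [[[i1 i2 i3 i4] bn] _] := sS n.
have Lh : 0 <= L * h n by rewrite mulr_ge0// ltW.
have Th : 0 <= T * h n by rewrite mulr_ge0// ltW.
have hn0 := h0 n.
move: hn; rewrite (mulrDl (L + T)) (mulrDl L) mul1r => hn.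
have := loc (s n).1 (s n).2 (L * h n) (T * h n).
rewrite Lh Th /= i1 i2 i3 i4 x0P y0P /= => /(_ _ _ isT isT isT isT isT isT).
have -> : L * h n < d by rewrite (le_lt_trans _ hn)// -addrA lerDl addr_ge0// ltW.
have -> : T * h n < d.
  by rewrite (le_lt_trans _ hn)// addrAC lerDr addr_ge0// ltW.
move=> /(_ isT isT) le; move: (le_trans bn le).
rewrite -mulrDl exprMn [leRHS]mulrA ler_pM2r ?exprn_gt0// leNgt => /negP; apply.
rewrite -mulrA gtr_pMr// mulrC ltr_pdivrMr// mul1r.
have LT0 : 0 <= L + T by rewrite addr_ge0.
have LT1 : 0 <= L + T + 1 by rewrite (addr_ge0 LT0).
by rewrite ltr_pXn2r ?nnegrE// (ltrDl (L + T)).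
Qed.
End rectangle.
End goursat.

(** * Complex differentiability in exponential polar coordinates *)

Section complex_calculus.
Context {R : realType}.
Notation mu := (@lebesgue_measure R).
Notation C := R[i].
Implicit Types (z w : C) (x t : R) (f g h : C -> C).

Lemma normr_Re_le z : `|complex.Re z| <= normc z.
Proof.
case: z => a b /=; rewrite -[leLHS]sqrtr_sqr ler_sqrt ?lerDl ?sqr_ge0//.
by rewrite addr_ge0// sqr_ge0.
Qed.

Lemma normr_Im_le z : `|complex.Im z| <= normc z.
Proof.
case: z => a b /=; rewrite -[leLHS]sqrtr_sqr ler_sqrt ?lerDr ?sqr_ge0//.
by rewrite addr_ge0// sqr_ge0.
Qed.

Lemma normc_le_ReIm z : normc z <= `|complex.Re z| + `|complex.Im z|.
Proof.
case: z => a b /=.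
rewrite -[leRHS]ger0_norm ?addr_ge0// -sqrtr_sqr ler_sqrt ?sqr_ge0//.
rewrite sqrrD !real_normK ?num_real//.
by rewrite -addrA lerD2l lerDr mulrn_wge0// mulr_ge0.
Qed.

Lemma normc_real x : normc x%:C = `|x|.
Proof. by rewrite /= expr0n addr0 sqrtr_sqr. Qed.

(** The balls of [R[i]] have complex radii, while all estimates below are between
    real numbers. *)
Lemma nbhs_normcP z (P : set C) :
  (\forall w \near z, P w) <->
  (exists2 d : R, 0 < d & forall w, normc (w - z) < d -> P w).
Proof.
split=> [/nbhs_ballP[e /= e0 zP]|[d d0 zP]].
  exists (complex.Re e); first by move: e0; rewrite ltcE => /andP[].
  move=> w wz; apply: zP; rewrite /ball/= distrC.
  move: e0; rewrite ltcE /= => /andP[/eqP ime re].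
  by change ((normc (w - z))%:C < e); rewrite ltcE /= ime eqxx.
apply/nbhs_ballP; exists d%:C => /=; first by rewrite ltcR.
move=> w; rewrite /ball /= distrC => wz; apply: zP.
by move: wz; change ((normc (w - z))%:C < d%:C -> normc (w - z) < d); rewrite ltcR.
Qed.

Lemma derivable_approx h z : derivable h z 1 -> forall e : R, 0 < e ->
  exists2 d : R, 0 < d & forall w, normc (w - z) < d ->
    normc (h w - h z - 'D_1 h z * (w - z)) <= e * normc (w - z).
Proof.
move=> hz e e0.
have : ((fun k : C => k^-1 *: ((h \o shift z) (k *: 1) - h z)) @ (0 : C)^') -->
  'D_1 h z by exact: hz.
move=> /cvgrPdist_le /(_ e%:C); rewrite ltcR => /(_ e0).
rewrite near_withinE => /nbhs_normcP[d d0 hd]; exists d => // w wz.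
have [->|nwz] := eqVneq w z; first by rewrite !subrr mulr0 subr0 normc0 mulr0.
have := hd (w - z); rewrite subr0 subr_eq0 => /(_ wz nwz) /=.
rewrite [_ *: 1]mulr1 subrK.
set k := _^-1 *: _ => hk.
have -> : h w - h z - 'D_1 h z * (w - z) = - (('D_1 h z - k) * (w - z)).
  rewrite mulrBl opprB /k /GRing.scale /= mulrAC mulVf ?subr_eq0// mul1r.
  by [].
rewrite [leLHS]normcN [leLHS]normcM ler_wpM2r ?normc_ge0//.
move: hk; change ((normc ('D_1 h z - k))%:C <= e%:C -> normc ('D_1 h z - k) <= e).
by rewrite lecR.
Qed.

Lemma id_derivable w : derivable (fun v : C => v) w 1.
Proof. exact: derivable_id. Qed.

Lemma cst_derivable (c : C) w : derivable (fun _ : C => c) w 1.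
Proof. exact: derivable_cst. Qed.

Lemma sub_derivable f g w : derivable f w 1 -> derivable g w 1 ->
  derivable (fun v => f v - g v) w 1.
Proof. by move=> h1 h2; exact: (derivableB h1 h2). Qed.

Lemma mul_derivable f g w : derivable f w 1 -> derivable g w 1 ->
  derivable (fun v => f v * g v) w 1.
Proof. by move=> h1 h2; exact: (derivableM h1 h2). Qed.

Lemma inv_derivable f w : f w != 0 -> derivable f w 1 ->
  derivable (fun v => (f v)^-1) w 1.
Proof. by move=> h1 h2; exact: (derivableV h1 h2). Qed.

Lemma derivable_comp1 f g z :
  derivable f z 1 -> derivable g (f z) 1 -> derivable (g \o f) z 1.
Proof.
move=> /derivable1_diffP df /derivable1_diffP dg; apply/derivable1_diffP.
exact: (@differentiable_comp _ _ _ _ f g z df dg).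
Qed.

Lemma derivable_continuous f z : derivable f z 1 -> {for z, continuous f}.
Proof. by move=> /derivable1_diffP/differentiable_continuous. Qed.

(** Complex exponential coordinates: [polar x t] is exp (x + i t). *)
Definition polar x t : C := (expR x)%:C * val (expi t).

Lemma polarD x t x' t' : polar (x + x') (t + t') = polar x t * polar x' t'.
Proof.
rewrite /polar expRD /=; apply/eqP; rewrite eq_complex /= cosD sinD.
by rewrite !(mul0r, mulr0, subr0, addr0, add0r); apply/andP; split; apply/eqP; ring.
Qed.

Lemma normc_polar x t : normc (polar x t) = expR x.
Proof.
rewrite /polar [LHS]normcM normc_real ger0_norm ?expR_ge0//.
by rewrite /= cos2Dsin2 sqrtr1 mulr1.
Qed.

Lemma normc_polar_lt1 x t : x < 0 -> normc (polar x t) < 1.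
Proof. by move=> x0; rewrite normc_polar -expR0 ltr_expR. Qed.

Lemma polar_neq0 x t : polar x t != 0.
Proof.
apply/eqP => h; have := normc_polar x t; rewrite h normc0 => /esym/eqP.
by rewrite gt_eqF// expR_gt0.
Qed.

Lemma polar_pi x : polar x pi = polar x (- pi).
Proof. by rewrite /polar /= cosN sinN sinpi oppr0. Qed.

Lemma real_derive_approx (f : R -> R) x (c : R) : is_derive x 1 f c ->
  forall e : R, 0 < e -> exists2 d : R, 0 < d & forall y, `|y - x| < d ->
    `|f y - f x - c * (y - x)| <= e * `|y - x|.
Proof.
move=> [fx fc] e e0.
have : ((fun k : R => k^-1 *: ((f \o shift x) (k *: 1) - f x)) @ (0 : R)^') -->
  'D_1 f x by exact: fx.
move=> /cvgrPdist_le /(_ _ e0); rewrite near_withinE fc => /nbhs_ballP[d d0 fd].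
exists d => // y yx; have [->|nyx] := eqVneq y x.
  by rewrite !subrr mulr0 subr0 normr0 mulr0.
have := fd (y - x); rewrite /ball /= sub0r normrN subr_eq0 => /(_ yx nyx).
rewrite [_ *: 1]mulr1 subrK.
set k := _^-1 *: _ => hk.
have -> : f y - f x - c * (y - x) = - ((c - k) * (y - x)).
  rewrite mulrBl opprB /k /GRing.scale /= mulrAC mulVf ?subr_eq0// mul1r.
  by [].
by rewrite normrN normrM ler_wpM2r.
Qed.

Lemma polar_approx0 (e : R) : 0 < e ->
  exists2 d : R, 0 < d & forall x t, `|x| < d -> `|t| < d ->
    normc (polar x t - 1 - (x +i* t)) <= e * (`|x| + `|t|).
Proof.
(* expanding exp and cos, sin leaves remainders of total size at most
   [k * |x| + 5 * k * |t|]; [k <= 1] absorbs the products of remainders *)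
move=> e0; set k := Num.min (e / 5) 1.
have k0 : 0 < k by rewrite lt_min ltr01 divr_gt0.
have k1 : k <= 1 by rewrite ge_min lexx orbT.
have ke : 5 * k <= e by rewrite mulrC -ler_pdivlMr// ge_min lexx.
have [d1 d10 h1] := real_derive_approx (is_derive_expR 0) k0.
have [d2 d20 h2] := real_derive_approx (is_derive_cos 0) k0.
have [d3 d30 h3] := real_derive_approx (is_derive_sin 0) k0.
exists (Num.min (Num.min d1 d2) (Num.min d3 (k / 2))).
  by rewrite !lt_min d10 d20 d30 divr_gt0.
move=> x t; rewrite !lt_min => /andP[/andP[x1 _] /andP[_ x4]].
move=> /andP[/andP[_ t2] /andP[t3 _]].
move: {h1}(h1 x) {h2}(h2 t) {h3}(h3 t).
rewrite expR0 sin0 cos0 !subr0 oppr0 mul0r !mul1r !subr0.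
move=> /(_ x1) h1 /(_ t2) h2 /(_ t3) h3.
have h4 : `|expR x - 1| <= k.
  rewrite (_ : expR x - 1 = (expR x - 1 - x) + x); last by ring.
  rewrite (le_trans (ler_normD _ _))//.
  rewrite (splitr k) lerD//; last exact: ltW.
  rewrite (le_trans h1)// (le_trans _ (ltW x4))// ler_piMl//.
apply: le_trans (normc_le_ReIm _) _.
have -> : complex.Re (polar x t - 1 - (x +i* t)) =
    (expR x - 1 - x) + (expR x - 1) * (cos t - 1) + (cos t - 1).
  by rewrite /= mul0r subr0; ring.
have -> : complex.Im (polar x t - 1 - (x +i* t)) =
    (expR x - 1) * sin t + (sin t - t).
  by rewrite /= mul0r addr0 subr0; ring.
have h5 : `|sin t| <= 2 * `|t|.
  have := ler_normD (sin t - t) t; rewrite subrK => /le_trans; apply.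
  by rewrite mulr_natl mulr2n lerD2r (le_trans h3)// ler_piMl.
have h6 : `|(expR x - 1) * (cos t - 1)| <= k * `|t|.
  by rewrite normrM ler_pM// (le_trans h2)// ler_piMl.
have h7 : `|(expR x - 1) * sin t| <= k * (2 * `|t|) by rewrite normrM ler_pM.
apply: (@le_trans _ _ ((k * `|x| + k * `|t| + k * `|t|) +
    (k * (2 * `|t|) + k * `|t|))).
  rewrite lerD// (le_trans (ler_normD _ _))// lerD//.
  by rewrite (le_trans (ler_normD _ _))// lerD.
have h8 : 5 * k * (`|x| + `|t|) <= e * (`|x| + `|t|) by rewrite ler_wpM2r// addr_ge0.
apply: le_trans h8.
rewrite (_ : _ + _ = k * `|x| + 5 * (k * `|t|)); last by ring.
rewrite mulrDr lerD//; last by rewrite mulrA.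
by rewrite -mulrA ler_peMl ?ler1n// mulr_ge0// ltW.
Qed.

(** The addition law moves the expansion from the origin to any point. *)
Lemma polar_approx x0 t0 (e : R) : 0 < e ->
  exists2 d : R, 0 < d & forall x t, `|x - x0| < d -> `|t - t0| < d ->
    normc (polar x t - polar x0 t0 - polar x0 t0 * ((x - x0) +i* (t - t0)))
      <= e * (`|x - x0| + `|t - t0|).
Proof.
move=> e0; have e1 : 0 < e / expR x0 by rewrite divr_gt0// expR_gt0.
have [d d0 hd] := polar_approx0 e1; exists d => // x t hx ht.
rewrite -[in polar x t](subrK x0 x) -[in polar _ t](subrK t0 t) polarD.
rewrite (_ : _ - _ - _ = polar x0 t0 *
  (polar (x - x0) (t - t0) - 1 - ((x - x0) +i* (t - t0)))); last by ring.
rewrite [leLHS]normcM normc_polar mulrC -ler_pdivlMr ?expR_gt0// mulrAC.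
exact: hd.
Qed.

(** In the coordinates z = exp (x + i t), the form h(z) dz / (i z) is
    h(z) (dt - i dx); its real and imaginary parts are closed wherever h is
    complex differentiable, by the Cauchy-Riemann equations. *)
Lemma derivable_polar_closed h x0 t0 : derivable h (polar x0 t0) 1 ->
  closed_at (fun x t => complex.Im (h (polar x t)))
            (fun x t => complex.Re (h (polar x t))) x0 t0 /\
  closed_at (fun x t => - complex.Re (h (polar x t)))
            (fun x t => complex.Im (h (polar x t))) x0 t0.
Proof.
move=> dh; set z0 := polar x0 t0; set c := 'D_1 h z0.
pose k := c * z0.
have main : forall e : R, 0 < e -> exists2 d : R, 0 < d & forall x t,
    `|x - x0| < d -> `|t - t0| < d ->
    normc (h (polar x t) - h z0 - k * ((x - x0) +i* (t - t0)))
      <= e * (`|x - x0| + `|t - t0|).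
  move=> e e0.
  have [K K0 hK] : exists2 K : R, 0 < K & exists2 d : R, 0 < d & forall x t,
      `|x - x0| < d -> `|t - t0| < d ->
      normc (polar x t - z0) <= K * (`|x - x0| + `|t - t0|).
    exists (1 + normc z0); first by rewrite ltr_wpDr// normc_ge0.
    have [d d0 hd] := polar_approx x0 t0 ltr01; exists d => // x t hx ht.
    rewrite mulrDl; apply: le_trans (lerD (hd _ _ hx ht)
      (_ : normc (z0 * ((x - x0) +i* (t - t0))) <= _)).
      apply: le_trans (le_normcD _ _); rewrite le_eqVlt; apply/orP; left.
      by apply/eqP; congr normc; rewrite /z0; ring.
    rewrite [leLHS]normcM ler_wpM2l ?normc_ge0//.
    exact: normc_le_ReIm.
  have [d2 d20 {}hK] := hK.
  have e1 : 0 < e / 2 / K by rewrite !divr_gt0.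
  have [d1 d10 h1] := derivable_approx dh e1.
  have c1 : 0 < 1 + normc c by rewrite ltr_wpDr// normc_ge0.
  have e2 : 0 < e / 2 / (1 + normc c) by rewrite !divr_gt0.
  have [d3 d30 h3] := polar_approx x0 t0 e2.
  pose d := Num.min (Num.min d2 d3) (d1 / (2 * K)).
  exists d; first by rewrite /d !lt_min d20 d30 divr_gt0// mulr_gt0.
  move=> x t; rewrite /d !lt_min => /andP[/andP[x2 x3] x1] /andP[/andP[t2 t3] t1].
  have n1 := hK _ _ x2 t2.
  have n2 : normc (polar x t - z0) < d1.
    apply: le_lt_trans n1 _; rewrite mulrC -ltr_pdivlMr//.
    rewrite (_ : d1 / K = d1 / (2 * K) + d1 / (2 * K)); first exact: ltrD.
    by field; rewrite gt_eqF.
  have n3 := h1 _ n2; have n4 := h3 _ _ x3 t3.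
  rewrite (_ : _ - _ - _ = (h (polar x t) - h z0 - c * (polar x t - z0)) +
    c * (polar x t - z0 - z0 * ((x - x0) +i* (t - t0)))); last by rewrite /k; ring.
  apply: le_trans (le_normcD _ _) _.
  rewrite [e in leRHS]splitr mulrDl lerD//.
    apply: le_trans n3 _; rewrite -mulrA; apply: ler_wpM2l; first by rewrite divr_ge0// ltW.
    by rewrite mulrC ler_pdivrMr// mulrC.
  rewrite [leLHS]normcM.
  apply: (@le_trans _ _ ((1 + normc c) * (e / 2 / (1 + normc c) * (`|x - x0| + `|t - t0|)))).
    by rewrite ler_pM ?normc_ge0// lerDr.
  by rewrite mulrA mulrCA divff ?gt_eqF// mulr1.
have ReB z w v : complex.Re (z - w - v) = complex.Re z - complex.Re w - complex.Re v.
  by case: z; case: w; case: v.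
have ImB z w v : complex.Im (z - w - v) = complex.Im z - complex.Im w - complex.Im v.
  by case: z; case: w; case: v.
have kRe (a b : R) : complex.Re (k * (a +i* b)) = complex.Re k * a - complex.Im k * b.
  by case: (k).
have kIm (a b : R) : complex.Im (k * (a +i* b)) = complex.Re k * b + complex.Im k * a.
  by case: (k).
split.
- exists (complex.Im k), (complex.Re k), (- complex.Im k) => e e0.
  have [d d0 hd] := main e e0; exists d => // x t hx ht.
  have := hd x t hx ht; set u := (u in normc u) => hu; split; apply: le_trans hu.
    apply: le_trans (normr_Im_le u); rewrite ImB kIm.
    by rewrite le_eqVlt; apply/orP; left; apply/eqP; congr `|_|; ring.
  apply: le_trans (normr_Re_le u); rewrite ReB kRe.
  by rewrite le_eqVlt; apply/orP; left; apply/eqP; congr `|_|; ring.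
- exists (- complex.Re k), (complex.Im k), (complex.Re k) => e e0.
  have [d d0 hd] := main e e0; exists d => // x t hx ht.
  have := hd x t hx ht; set u := (u in normc u) => hu; split; apply: le_trans hu.
    rewrite -normrN; apply: le_trans (normr_Re_le u); rewrite ReB kRe.
    by rewrite le_eqVlt; apply/orP; left; apply/eqP; congr `|_|; ring.
  apply: le_trans (normr_Im_le u); rewrite ImB kIm.
  by rewrite le_eqVlt; apply/orP; left; apply/eqP; congr `|_|; ring.
Qed.

Definition circle_integral h x : C := Cintegral `[- pi, pi] (fun t => h (polar x t)).

(** By periodicity the two radial sides of the rectangle cancel, so Goursat's
    theorem compares the integrals over the two circles directly. *)
Lemma circle_integral_constant h x1 x2 : x1 <= x2 ->
  (forall x t, x1 <= x <= x2 -> derivable h (polar x t) 1) ->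
  circle_integral h x1 = circle_integral h x2.
Proof.
move=> x12 dh.
have pi2 : - (@pi R) <= pi by rewrite ge0_cp// pi_ge0.
have cl x y : x1 <= x <= x2 -> - (@pi R) <= y <= pi -> _ :=
  fun xx _ => derivable_polar_closed (dh x y xx).
have g1 := @goursat_rectangle _ _ _ _ _ _ _ x12 pi2 (fun x y hx hy => (cl x y hx hy).1).
have g2 := @goursat_rectangle _ _ _ _ _ _ _ x12 pi2 (fun x y hx hy => (cl x y hx hy).2).
have cancel (a b c d : R) : a - b - (c - d) = 0 -> c = d -> b = a.
  by move=> abcd cd; move: abcd; rewrite cd subrr subr0 => /subr0_eq.
have sides (F : C -> R) : \int[mu]_(x in `[x1, x2]) F (h (polar x pi)) =
    \int[mu]_(x in `[x1, x2]) F (h (polar x (- pi))).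
  by apply: eq_Rintegral => x _; rewrite polar_pi.
have eRe := cancel _ _ _ _ g1 (sides (@complex.Im R)).
have eIm := cancel _ _ _ _ g2 (sides (fun z => - complex.Re z)).
by rewrite /circle_integral /Cintegral eRe eIm.
Qed.



End complex_calculus.

(** * Integrals over concentric circles *)

Section complex_integral.
Context {R : realType}.
Notation mu := (@lebesgue_measure R).
Notation C := R[i].
Implicit Types (F G : R -> C) (D : set R).

Definition Cintegrable D F :=
  mu.-integrable D (EFin \o (fun t => complex.Re (F t))) /\
  mu.-integrable D (EFin \o (fun t => complex.Im (F t))).

Lemma Re_add (z w : C) : complex.Re (z + w) = complex.Re z + complex.Re w.
Proof. by case: z; case: w. Qed.

Lemma Im_add (z w : C) : complex.Im (z + w) = complex.Im z + complex.Im w.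
Proof. by case: z; case: w. Qed.

Lemma Re_mul (z w : C) :
  complex.Re (z * w) = complex.Re z * complex.Re w - complex.Im z * complex.Im w.
Proof. by case: z; case: w. Qed.

Lemma Im_mul (z w : C) :
  complex.Im (z * w) = complex.Re z * complex.Im w + complex.Im z * complex.Re w.
Proof. by case: z; case: w. Qed.

Lemma CintegrableD D F G : measurable D ->
  Cintegrable D F -> Cintegrable D G -> Cintegrable D (fun t => F t + G t).
Proof.
move=> mD [f1 f2] [g1 g2]; split.
  rewrite (_ : (fun t => _) = (fun t => complex.Re (F t) + complex.Re (G t))).
    exact: integrable_fctD.
  by apply/funext => t; rewrite Re_add.
rewrite (_ : (fun t => _) = (fun t => complex.Im (F t) + complex.Im (G t))).
  exact: integrable_fctD.
by apply/funext => t; rewrite Im_add.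
Qed.

Lemma CintegrableZ D (c : C) F : measurable D ->
  Cintegrable D F -> Cintegrable D (fun t => c * F t).
Proof.
move=> mD [f1 f2]; split.
  rewrite (_ : (fun t => _) = (fun t => complex.Re c * complex.Re (F t) -
    complex.Im c * complex.Im (F t))).
    by apply: integrable_fctB => //; exact: integrable_fctZ.
  by apply/funext => t; rewrite Re_mul.
rewrite (_ : (fun t => _) = (fun t => complex.Re c * complex.Im (F t) +
    complex.Im c * complex.Re (F t))).
  by apply: integrable_fctD => //; exact: integrable_fctZ.
by apply/funext => t; rewrite Im_mul.
Qed.

Lemma CintegralD D F G : measurable D -> Cintegrable D F -> Cintegrable D G ->
  Cintegral D (fun t => F t + G t) = Cintegral D F + Cintegral D G.
Proof.
move=> mD [f1 f2] [g1 g2]; rewrite /Cintegral; apply/eqP.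
rewrite eq_complex Re_add Im_add /=; apply/andP; split; apply/eqP; rewrite -RintegralD//.
  by apply: eq_Rintegral => t _; rewrite Re_add.
by apply: eq_Rintegral => t _; rewrite Im_add.
Qed.

Lemma CintegralZ D (c : C) F : measurable D -> Cintegrable D F ->
  Cintegral D (fun t => c * F t) = c * Cintegral D F.
Proof.
move=> mD [f1 f2]; rewrite /Cintegral; apply/eqP.
rewrite eq_complex Re_mul Im_mul /=; apply/andP; split; apply/eqP.
  rewrite -!RintegralZl// -RintegralB//; try exact: integrable_fctZ.
  by apply: eq_Rintegral => t _; rewrite Re_mul.
rewrite -!RintegralZl// -RintegralD//; try exact: integrable_fctZ.
by apply: eq_Rintegral => t _; rewrite Im_mul.
Qed.

Lemma eq_Cintegral D F G : {in D, F =1 G} -> Cintegral D F = Cintegral D G.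
Proof.
by move=> FG; congr (_ +i* _); apply: eq_Rintegral => t tD; rewrite FG.
Qed.

Lemma Cintegral_conj D F : measurable D -> Cintegrable D F ->
  Cintegral D (fun t => conjc (F t)) = conjc (Cintegral D F).
Proof.
move=> mD [f1 f2]; rewrite /Cintegral /=; congr (_ +i* _).
  by apply: eq_Rintegral => t _; case: (F t).
rewrite -mulN1r -RintegralZl//.
by apply: eq_Rintegral => t _; rewrite mulN1r; case: (F t).
Qed.

End complex_integral.

Section cauchy.
Context {R : realType}.
Notation mu := (@lebesgue_measure R).
Notation C := R[i].
Implicit Types (z w : C) (x t : R) (f g h : C -> C).

Lemma continuous_Re z : {for z, continuous (@complex.Re R : C -> R)}.
Proof.
apply/(@cvgrPdist_lt R R C (nbhs z)) => e e0; apply/nbhs_normcP; exists e => // w wz.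
rewrite distrC (_ : _ - _ = complex.Re (w - z)); last by case: w {wz}; case: z.
exact: le_lt_trans (normr_Re_le _) wz.
Qed.

Lemma continuous_Im z : {for z, continuous (@complex.Im R : C -> R)}.
Proof.
apply/(@cvgrPdist_lt R R C (nbhs z)) => e e0; apply/nbhs_normcP; exists e => // w wz.
rewrite distrC (_ : _ - _ = complex.Im (w - z)); last by case: w {wz}; case: z.
exact: le_lt_trans (normr_Im_le _) wz.
Qed.

Lemma continuous_polar (x0 t0 : R) :
  {for x0, continuous (polar ^~ t0)} /\ {for t0, continuous (polar x0)}.
Proof.
have c0 : 0 < 1 + normc (polar x0 t0) by rewrite ltr_wpDr// normc_ge0.
have [d d0 hd] := polar_approx x0 t0 ltr01.
have bound x t : `|x - x0| < d -> `|t - t0| < d ->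
    normc (polar x t - polar x0 t0) <= (1 + normc (polar x0 t0)) * (`|x - x0| + `|t - t0|).
  move=> hx ht; have := hd _ _ hx ht.
  set u := polar x0 t0 * _ => hu; rewrite -(subrK u (polar x t - _)).
  rewrite (le_trans (le_normcD _ _))// mulrDl lerD//.
  by rewrite [leLHS]normcM ler_wpM2l ?normc_ge0// (le_trans (normc_le_ReIm _)).
split.
- move=> A /nbhs_normcP[e e0 eA].
  apply/nbhs_ballP; exists (Num.min d (e / (1 + normc (polar x0 t0)))) => /=.
    by rewrite lt_min d0 divr_gt0.
  move=> x; rewrite /ball/= distrC lt_min => /andP[xd xe]; apply: eA.
  apply: le_lt_trans (bound _ _ xd _) _; first by rewrite subrr normr0.
  by rewrite subrr normr0 addr0 mulrC -ltr_pdivlMr.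
- move=> A /nbhs_normcP[e e0 eA].
  apply/nbhs_ballP; exists (Num.min d (e / (1 + normc (polar x0 t0)))) => /=.
    by rewrite lt_min d0 divr_gt0.
  move=> x; rewrite /ball/= distrC lt_min => /andP[xd xe]; apply: eA.
  apply: le_lt_trans (bound _ _ _ xd) _; first by rewrite subrr normr0.
  by rewrite subrr normr0 add0r mulrC -ltr_pdivlMr.
Qed.

Lemma continuous_comp_polar (F : C -> R) h x t :
  (forall z, {for z, continuous F}) -> {for polar x t, continuous h} ->
  {for x, continuous (fun x => F (h (polar x t)))} /\
  {for t, continuous (fun t => F (h (polar x t)))}.
Proof.
move=> cF ch; have [c1 c2] := continuous_polar x t.
have cFh : {for polar x t, continuous (F \o h)}.
  exact: (@continuous_comp C C R h F _ ch (cF _)).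
split.
  exact: (@continuous_comp R C R (polar ^~ t) (F \o h) _ c1 cFh).
exact: (@continuous_comp R C R (polar x) (F \o h) _ c2 cFh).
Qed.

Lemma circle_integrable h x : (forall t, {for polar x t, continuous h}) ->
  Cintegrable `[- pi, pi] (fun t => h (polar x t)).
Proof.
move=> ch; split; apply: integrable_itvcc => t _.
  by have [] := continuous_comp_polar continuous_Re (ch t).
by have [] := continuous_comp_polar continuous_Im (ch t).
Qed.

Lemma ltNpipi : - pi < pi :> R.
Proof. by rewrite gtrN// pi_gt0. Qed.

(** Mean value property: shrink the circle to its centre, where [h] is
    continuous. *)
Lemma circle_integral_center h x :
  (forall w, normc w <= expR x -> derivable h w 1) ->
  circle_integral h x = (2 * pi)%:C * h 0.
Proof.
move=> dh.
have dhp y t : y <= x -> derivable h (polar y t) 1.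
  by move=> yx; apply: dh; rewrite normc_polar ler_expR.
have cst y : y <= x -> circle_integral h y = circle_integral h x.
  by move=> yx; apply: circle_integral_constant => // y' t /andP[_]; exact: dhp.
have ch0 : {for 0, continuous h}.
  by apply: derivable_continuous; apply: dh; rewrite normc0 expR_ge0.
have part (F : C -> R) : (forall z, {for z, continuous F}) ->
    (forall z w, `|F z - F w| <= normc (z - w)) ->
    (forall y, y <= x -> \int[mu]_(t in `[- pi, pi]) F (h (polar y t)) =
      \int[mu]_(t in `[- pi, pi]) F (h (polar x t))) ->
    \int[mu]_(t in `[- pi, pi]) F (h (polar x t)) = F (h 0) * (2 * pi).
  move=> cF lF Fy; apply/eqP; rewrite -subr_eq0 -normr_le0; apply/ler_addgt0Pl => e e0.
  have e1 : 0 < e / (2 * pi) :> R by rewrite divr_gt0// mulr_gt0 ?pi_gt0.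
  have [d d0 hd] : exists2 d : R, 0 < d & forall w, normc w < d ->
      `|F (h w) - F (h 0)| <= e / (2 * pi).
    have : {for 0, continuous (F \o h)} by exact: continuous_comp.
    move/cvgrPdist_le => /(_ _ e1)/nbhs_normcP[d d0 hd]; exists d => // w wd.
    by rewrite distrC; apply: hd; rewrite subr0.
  pose y := Num.min x (ln (d / 2)).
  have yx : y <= x by rewrite ge_min lexx.
  have yd : expR y < d.
    rewrite (@le_lt_trans _ _ (d / 2))// ?ltr_pdivrMr// ?ltr_pMr// ?ltr1n//.
    by rewrite -[leRHS]lnK ?posrE ?divr_gt0// ler_expR ge_min lexx orbT.
  rewrite addr0 -(Fy _ yx).
  have := @Rintegral_near_cst _ (fun t => F (h (polar y t))) (- pi) pi (F (h 0)) _
    (ltW ltNpipi).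
  have -> : pi - - pi = 2 * pi :> R by rewrite opprK mulr_natl mulr2n.
  move=> /(_ (e / (2 * pi))); rewrite divfK; last first.
    by rewrite gt_eqF// mulr_gt0// pi_gt0.
  apply.
    apply: integrable_itvcc => t _.
    have := derivable_continuous (dhp _ t yx).
    by move=> /(continuous_comp_polar cF)[].
  by move=> t _; apply: hd; rewrite normc_polar.
have ReB z w : complex.Re z - complex.Re w = complex.Re (z - w).
  by case: z; case: w.
have ImB z w : complex.Im z - complex.Im w = complex.Im (z - w).
  by case: z; case: w.
rewrite /circle_integral /Cintegral.
rewrite (part _ continuous_Re); first rewrite (part _ continuous_Im).
- by apply/eqP; rewrite eq_complex Re_mul Im_mul /= !mul0r subr0 addr0 !(mulrC (2 * pi)) !eqxx.
- by move=> z w; rewrite ImB normr_Im_le.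
- by move=> y yx; exact: (congr1 (@complex.Im R) (cst y yx)).
- by move=> z w; rewrite ReB normr_Re_le.
- by move=> y yx; exact: (congr1 (@complex.Re R) (cst y yx)).
Qed.

Lemma continuous_circle_integral h (u : R) (M : R) :
  (forall w, normc w < expR u -> {for w, continuous h}) ->
  (forall w, normc w < expR u -> normc (h w) <= M) ->
  forall x, x < u -> {for x, continuous (fun x => complex.Re (circle_integral h x))} /\
   {for x, continuous (fun x => complex.Im (circle_integral h x))}.
Proof.
move=> ch hM x xu.
have part (F : C -> R) : (forall z, {for z, continuous F}) ->
    (forall z, `|F z| <= normc z) ->
   {for x, continuous (fun x => \int[mu]_(t in `[- pi, pi]) F (h (polar x t)))}.
  move=> cF Fn.
  have xI : x \in `]x - 1, u[%classic.
    by apply/mem_set; rewrite /= in_itv /= xu andbT gtrBl.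
  have hc y t : `]x - 1, u[%classic y -> {for polar y t, continuous h}.
    by rewrite /= in_itv /= => /andP[_ yu]; apply: ch; rewrite normc_polar ltr_expR.
  apply: (@continuity_under_integral _ _ _ mu (fun x t => F (h (polar x t))) `[- pi, pi]
    _ (x - 1) u _ _ (cst M)) => //.
  - move=> y yI; apply: integrable_itvcc => t _.
    by have [] := continuous_comp_polar cF (hc _ t yI).
  - apply: aeW => t _ y /set_mem yI.
    by have [] := continuous_comp_polar cF (hc _ t yI).
  - by apply: integrable_itvcc => t _; exact: cvg_cst.
  - move=> y yI; apply: aeW => t _; apply: le_trans (Fn _) _; apply: hM.
    by rewrite normc_polar ltr_expR; move: yI; rewrite /= in_itv /= => /andP[].
split; first exact: (part _ continuous_Re normr_Re_le).
exact: (part _ continuous_Im normr_Im_le).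
Qed.

End cauchy.

(** * Poisson's formula in a disk of radius larger than 1 *)

Section poisson_formula.
Context {R : realType}.
Notation mu := (@lebesgue_measure R).
Notation C := R[i].
Implicit Types (z w : C) (x t u : R) (f g h : C -> C).

Lemma constant_left_limit (F : R -> R) x0 (c : R) : {for x0, continuous F} ->
  (forall x, x < x0 -> F x = c) -> F x0 = c.
Proof.
move=> cF Fc; apply/eqP; rewrite -subr_eq0 -normr_le0; apply/ler_addgt0Pl => e e0.
move/cvgrPdist_le: cF => /(_ _ e0)/nbhs_ballP[d /= d0 hd].
rewrite addr0 -(Fc (x0 - d / 2)) ?gtrBl ?divr_gt0//; apply: hd.
rewrite /ball /= opprB addrC subrK ger0_norm ?divr_ge0 ?ltW//.
by rewrite ltr_pdivrMr// ltr_pMr// ltr1n.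
Qed.

Lemma constant_right_limit (F : R -> R) x0 u (c : R) : x0 < u -> {for x0, continuous F} ->
  (forall x, x0 < x < u -> F x = c) -> F x0 = c.
Proof.
move=> x0u cF Fc; apply/eqP; rewrite -subr_eq0 -normr_le0; apply/ler_addgt0Pl => e e0.
move/cvgrPdist_le: cF => /(_ _ e0)/nbhs_ballP[d /= d0 hd].
pose y := x0 + Num.min (d / 2) ((u - x0) / 2).
have m0 : 0 < Num.min (d / 2) ((u - x0) / 2).
  by rewrite lt_min !divr_gt0// subr_gt0.
rewrite addr0 -(Fc y).
  apply: hd; rewrite /ball /= /y opprD addNKr normrN gtr0_norm//.
  by rewrite gt_min ltr_pdivrMr// ltr_pMr// ltr1n.
rewrite /y ltrDl m0/= -ltrBrDl gt_min; apply/orP; right.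
by rewrite ltr_pdivrMr// ltr_pMr ?subr_gt0// ltr1n.
Qed.

(** The value at [w = z] is the limit, so that the quotient is continuous. *)
Definition difference_quotient f z w : C :=
  if w == z then 'D_1 f z else (f w - f z) / (w - z).

Lemma difference_quotientE f z w : difference_quotient f z w * (w - z) = f w - f z.
Proof.
rewrite /difference_quotient; have [->|wz] := eqVneq w z.
  by rewrite !subrr mulr0.
by rewrite divfK// subr_eq0.
Qed.

Lemma difference_quotient_approx f z : derivable f z 1 -> forall e : R, 0 < e ->
  exists2 d : R, 0 < d & forall w, normc (w - z) < d ->
    normc (difference_quotient f z w - 'D_1 f z) <= e.
Proof.
move=> df e e0; have [d d0 hd] := derivable_approx df e0.
exists d => // w wz; rewrite /difference_quotient.
have [_|nwz] := eqVneq w z; first by rewrite subrr normc0 ltW.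
have nwz0 : 0 < normc (w - z).
  rewrite lt_neqAle normc_ge0 andbT eq_sym; apply/eqP => /eq0_normc /eqP.
  by rewrite subr_eq0 (negbTE nwz).
rewrite -(ler_pM2r nwz0) -[leLHS]normcM; apply: le_trans (hd _ wz).
by rewrite mulrBl divfK ?subr_eq0.
Qed.

Lemma derivable_difference_quotient f z w : w != z -> derivable f w 1 ->
  derivable (difference_quotient f z) w 1.
Proof.
move=> wz df.
have dq : derivable (fun v => (f v - f z) * (v - z)^-1) w 1.
  have d1 : derivable (fun v => f v - f z) w 1 := sub_derivable df (@cst_derivable _ _ _).
  have d2 : derivable (fun v : C => v - z) w 1 :=
    sub_derivable (@id_derivable _ _) (@cst_derivable _ _ _).
  have wz0 : w - z != 0 by rewrite subr_eq0.
  have d3 : derivable (fun v : C => (v - z)^-1) w 1 :=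
    @inv_derivable _ (fun v => v - z) w wz0 d2.
  exact: (mul_derivable d1 d3).
apply: near_eq_derivable dq; apply/nbhs_normcP.
exists (normc (w - z)).
  rewrite lt_neqAle normc_ge0 andbT eq_sym; apply/eqP => /eq0_normc /eqP.
  by rewrite subr_eq0 (negbTE wz).
move=> v hv; rewrite /difference_quotient; case: eqVneq => // vz.
by move: hv; rewrite vz -opprB normcN ltxx.
Qed.

Lemma continuous_difference_quotient f z : derivable f z 1 ->
  {for z, continuous (difference_quotient f z)}.
Proof.
move=> df A; rewrite {1}/difference_quotient eqxx => /nbhs_normcP[e e0 eA].
have e20 : 0 < e / 2 by rewrite divr_gt0.
have [d d0 hd] := difference_quotient_approx df e20.
apply/nbhs_normcP; exists d => // w wz; apply: eA.
by rewrite (le_lt_trans (hd _ wz))// ltr_pdivrMr// ltr_pMr// ltr1n.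
Qed.

(** Near [z] the quotient is close to the derivative; away from [z] the bound on
    [f] suffices. *)
Lemma difference_quotient_bounded f z (M r : R) :
  derivable f z 1 -> normc z < r -> (forall w, normc w < r -> normc (f w) <= M) ->
  exists K, forall w, normc w < r -> normc (difference_quotient f z w) <= K.
Proof.
move=> df zr fM; have [d d0 hd] := difference_quotient_approx df ltr01.
exists (Num.max (1 + normc ('D_1 f z)) (2 * M / d)) => w wr.
rewrite le_max; have [wz|wz] := ltP (normc (w - z)) d; apply/orP.
  left; rewrite -(subrK ('D_1 f z) (difference_quotient f z w)).
  by rewrite (le_trans (le_normcD _ _))// lerD2r hd.
right; rewrite ler_pdivlMr//.
apply: (@le_trans _ _ (normc (difference_quotient f z w) * normc (w - z))).
  by rewrite ler_wpM2l// normc_ge0.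
rewrite -[leLHS]normcM difference_quotientE (le_trans (le_normcD _ _))//.
by rewrite normcN mulr_natl mulr2n lerD// fM.
Qed.

(** Cauchy's formula with the kernel w / (w - z).  The integrand is possibly not
    differentiable at [z], but it is continuous there; its integral vanishes over
    the circles inside [|w| < |z|], is constant over those outside, and
    continuity in the radius joins the two regimes. *)
Lemma circle_integral_difference_quotient f z u x (M : R) :
  (forall w, normc w < expR u -> derivable f w 1) ->
  (forall w, normc w < expR u -> normc (f w) <= M) ->
  normc z < expR x -> x < u ->
  circle_integral (fun w => w * difference_quotient f z w) x = 0.
Proof.
move=> df fM zx xu; set h := fun w => _.
have zu : normc z < expR u by rewrite (lt_trans zx)// ltr_expR.
have dh w : w != z -> normc w < expR u -> derivable h w 1.
  move=> wz wu.
  exact: (mul_derivable (@id_derivable _ _) (derivable_difference_quotient wz (df _ wu))).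
have ch w : normc w < expR u -> {for w, continuous h}.
  move=> wu; have [wz|wz] := eqVneq w z; last exact: derivable_continuous (dh _ wz wu).
  have c1 : {for w, continuous (fun v : C => v)} by exact: cvg_id.
  have c2 : {for w, continuous (difference_quotient f z)}.
    by rewrite wz; apply: continuous_difference_quotient; exact: df.
  exact: (continuousM c1 c2).
have [K hK] := difference_quotient_bounded (df _ zu) zu fM.
have hM w : normc w < expR u -> normc (h w) <= expR u * K.
  by move=> wu; rewrite [leLHS]normcM ler_pM ?normc_ge0 ?hK// ltW.
have [z0|z0] := eqVneq z 0.
  have hE : h = fun w => f w - f 0.
    by apply/funext => w; rewrite /h mulrC -difference_quotientE z0 subr0.
  rewrite hE circle_integral_center ?subrr ?mulr0// => w wx.
  have wu : normc w < expR u by rewrite (le_lt_trans wx)// ltr_expR.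
  exact: (sub_derivable (df _ wu) (@cst_derivable _ _ _)).
have nz0 : 0 < normc z.
  by rewrite lt_neqAle normc_ge0 andbT eq_sym; apply/eqP => /eq0_normc /eqP; exact/negP.
pose x0 := ln (normc z); have ex0 : expR x0 = normc z by rewrite lnK.
have x0x : x0 < x by rewrite -ltr_expR ex0.
have off_z w : normc w != expR x0 -> w != z by rewrite ex0; apply: contraNN => /eqP ->.
have inner y : y < x0 -> circle_integral h y = 0.
  move=> yx0; rewrite circle_integral_center /h ?mul0r ?mulr0// => w wy.
  apply: dh.
    by apply: off_z; rewrite lt_eqF// (le_lt_trans wy)// ltr_expR.
  by rewrite (le_lt_trans wy)// ltr_expR (lt_trans yx0)// (lt_trans x0x).
have outer y : x0 < y < x -> circle_integral h y = circle_integral h x.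
  move=> /andP[x0y yx]; apply: circle_integral_constant; first exact: ltW.
  move=> x' t /andP[yx' x'x]; apply: dh; rewrite ?normc_polar.
    by apply: off_z; rewrite normc_polar gt_eqF// ltr_expR (lt_le_trans x0y).
  by rewrite ltr_expR (le_lt_trans x'x).
have [cRe cIm] := continuous_circle_integral ch hM (lt_trans x0x xu).
have e1 := constant_left_limit cRe (fun y yx => congr1 (@complex.Re R) (inner y yx)).
have e2 := constant_left_limit cIm (fun y yx => congr1 (@complex.Im R) (inner y yx)).
have e3 := constant_right_limit x0x cRe (fun y yx => congr1 (@complex.Re R) (outer y yx)).
have e4 := constant_right_limit x0x cIm (fun y yx => congr1 (@complex.Im R) (outer y yx)).
apply/eqP; rewrite eq_complex -e3 -e4; apply/andP; split; apply/eqP; [exact: e1|exact: e2].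
Qed.

Lemma one_sub_conjM_neq0 z w : normc z < 1 -> normc w <= 1 -> 1 - conjc z * w != 0.
Proof.
move=> z1 w1; rewrite subr_eq0; apply/eqP => h.
have : normc (conjc z * w) = 1 by rewrite -h normc1.
rewrite normcM (_ : normc (conjc z) = normc z); last first.
  by case: z {z1 h} => a b /=; rewrite sqrrN.
move=> h1; have : normc z * normc w < 1 by rewrite (le_lt_trans _ z1)// ler_piMr// normc_ge0.
by rewrite h1 ltxx.
Qed.

Lemma derivable_conj_kernel z w : normc z < 1 -> normc w <= 1 ->
  derivable (fun v : C => (1 - conjc z * v)^-1) w 1.
Proof.
move=> z1 w1; have nz := one_sub_conjM_neq0 z1 w1.
have d1 : derivable (fun v : C => 1 - conjc z * v) w 1 :=
  sub_derivable (@cst_derivable _ _ _) (mul_derivable (@cst_derivable _ _ _) (@id_derivable _ _)).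
exact: (@inv_derivable _ (fun v => 1 - conjc z * v) w nz d1).
Qed.

(** On the circle [conj w = 1 / w], so the kernel's denominator [|w - z|^2] factors
    as [(w - z) (1 - conj z * w) / w]; the rest is a partial fraction
    decomposition. *)
Lemma poisson_kernelE (r s t : R) : 0 <= r -> r < 1 ->
  let z : C := r%:C * val (expi s) in let w : C := polar 0 t in
  [/\ w - z != 0, normc z = r, w^-1 = conjc w &
  (poisson_kernel r (s - t))%:C = w / (w - z) + conjc z * w / (1 - conjc z * w)].
Proof.
move=> r0 r1 z w.
have wE : w = cos t +i* sin t by rewrite /w /polar expR0 mul1r.
have zE : z = (r * cos s) +i* (r * sin s).
  by rewrite /z; apply/eqP; rewrite eq_complex /= !mul0r subr0 addr0 !eqxx.
have nz : normc z = r.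
  rewrite zE /= !exprMn -mulrDr cos2Dsin2 mulr1 sqrtr_sqr ger0_norm//.
have nw : normc w = 1 by rewrite normc_polar expR0.
have wz : w - z != 0.
  by rewrite subr_eq0; apply/eqP => h; move: nw; rewrite h nz => h1; rewrite h1 ltxx in r1.
have ww : w * conjc w = 1.
  rewrite wE; apply/eqP; rewrite eq_complex /=; apply/andP; split; apply/eqP.
    by rewrite mulrN opprK -!expr2 cos2Dsin2.
  by ring.
have w0 : w != 0 by exact: polar_neq0.
have wV : w^-1 = conjc w by rewrite -[LHS]mulr1 -ww mulKf.
split => //.
have zw : 1 - conjc z * w != 0 by apply: one_sub_conjM_neq0; rewrite ?nz ?nw.
have r2 : r ^+ 2 = r ^+ 2 * (cos s ^+ 2 + sin s ^+ 2) by rewrite cos2Dsin2 mulr1.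
have D : (1 - 2 * r * cos (s - t) + r ^+ 2)%:C = (w - z) * (1 - conjc z * w) / w.
  rewrite wV mulrBr mulr1 mulrBl.
  have -> : (w - z) * conjc w - (w - z) * (conjc z * w) * conjc w =
    w * conjc w - z * conjc w - (w - z) * conjc z * (w * conjc w) by ring.
  rewrite ww zE wE cosB; apply/eqP; rewrite eq_complex /=; apply/andP; split; apply/eqP.
    by rewrite [in LHS]r2; ring.
  by ring.
have N : (1 - r ^+ 2)%:C = 1 - z * conjc z.
  rewrite zE; apply/eqP; rewrite eq_complex /=; apply/andP; split; apply/eqP.
    by rewrite [in LHS]r2; ring.
  by ring.
rewrite /poisson_kernel rmorphM fmorphV /= N D.
have key (a b c : C) : a != 0 -> a - b != 0 -> 1 - c * a != 0 ->
    (1 - b * c) * ((a - b) * (1 - c * a) / a)^-1 = a / (a - b) + c * a / (1 - c * a).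
  by move=> *; field; do ! (apply/andP; split).
exact: key.
Qed.

(** Split the kernel by [poisson_kernelE].  In the first term, [f w - f z]
    contributes nothing by Cauchy's formula and the mean of [w / (w - z)] is the
    conjugate of the mean of [1 / (1 - conj z * w)], which is 1; the second term
    is analytic in the disk and vanishes at the centre. *)
Lemma circle_poisson_formula f (u M r s : R) : 0 < u ->
  (forall w, normc w < expR u -> derivable f w 1) ->
  (forall w, normc w < expR u -> normc (f w) <= M) ->
  0 <= r -> r < 1 ->
  Cintegral `[- pi, pi] (fun t => f (polar 0 t) * (poisson_kernel r (s - t))%:C) =
  (2 * pi)%:C * f (r%:C * val (expi s)).
Proof.
move=> u0 df fM r0 r1; set z := r%:C * _.
have nz : normc z = r by have [] := poisson_kernelE s 0 r0 r1.
have z1 : normc z < 1 by rewrite nz.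
have u1 : 1 < expR u by rewrite -[ltLHS]expR0 ltr_expR.
pose h1 w := w * difference_quotient f z w.
pose h2 w := (1 - conjc z * w)^-1.
pose h3 w := f w * (h2 w - 1).
have dh2 w : normc w <= 1 -> derivable h2 w 1 by exact: derivable_conj_kernel.
have dh3 w : normc w <= 1 -> derivable h3 w 1.
  move=> w1; have wu : normc w < expR u by exact: le_lt_trans w1 u1.
  exact: (@mul_derivable _ f (fun v => h2 v - 1) w (df _ wu)
    (@sub_derivable _ h2 (fun=> 1) w (dh2 _ w1) (@cst_derivable _ _ _))).
have n1 t : normc (polar 0 t : C) <= 1 by rewrite normc_polar expR0.
have I1 : circle_integral h1 0 = 0.
  by apply: (circle_integral_difference_quotient df fM); rewrite ?expR0.
have I2 : circle_integral h2 0 = (2 * pi)%:C.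
  rewrite circle_integral_center; last by move=> w; rewrite expR0; exact: dh2.
  rewrite /h2.
  by rewrite mulr0 subr0 invr1 mulr1.
have I3 : circle_integral h3 0 = 0.
  rewrite circle_integral_center; last by move=> w; rewrite expR0; exact: dh3.
  rewrite /h3 /h2.
  by rewrite mulr0 subr0 invr1 subrr !mulr0.
have J1 : Cintegrable `[- pi, pi] (fun t => h1 (polar 0 t)).
  apply: circle_integrable => t; apply: derivable_continuous.
  have wz : polar 0 t != z.
    by apply/eqP => h; have := normc_polar 0 t; rewrite h expR0 => h'; rewrite h' ltxx in z1.
  have wu : normc (polar 0 t) < expR u by exact: le_lt_trans (n1 t) u1.
  exact: (mul_derivable (@id_derivable _ _) (derivable_difference_quotient wz (df _ wu))).
have J2 : Cintegrable `[- pi, pi] (fun t => h2 (polar 0 t)).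
  by apply: circle_integrable => t; apply: derivable_continuous; exact: dh2.
have J3 : Cintegrable `[- pi, pi] (fun t => h3 (polar 0 t)).
  by apply: circle_integrable => t; apply: derivable_continuous; exact: dh3.
have J2' : Cintegrable `[- pi, pi] (fun t => conjc (h2 (polar 0 t))).
  case: J2 => J21 J22; split.
    by rewrite (_ : (fun t => _) = (fun t => complex.Re (h2 (polar 0 t))))//.
  rewrite (_ : (fun t => _) = (fun t => (-1) * complex.Im (h2 (polar 0 t)))).
    exact: integrable_fctZ.
  by apply/funext => t; rewrite mulN1r; case: (h2 _).
rewrite (@eq_Cintegral _ _ _ (fun t => h1 (polar 0 t) +
    (f z * conjc (h2 (polar 0 t)) + h3 (polar 0 t)))).
  rewrite CintegralD//; last first.
    by apply: CintegrableD => //; exact: CintegrableZ.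
  rewrite CintegralD//; last exact: CintegrableZ.
  rewrite CintegralZ// Cintegral_conj//.
  move: I1 I2 I3; rewrite /circle_integral => -> -> ->.
  rewrite add0r addr0 mulrC; congr (_ * _).
  by apply/eqP; rewrite eq_complex /= oppr0 !eqxx.
move=> t _; set w := polar 0 t; have [wz _ wV ->] := poisson_kernelE s t r0 r1.
rewrite -/z -/w in wz wV *.
have w0 : w != 0 by exact: polar_neq0.
have nzw := one_sub_conjM_neq0 z1 (n1 t); rewrite -/w in nzw.
have -> : conjc (h2 w) = w / (w - z).
  have cK : conjc (1 - conjc z * w) = 1 - z * conjc w.
    by rewrite rmorphB rmorphM rmorph1; case: (z) => a b; rewrite /= opprK.
  have cV (a : C) : conjc a^-1 = (conjc a)^-1 by exact: fmorphV.
  rewrite /h2 cV cK -wV.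
  have key (a b : C) : a != 0 -> a - b != 0 -> (1 - b / a)^-1 = a / (a - b).
    by move=> *; field; do ! (apply/andP; split).
  exact: key.
rewrite /h1 /h3 /h2 -/w.
have -> : w * difference_quotient f z w = w / (w - z) * (f w - f z).
  have key (a b q : C) : b != 0 -> a * q = a / b * (q * b) by move=> *; field.
  by rewrite -difference_quotientE; exact: key.
have key (a b c d e : C) : a - b != 0 ->
    c * (a / (a - b) + e) = a / (a - b) * (c - d) + (d * (a / (a - b)) + c * e).
  by move=> *; field.
rewrite (key _ _ _ (f z))//; congr (_ + (_ + _ * _)).
have key2 (a : C) : 1 - a != 0 -> a / (1 - a) = (1 - a)^-1 - 1.
  by move=> *; field.
exact: key2.
Qed.

End poisson_formula.

(** * Square means over circles *)

Section square_means.
Context {R : realType}.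
Notation mu := (@lebesgue_measure R).
Notation C := R[i].
Implicit Types (z w : C) (x y t : R) (f g h : C -> C).

Lemma normc_conjc z : normc (conjc z) = normc z.
Proof. by case: z => a b /=; rewrite sqrrN. Qed.

Lemma normc_sqrE z : normc z ^+ 2 = complex.Re z ^+ 2 + complex.Im z ^+ 2.
Proof. by case: z => a b /=; rewrite sqr_sqrtr// addr_ge0// sqr_ge0. Qed.

(** Schwarz reflection. *)
Lemma derivable_conj f z : derivable f (conjc z) 1 ->
  derivable (fun w => conjc (f (conjc w))) z 1.
Proof.
move=> df; apply/cvg_ex; exists (conjc ('D_1 f (conjc z))).
apply/cvgrPdist_le => e e0; rewrite near_withinE; apply/nbhs_normcP.
have e0' : 0 < complex.Re e by move: e0; rewrite ltcE => /andP[].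
have eE : e = (complex.Re e)%:C.
  by apply/eqP; rewrite eq_complex /= eqxx /=; move: e0; rewrite ltcE => /andP[].
have [d d0 hd] := derivable_approx df e0'.
exists d => // w; rewrite subr0 => wd w0 /=.
have := hd (conjc (w + z)).
have -> : conjc (w + z) - conjc z = conjc w by rewrite raddfD /= addrK.
rewrite normc_conjc => /(_ wd) hh.
rewrite [_ *: 1]mulr1 /GRing.scale /=.
rewrite eE; change ((normc (conjc ('D_1 f (conjc z)) - w^-1 * (conjc (f (conjc (w + z))) -
   conjc (f (conjc z)))))%:C <= (complex.Re e)%:C); rewrite lecR.
have w0n : 0 < normc w.
  by rewrite lt_neqAle normc_ge0 andbT eq_sym; apply/eqP => /eq0_normc /eqP; exact/negP.
rewrite -(ler_pM2r w0n) -[leLHS]normcM; apply: le_trans hh.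
rewrite -normc_conjc -[leLHS]normcN le_eqVlt; apply/orP; left; apply/eqP; congr normc.
have cM (a b : C) : conjc (a * b) = conjc a * conjc b by exact: rmorphM.
have cB (a b : C) : conjc (a - b) = conjc a - conjc b by exact: raddfB.
have cV (a : C) : conjc (a^-1) = (conjc a)^-1 by exact: fmorphV.
have cK (a : C) : conjc (conjc a) = a by case: a => a b /=; rewrite opprK.
rewrite cM !cB !cK cM cV !cB !cK -mulNr opprB mulrBl.
congr (_ - _); rewrite mulrAC mulVf ?mul1r//.
by apply: contraNneq w0 => cw; rewrite -(cK w) cw /= oppr0.
Qed.

Variables (F : C -> C) (M : R).
Hypothesis dF : forall w, normc w < 1 -> derivable F w 1.
Hypothesis FM : forall w, normc w < 1 -> normc (F w) <= M.

Let cF x t : x < 0 -> {for polar x t, continuous F}.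
Proof. by move=> x0; apply: derivable_continuous; apply: dF; exact: normc_polar_lt1. Qed.

Let cpart (p : C -> R) x : (forall z, {for z, continuous p}) -> x < 0 ->
  forall t, {for t, continuous (fun t => p (F (polar x t)))}.
Proof. by move=> cp x0 t; have [] := continuous_comp_polar cp (@cF x t x0). Qed.

Let intg (u : R -> R) : (forall t, {for t, continuous u}) ->
  mu.-integrable `[- pi, pi] (EFin \o u).
Proof. by move=> cu; apply: integrable_itvcc => t _; exact: cu. Qed.

Definition square_mean x : R :=
  \int[mu]_(t in `[- pi, pi]) normc (F (polar x t)) ^+ 2.

Let Ref x t := complex.Re (F (polar x t)).
Let Imf x t := complex.Im (F (polar x t)).

Let cRe x : x < 0 -> forall t, {for t, continuous (Ref x)}.
Proof. exact: (cpart continuous_Re). Qed.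
Let cIm x : x < 0 -> forall t, {for t, continuous (Imf x)}.
Proof. exact: (cpart continuous_Im). Qed.

Let continuous_corr x y : x < 0 -> y < 0 -> forall t,
  {for t, continuous (fun t => Ref x t * Ref y t + Imf x t * Imf y t)}.
Proof.
move=> x0 y0 t.
have c1 : {for t, continuous (fun t => Ref x t * Ref y t)} :=
  continuousM (@cRe x x0 t) (@cRe y y0 t).
have c2 : {for t, continuous (fun t => Imf x t * Imf y t)} :=
  continuousM (@cIm x x0 t) (@cIm y y0 t).
exact: continuousD c1 c2.
Qed.

Let square_meanE x : square_mean x =
  \int[mu]_(t in `[- pi, pi]) (Ref x t * Ref x t + Imf x t * Imf x t).
Proof. by apply: eq_Rintegral => t _; rewrite normc_sqrE !expr2. Qed.

(** The correlation of the values on two circles depends only on the product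
    of the radii: the integrand below is analytic between the two circles, and
    on the circle of radius exp x' it pairs exp (x' + i t) with the point of
    the same argument and modulus exp (x + y - x'). *)
Lemma correlation x y : x < 0 -> y < 0 ->
  \int[mu]_(t in `[- pi, pi]) (Ref x t * Ref y t + Imf x t * Imf y t) =
  square_mean ((x + y) / 2).
Proof.
wlog xy : x y / x <= y.
  move=> H x0 y0; have [xy|/ltW yx] := leP x y; first exact: H.
  rewrite (addrC x) -(H _ _ yx y0 x0); apply: eq_Rintegral => t _.
  by congr (_ + _); exact: mulrC.
move=> x0 y0; set m := (x + y) / 2.
have xm : x <= m by rewrite /m; lra.
have my : m <= y by rewrite /m; lra.
pose c : C := (expR (x + y))%:C.
pose h w := F w * conjc (F (conjc (c / w))).
have cE x' t : conjc (c / polar x' t) = polar (x + y - x') t.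
  have -> : c / polar x' t = polar (x + y - x') (- t).
    apply: (mulIf (polar_neq0 x' t)); rewrite divfK ?polar_neq0//.
    rewrite -polarD subrK addNr /polar /= cos0 sin0.
    by rewrite /c; apply/eqP; rewrite eq_complex /= !mulr0 mul0r mulr1 subr0 addr0 !eqxx.
  rewrite /polar /= cosN sinN; apply/eqP; rewrite eq_complex /=.
  by rewrite !(mul0r, mulr0, subr0, addr0) mulrN opprK !eqxx.
have hE x' t : h (polar x' t) = F (polar x' t) * conjc (F (polar (x + y - x') t)).
  by rewrite /h cE.
have dh x' t : x <= x' <= m -> derivable h (polar x' t) 1.
  move=> /andP[xx' x'm]; have x'0 : x' < 0 by lra.
  have y'0 : x + y - x' < 0 by lra.
  have d1 : derivable F (polar x' t) 1 by apply: dF; exact: normc_polar_lt1.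
  have d2 : derivable (fun w : C => c * w^-1) (polar x' t) 1.
    exact: (@mul_derivable _ (fun=> c) (fun w => w^-1) _ (@cst_derivable _ _ _)
      (@inv_derivable _ (fun w => w) _ (polar_neq0 _ _) (@id_derivable _ _))).
  have d3 : derivable (fun w => conjc (F (conjc w))) (c * (polar x' t)^-1) 1.
    by apply: derivable_conj; rewrite cE; apply: dF; exact: normc_polar_lt1.
  exact: (@mul_derivable _ F _ _ d1 (@derivable_comp1 _ (fun w => c * w^-1) _ _ d2 d3)).
have := circle_integral_constant xm dh => /(congr1 (@complex.Re R)).
rewrite /circle_integral /Cintegral /=.
have ReC (a b : C) : complex.Re (a * conjc b) =
    complex.Re a * complex.Re b + complex.Im a * complex.Im b.
  by case: a; case: b => /= *; rewrite mulrN opprK.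
have e1 : \int[mu]_(t in `[- pi, pi]) complex.Re (h (polar x t)) =
    \int[mu]_(t in `[- pi, pi]) (Ref x t * Ref y t + Imf x t * Imf y t).
  by apply: eq_Rintegral => t _; rewrite hE ReC addrAC subrr add0r.
have e2 : \int[mu]_(t in `[- pi, pi]) complex.Re (h (polar m t)) = square_mean m.
  rewrite square_meanE; apply: eq_Rintegral => t _; rewrite hE ReC.
  by rewrite (_ : x + y - m = m)// /m; lra.
by rewrite e1 e2.
Qed.

(** Expand the square: the cross term is the correlation of the two circles. *)
Lemma square_distance x y : x < 0 -> y < 0 ->
  \int[mu]_(t in `[- pi, pi]) normc (F (polar x t) - F (polar y t)) ^+ 2 =
  square_mean x + square_mean y - 2 * square_mean ((x + y) / 2).
Proof.
move=> x0 y0; rewrite -correlation// !square_meanE -RintegralZl//; last first.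
  by apply: intg; exact: continuous_corr.
rewrite -RintegralD//; try by apply: intg; exact: continuous_corr.
rewrite -RintegralB//; last 2 first.
- by apply: integrable_fctD => //; apply: intg; exact: continuous_corr.
- by apply: integrable_fctZ => //; apply: intg; exact: continuous_corr.
apply: eq_Rintegral => t _; rewrite normc_sqrE /Ref /Imf.
by case: (F (polar x t)); case: (F (polar y t)) => /= *; ring.
Qed.

Lemma square_mean_le x : x < 0 -> square_mean x <= 2 * pi * M ^+ 2.
Proof.
move=> x0; have -> : 2 * pi * M ^+ 2 = M ^+ 2 * (pi - - pi).
  by rewrite opprK mulr_natl mulr2n mulrC.
rewrite -Rintegral_cst_itv; last exact: ltW (ltNpipi).
apply: le_Rintegral => //.
- rewrite (_ : (fun t => _) = (fun t => Ref x t * Ref x t + Imf x t * Imf x t)).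
    by apply: intg; exact: continuous_corr.
  by apply/funext => t; rewrite normc_sqrE !expr2.
- by apply: integrable_itvcc => t _; exact: cvg_cst.
- move=> t _; have h := FM (normc_polar_lt1 t x0).
  by rewrite ler_pXn2r// nnegrE ?normc_ge0// (le_trans _ h)// normc_ge0.
Qed.

Lemma square_mean_midpoint x y : x < 0 -> y < 0 ->
  2 * square_mean ((x + y) / 2) <= square_mean x + square_mean y.
Proof.
move=> x0 y0; rewrite -subr_ge0 -square_distance//; apply: Rintegral_ge0 => t _.
exact: sqr_ge0.
Qed.

End square_means.

Section midpoint_convex.
Context {R : realType}.
Variables (phi : R -> R) (B : R).
Hypothesis phi_mid : forall x y, x < 0 -> y < 0 ->
  2 * phi ((x + y) / 2) <= phi x + phi y.
Hypothesis phiB : forall x, x < 0 -> phi x <= B.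

(** A strict decrease would propagate to the left by midpoint convexity with
    increments that do not shrink, and exceed any bound. *)
Lemma midpoint_convex_nondecreasing x y : x <= y -> y < 0 -> phi x <= phi y.
Proof.
move=> xy y0; rewrite leNgt; apply/negP => lt_phi.
have d0 : 0 <= y - x by rewrite subr_ge0.
pose v k := phi (y - k%:R * (y - x)).
have arg0 k : y - k%:R * (y - x) < 0.
  by rewrite (le_lt_trans _ y0)// gerBl mulr_ge0.
have vS k : v 1%N - v 0%N <= v k.+1 - v k.
  elim: k => // k ih; apply: le_trans ih _.
  have := phi_mid (arg0 k) (arg0 k.+2).
  have -> : (y - k%:R * (y - x) + (y - k.+2%:R * (y - x))) / 2 = y - k.+1%:R * (y - x).
    rewrite -[k.+2]addn2 -[k.+1]addn1 !natrD.
    by move: (k%:R : R) => K; field.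
  rewrite -/(v k) -/(v k.+1) -/(v k.+2); lra.
have vk k : v 0%N + k%:R * (v 1%N - v 0%N) <= v k.
  elim: k => [|k ih]; first by rewrite mul0r addr0.
  by have := vS k; rewrite -natr1 mulrDl mul1r; lra.
have dv : 0 < v 1%N - v 0%N.
  by rewrite /v mul0r subr0 mul1r subKr subr_gt0.
have [k] : exists k : nat, (B - v 0%N) / (v 1%N - v 0%N) < k%:R.
  exists (Num.Def.truncn ((B - v 0%N) / (v 1%N - v 0%N))).+1.
  exact: truncnS_gt.
rewrite ltr_pdivrMr//; have := vk k; have := phiB (arg0 k); rewrite -/(v k); lra.
Qed.

(** Radii exp (x k) tending to 1 along which the midpoint defects of [phi]
    decay geometrically: take [x k] where [phi] is within 4^-k of its supremum. *)
Lemma midpoint_convex_sequence : exists x : nat -> R,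
  (forall k, - k.+1%:R^-1 < x k < 0) /\
  forall k, phi (x k) + phi (x k.+1) - 2 * phi ((x k + x k.+1) / 2) <= 4^-1 ^+ k.
Proof.
pose E := phi @` [set x | x < 0].
have E0 : has_sup E.
  split; first by exists (phi (-1)); exists (-1) => //=; rewrite oppr_lt0.
  by exists B => _ [x /= x0 <-]; exact: phiB.
have /choice[x xP] : forall k : nat, exists x, - k.+1%:R^-1 < x < 0 /\
    forall y, y < 0 -> phi y <= phi x + 4^-1 ^+ k.
  move=> k; have e0 : 0 < (4^-1 ^+ k : R) by rewrite exprn_gt0.
  have [_ [x /= x0 <-] hx] := sup_adherent e0 E0.
  have k0 : - k.+1%:R^-1 / 2 < 0 :> R by rewrite mulNr oppr_lt0 divr_gt0.
  exists (Num.max x (- k.+1%:R^-1 / 2)); split.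
    rewrite lt_max gt_max x0 k0 !andbT; apply/orP; right.
    by rewrite mulNr ltrN2 ltr_pdivrMr// ltr_pMr// ltr1n.
  move=> y y0; have yE : phi y <= sup E by apply: sup_upper_bound => //; exists y.
  apply: (le_trans yE); rewrite -lerBlDr; apply: (le_trans (ltW hx)).
  by apply: midpoint_convex_nondecreasing; rewrite ?le_max ?lexx// gt_max x0.
exists x; split=> [k|k]; first by case: (xP k).
have [/andP[_ x0] hx] := xP k; have [/andP[_ x1] hx1] := xP k.+1.
have h4 : (4^-1 ^+ k.+1 : R) <= 4^-1 ^+ k.
  by rewrite exprS ler_piMl ?exprn_ge0// invf_le1// ler1n.
set m := (_ + _) / 2.
have m0 : m < 0 by rewrite /m; lra.
have [xx|/ltW xx] := leP (x k) (x k.+1).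
  have : phi (x k) <= phi m by apply: midpoint_convex_nondecreasing; rewrite /m; lra.
  by have := hx _ x1; lra.
have : phi (x k.+1) <= phi m by apply: midpoint_convex_nondecreasing; rewrite /m; lra.
by have := hx1 _ x0; lra.
Qed.

End midpoint_convex.

(** * Almost everywhere convergence and measurability on the circle *)

Section almost_everywhere.
Context {R : realType}.
Notation mu := (@lebesgue_measure R).
Notation C := R[i].
Notation T := (circle R).

(** Chebyshev in the form [a <= c + a^2 / c] turns square-mean increments of
    size 4^-k into mean increments of size 2^-k, which are summable. *)
Lemma ae_cvg_of_square_increments (u : nat -> R -> R) :
  (forall k t, {for t, continuous (u k)}) ->
  (forall k, \int[mu]_(t in `[- pi, pi]) (u k t - u k.+1 t) ^+ 2 <= 4^-1 ^+ k) ->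
  {ae mu, forall t, `[- pi, pi]%classic t -> cvgn (u ^~ t)}.
Proof.
move=> cu hu; pose d k t := `|u k t - u k.+1 t|.
have cB k t : {for t, continuous (fun t => u k t - u k.+1 t)}.
  exact: (continuousB (@cu k t) (@cu k.+1 t)).
have cd k t : {for t, continuous (d k)}.
  apply: (@continuous_comp _ _ _ (fun t => u k t - u k.+1 t) (@Num.Def.normr R R)).
    exact: cB.
  exact: norm_continuous.
have csq k t : {for t, continuous (fun t => (u k t - u k.+1 t) ^+ 2)}.
  exact: (continuousM (cB k t) (cB k t)).
have md k : measurable_fun `[- pi, pi]%classic (EFin \o d k).
  apply/measurable_EFinP; apply: measurable_funTS.
  by apply: continuous_measurable_fun => t; exact: cd.
have itd k : (\int[mu]_(t in `[(- pi)%R, pi]) (d k t)%:E <=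
    0 + ((4 * pi + 2) / (2 ^ k.+1)%:R)%:E)%E.
  have it := @integrable_itvcc _ _ (- pi) pi (fun t _ => cd k t).
  rewrite add0e -[leLHS]fineK; last exact: integrable_fin_num it.
  rewrite lee_fin; pose c : R := 2^-1 ^+ k.
  have c0 : 0 < c by rewrite exprn_gt0.
  have c1 : c * c^-1 = 1 by rewrite divff// gt_eqF.
  have is2 := @integrable_itvcc _ _ (- pi) pi (fun t _ => csq k t).
  have is3 : mu.-integrable `[(- pi)%R, pi] (EFin \o (fun t => c^-1 * (u k t - u k.+1 t) ^+ 2)).
    exact: integrable_fctZ is2.
  have is1 : mu.-integrable `[(- pi)%R, pi] (EFin \o (fun _ : R => c)).
    by apply: integrable_itvcc => t _; exact: cvg_cst.
  have is4 : mu.-integrable `[(- pi)%R, pi]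
      (EFin \o (fun t => c + c^-1 * (u k t - u k.+1 t) ^+ 2)).
    exact: integrable_fctD is1 is3.
  apply: (@le_trans _ _ (\int[mu]_(t in `[- pi, pi]) (c + c^-1 * (u k t - u k.+1 t) ^+ 2))).
    apply: le_Rintegral => // t _.
    rewrite /d -[X in c^-1 * X]real_normK ?num_real//; set a := `|_|.
    have a0 : 0 <= a by exact: normr_ge0.
    have [ac|/ltW ca] := leP a c.
      by rewrite (le_trans ac)// lerDl mulr_ge0 ?sqr_ge0// invr_ge0 ltW.
    apply: ler_wpDl; first exact: ltW.
    by rewrite expr2 mulrA ler_peMl// mulrC ler_pdivlMr// mul1r.
  rewrite RintegralD// Rintegral_cst_itv; last exact: ltW (ltNpipi).
  rewrite RintegralZl//.
  apply: (@le_trans _ _ (c * (pi - - pi) + c^-1 * 4^-1 ^+ k)).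
    by rewrite lerD2l ler_wpM2l// invr_ge0 ltW.
  have -> : (4^-1 ^+ k : R) = c * c.
    by rewrite /c -exprMn; congr (_ ^+ _); rewrite -invfM -natrM.
  have -> : ((2 ^ k.+1)%:R : R) = 2 * c^-1.
    by rewrite natrX exprS /c -exprVn invrK.
  rewrite mulrA mulVf ?gt_eqF// mul1r invfM invrK.
  by rewrite le_eqVlt; apply/orP; left; apply/eqP; field.
have sumd : (\int[mu]_(t in `[(- pi)%R, pi]) (\sum_(0 <= k <oo) (d k t)%:E) < +oo)%E.
  rewrite (@integral_nneseries _ _ _ mu _ _ (fun k t => (d k t)%:E))//; last first.
    by move=> n x _; rewrite lee_fin /d normr_ge0.
  apply: (@le_lt_trans _ _ (\sum_(0 <= k <oo) (0 + ((4 * pi + 2) / (2 ^ k.+1)%:R)%:E))%E).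
    apply: lee_nneseries => // i _ _.
    by apply: integral_ge0 => t _; rewrite lee_fin /d normr_ge0.
  apply: le_lt_trans (epsilon_trick xpredT _ _) _ => //.
    by rewrite addr_ge0// mulr_ge0// pi_ge0.
  by rewrite eseries0// add0e ltry.
have isum : mu.-integrable `[(- pi)%R, pi] (fun t => \sum_(0 <= k <oo) (d k t)%:E)%E.
  apply/integrableP; split.
    apply: (@ge0_emeasurable_sum _ _ _ _ (fun k t => (d k t)%:E) xpredT).
      by move=> k t _ _; rewrite lee_fin /d normr_ge0.
    by move=> k _; exact: md.
  rewrite (_ : (\int[mu]_(t in _) _)%E =
    \int[mu]_(t in `[(- pi)%R, pi]) (\sum_(0 <= k <oo) (d k t)%:E))%E//.
  apply: eq_integral => t _; rewrite gee0_abs//.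
  by apply: nneseries_ge0 => k _ _; rewrite lee_fin /d normr_ge0.
have := integrable_ae _ isum => /(_ (measurable_itv _)).
apply: filterS => t h tpi; have {h tpi} /fin_numPlt /andP[_ ht] := h tpi.
have : cvgn (series (fun k => d k t)).
  by apply: nnseries_is_cvg => // k; rewrite /d normr_ge0.
move=> /(@normed_cvg _ _ (fun k => u k t - u k.+1 t)) cs.
have -> : (fun k => u k t) = (fun n => u 0%N t - series (fun k => u k t - u k.+1 t) n).
  apply/funext => n; rewrite seriesEnat /=.
  elim: n => [|n ih]; first by rewrite big_geq// subr0.
  by rewrite big_nat_recr//= opprD addrA -ih; ring.
by apply: is_cvgB => //; exact: is_cvg_cst.
Qed.

Lemma normc_circle (z : T) : normc (val z) = 1.
Proof.
case: z => z /= /eqP; change ((normc z)%:C = 1%:C -> normc z = 1).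
by move=> /(congr1 (@complex.Re R)).
Qed.

(** The preimage of an open interval is perhaps not open in the plane, as [h] is
    continuous only at the points of the circle; but it has the same trace on the
    circle as its interior. *)
Lemma measurable_circle_fun (h : C -> R) :
  (forall w, normc w = 1 -> {for w, continuous h}) ->
  measurable_fun [set: T] (fun z : T => h (val z)).
Proof.
move=> ch; apply: (measurability _ (RGenOpens.measurableE R)).
move=> _ [_ [a [b ->] <-]]; rewrite setTI.
apply: sub_sigma_algebra; exists (interior (h @^-1` `]a, b[)); first exact: open_interior.
apply/seteqP; split => z /=; first exact: interior_subset.
move=> hz; have z1 := normc_circle z.
by apply: (ch _ z1); apply: open_nbhs_nbhs; split => //; exact: interval_open.
Qed.

(** Arc length is an image measure, so an exceptional set on the circle is null
    only through a measurable set, which [~` P] provides. *)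
Lemma ae_arc_length (P : set T) : measurable P ->
  {ae mu, forall t, `[- pi, pi]%classic t -> P (expi t)} ->
  \forall z \ae (@arc_length R), P z.
Proof.
move=> mP ae; exists (~` P); split=> //; first exact: measurableC.
have mE : measurable (@expi R @^-1` (~` P) : set (measurableTypeR R)).
  rewrite -[X in measurable X]setTI; apply: (@measurable_expi R) => //.
  exact: measurableC.
rewrite /arc_length /pushforward /mrestr; apply: measure_negligible.
  by apply: measurableI => //; exact: measurable_itv.
apply: negligibleS ae => t /= [nP tpi]; exact/not_implyP.
Qed.

Lemma measurable_cfun_eq (f g : T -> C) : measurable_cfun f -> measurable_cfun g ->
  measurable [set z | f z = g z].
Proof.
move=> [f1 f2] [g1 g2].
have m1 : measurable_fun [set: T] (fun z => complex.Re (f z) - complex.Re (g z)).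
  exact: measurable_funB.
have m2 : measurable_fun [set: T] (fun z => complex.Im (f z) - complex.Im (g z)).
  exact: measurable_funB.
have := measurableI _ _ (m1 measurableT _ (measurable_set1 0))
  (m2 measurableT _ (measurable_set1 0)).
rewrite !setTI; congr (measurable _); apply/seteqP; split=> z /=.
  move=> [/eqP + /eqP]; rewrite !subr_eq0 => /eqP h1 /eqP h2.
  by apply/eqP; rewrite eq_complex h1 h2 !eqxx.
by move=> ->; rewrite !subrr.
Qed.

Lemma measurable_normc_le (f : T -> C) (M : R) : measurable_cfun f -> 0 <= M ->
  measurable [set z | normc (f z) <= M].
Proof.
move=> [f1 f2] M0.
have m1 : measurable_fun [set: T]
    (fun z => complex.Re (f z) * complex.Re (f z) + complex.Im (f z) * complex.Im (f z)).
  by apply: measurable_funD; exact: measurable_funM.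
have := m1 measurableT `]-oo, M ^+ 2]%classic (measurable_itv _).
rewrite setTI; congr (measurable _); apply/seteqP; split=> z /=;
  by rewrite in_itv /= -!expr2 -normc_sqrE ler_pXn2r// nnegrE normc_ge0.
Qed.

End almost_everywhere.

(** * Poisson's formula for radial limits *)

Section boundary_function.
Context {R : realType}.
Notation mu := (@lebesgue_measure R).
Notation C := R[i].
Notation T := (circle R).

Lemma ae_impl (P Q : R -> Prop) : (forall t, P t -> Q t) ->
  {ae mu, forall t, P t} -> {ae mu, forall t, Q t}.
Proof. by move=> PQ; apply: negligibleS => t /= nQ Pt; apply: nQ; exact: PQ. Qed.

Lemma ae_impl2 (P Q S : R -> Prop) : (forall t, P t -> Q t -> S t) ->
  {ae mu, forall t, P t} -> {ae mu, forall t, Q t} -> {ae mu, forall t, S t}.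
Proof.
move=> PQS P0 Q0; apply: negligibleS (negligibleU P0 Q0) => t /= nS.
by apply/not_andP => -[Pt Qt]; apply: nS; exact: PQS.
Qed.

Lemma extend_diskE (f : disk R -> C) (z : disk R) : extend_disk f (val z) = f z.
Proof. by rewrite /extend_disk valK. Qed.

Lemma disk_of_normc (w : C) : normc w < 1 -> exists z : disk R, val z = w.
Proof.
move=> w1; have w1' : `|w| < 1 by change ((normc w)%:C < 1%:C); rewrite ltcR.
by exists (Disk w1').
Qed.

Lemma normc_disk (z : disk R) : normc (val z) < 1.
Proof. by case: z => w /=; change ((normc w)%:C < 1%:C -> normc w < 1); rewrite ltcR. Qed.

Lemma Hinf_analytic (f : Hinf R) (w : C) : normc w < 1 -> derivable (extend_disk f) w 1.
Proof. by move=> /disk_of_normc[z <-]; have /hinfP[af _] := valP f; exact: af. Qed.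

Lemma Hinf_norm_ub (f : Hinf R) (z : disk R) : normc (f z) <= Hinf_norm f.
Proof.
apply: ub_le_sup; last by exists z.
by have /hinfP[_ [M fM]] := valP f; exists M => _ [w _ <-]; exact: fM.
Qed.

Lemma extend_disk_le (f : Hinf R) (w : C) : normc w < 1 ->
  normc (extend_disk f w) <= Hinf_norm f.
Proof. by move=> /disk_of_normc[z <-]; rewrite extend_diskE; exact: Hinf_norm_ub. Qed.

Definition radii_to_one (x : nat -> R) := forall k, - k.+1%:R^-1 < x k < 0.

(** Stated over the angles, where the Poisson integral is taken, and for each
    component, where dominated convergence applies. *)
Definition radial_limit (F : C -> C) (x : nat -> R) (g : T -> C) :=
  {ae mu, forall t, `[- pi, pi]%classic t ->
    complex.Re (F (polar (x k) t)) @[k --> \oo] --> complex.Re (g (expi t)) /\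
    complex.Im (F (polar (x k) t)) @[k --> \oo] --> complex.Im (g (expi t))}.

Lemma radii_to_one_cvg (x : nat -> R) : radii_to_one x -> x k @[k --> \oo] --> 0.
Proof.
move=> hx; apply: (@squeeze_cvgr _ _ _ _ (fun k => - k.+1%:R^-1) (fun=> 0)).
- by apply: nearW => k; have /andP[/ltW -> /ltW ->] := hx k.
- by rewrite -[X in _ --> X]oppr0; apply: cvgN; exact: cvg_harmonic.
- exact: cvg_cst.
Qed.

Lemma cvg_Rintegral_dominated (v : nat -> R -> R) (w p : R -> R) (B : R) :
  (forall k t, {for t, continuous (v k)}) -> (forall k t, `|v k t| <= B) ->
  measurable_fun [set: measurableTypeR R] w ->
  measurable_fun [set: measurableTypeR R] p ->
  mu.-integrable `[- pi, pi] (EFin \o p) ->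
  {ae mu, forall t, `[- pi, pi]%classic t -> v k t @[k --> \oo] --> w t} ->
  \int[mu]_(t in `[- pi, pi]) (v k t * p t) @[k --> \oo] -->
    \int[mu]_(t in `[- pi, pi]) (w t * p t).
Proof.
move=> cv vB mw mp ip vw.
have mv k : measurable_fun [set: measurableTypeR R] (v k).
  by apply: continuous_measurable_fun => t; exact: cv.
have iB : mu.-integrable `[- pi, pi] (EFin \o (fun t => B * `|p t|)).
  by apply: integrable_fctZ => //; exact: (integrable_norm ip).
have := @dominated_convergence _ _ _ mu `[- pi, pi]%classic (measurable_itv _)
  (fun k t => (v k t * p t)%:E) (fun t => (w t * p t)%:E) (fun t => (B * `|p t|)%:E).
case.
- move=> k; apply/measurable_EFinP; apply: measurable_funTS.
  exact: measurable_funM.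
- by apply/measurable_EFinP; apply: measurable_funTS; exact: measurable_funM.
- apply: ae_impl vw => t h tpi; apply: cvg_EFin; first exact: nearW.
  by apply: cvgM; [exact: h|exact: cvg_cst].
- exact: iB.
- by apply: aeW => t k _; rewrite lee_fin normrM ler_wpM2r.
- move=> iw _ cw; apply: fine_cvg; rewrite fineK; last exact: integrable_fin_num iw.
  exact: cw.
Qed.

Lemma continuous_poisson_shift (r s : R) : 0 <= r -> r < 1 -> forall t,
  {for t, continuous (fun t => poisson_kernel r (s - t))}.
Proof.
move=> r0 r1 t.
have c1 : {for t, continuous (fun t => s - t)} by apply: cvgB; [exact: cvg_cst|exact: cvg_id].
exact: (@continuous_comp _ _ _ (fun t => s - t) (poisson_kernel r) t c1
  (@continuous_poisson_kernel _ _ r0 r1 _)).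
Qed.

Lemma expRM_polar (x : R) t : (expR x)%:C * polar 0 t = polar x t.
Proof. by rewrite /polar expR0 mul1r. Qed.

(** Poisson's formula on the circles of radius exp (x k) passes to the limit by
    dominated convergence, the values of [f] being bounded. *)
Lemma poisson_of_radial_limit (f : Hinf R) (x : nat -> R) (g : T -> C) :
  radii_to_one x -> measurable_cfun g -> radial_limit (extend_disk f) x g ->
  forall (r s : R) (z : disk R), 0 <= r -> r < 1 ->
    val z = r%:C * val (expi s) -> f z = poisson_integral g r s.
Proof.
move=> hx [mg1 mg2] fg r s z r0 r1 zE; set F := extend_disk f in fg.
have x0 k : x k < 0 by have /andP[] := hx k.
have formula k : Cintegral `[- pi, pi]
    (fun t => F (polar (x k) t) * (poisson_kernel r (s - t))%:C) =
    (2 * pi)%:C * F ((expR (x k))%:C * val z).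
  have scale w : normc w < expR (- x k) -> normc ((expR (x k))%:C * w) < 1.
    rewrite [normc (_ * _)]normcM normc_real gtr0_norm ?expR_gt0// expRN.
    by rewrite -ltr_pdivlMl ?expR_gt0// mulr1.
  have := @circle_poisson_formula _ (fun w => F ((expR (x k))%:C * w)) (- x k)
    (Hinf_norm f) r s.
  rewrite oppr_gt0 => /(_ (x0 k)) H.
  have H1 w : normc w < expR (- x k) -> derivable (fun w => F ((expR (x k))%:C * w)) w 1.
    move=> hw; apply: (@derivable_comp1 _ (fun w => (expR (x k))%:C * w) F w).
      exact: (@mul_derivable _ (fun=> _) (fun w => w) _
        (@cst_derivable _ _ _) (@id_derivable _ _)).
    exact: Hinf_analytic (scale _ hw).
  have H2 w : normc w < expR (- x k) -> normc (F ((expR (x k))%:C * w)) <= Hinf_norm f.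
    by move=> hw; exact: extend_disk_le (scale _ hw).
  rewrite zE -(H H1 H2 r0 r1).
  by apply: eq_Cintegral => t _; rewrite expRM_polar.
have npol k t : normc (polar (x k) t) < 1 by exact: normc_polar_lt1.
have cF k t : {for polar (x k) t, continuous F}.
  by apply: derivable_continuous; exact: Hinf_analytic.
have bF k t : normc (F (polar (x k) t)) <= Hinf_norm f by exact: extend_disk_le.
have cpsi := @continuous_poisson_shift r s r0 r1.
have main (p : C -> R) : (forall w, {for w, continuous p}) ->
    (forall w, `|p w| <= normc w) -> (forall a b, p (a * b%:C) = p a * b) ->
    measurable_fun [set: T] (p \o g) ->
    {ae mu, forall t, `[- pi, pi]%classic t ->
      p (F (polar (x k) t)) @[k --> \oo] --> p (g (expi t))} ->
    (forall k, p (Cintegral `[- pi, pi]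
      (fun t => F (polar (x k) t) * (poisson_kernel r (s - t))%:C)) =
      \int[mu]_(t in `[- pi, pi]) p (F (polar (x k) t) * (poisson_kernel r (s - t))%:C)) ->
    (forall a b, p (b%:C * a) = b * p a) ->
    \int[mu]_(t in `[- pi, pi]) p (g (expi t) * (poisson_kernel r (s - t))%:C) =
      2 * pi * p (F (val z)).
  move=> cp pn pM mp pae pI pM'.
  have lim1 := @cvg_Rintegral_dominated (fun k t => p (F (polar (x k) t)))
    (fun t => p (g (expi t))) (fun t => poisson_kernel r (s - t)) (Hinf_norm f).
  have mpsi : measurable_fun [set: measurableTypeR R] (fun t => poisson_kernel r (s - t)).
    by apply: continuous_measurable_fun => t; exact: cpsi.
  have ipsi : mu.-integrable `[- pi, pi] (EFin \o (fun t => poisson_kernel r (s - t))).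
    by apply: integrable_itvcc => t _; exact: cpsi.
  have {lim1} := lim1 _ _ _ mpsi ipsi pae.
  move=> lim1.
  have : \int[mu]_(t in `[- pi, pi]) (p (F (polar (x k) t)) * poisson_kernel r (s - t))
      @[k --> \oo] --> 2 * pi * p (F (val z)).
    rewrite (_ : (fun k => _) = (fun k => 2 * pi * p (F ((expR (x k))%:C * val z)))); last first.
      apply/funext => k; rewrite -pM' -formula pI.
      by apply: eq_Rintegral => t _; rewrite pM.
    apply: cvgM; first exact: cvg_cst.
    have cFz : {for val z, continuous F}.
      by apply: derivable_continuous; apply: Hinf_analytic; exact: normc_disk.
    have cscale : (expR (x k))%:C * val z @[k --> \oo] --> val z.
      have : expR (x k) @[k --> \oo] --> expR 0.
        by apply: continuous_cvg; [exact: continuous_expR|exact: radii_to_one_cvg].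
      move=> /cvgrPdist_lt ce A /nbhs_normcP[e e0 eA].
      have e1 : 0 < e / (1 + normc (val z)) by rewrite divr_gt0// ltr_wpDr ?normc_ge0.
      suff : \forall k \near \oo, A ((expR (x k))%:C * val z) by [].
      near=> k; apply: eA.
      have -> : (expR (x k))%:C * val z - val z = (expR (x k) - 1)%:C * val z.
        by rewrite rmorphB rmorph1 mulrBl mul1r.
      rewrite [ltLHS]normcM normc_real distrC.
      have : `|expR 0 - expR (x k)| < e / (1 + normc (val z)) by near: k; exact: ce.
      rewrite expR0 ltr_pdivlMr ?ltr_wpDr ?normc_ge0//; apply: le_lt_trans.
      by rewrite ler_wpM2l// lerDr.
    have cpF : {for val z, continuous (p \o F)}.
      exact: (@continuous_comp C C R F p _ cFz (cp _)).
    exact: (cvg_comp _ _ cscale cpF).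
  move=> lim2.
  transitivity (\int[mu]_(t in `[- pi, pi]) (p (g (expi t)) * poisson_kernel r (s - t))).
    by apply: eq_Rintegral => t _; rewrite pM.
  apply: (cvg_unique _ _ lim2) => //.
  apply: lim1.
  - by move=> k t; have [] := continuous_comp_polar cp (@cF k t).
  - by move=> k t; exact: le_trans (pn _) (bF k t).
  - exact: (measurableT_comp mp (@measurable_expi R)).
have pi2 : 2 * pi != 0 :> R by rewrite gt_eqF// mulr_gt0// pi_gt0.
have key : Cintegral `[- pi, pi] (fun t => g (expi t) * (poisson_kernel r (s - t))%:C) =
    (2 * pi)%:C * F (val z).
  rewrite [LHS]/Cintegral (main (@complex.Re R)) ?(main (@complex.Im R))//.
  - by apply/eqP; rewrite eq_complex Re_mul Im_mul /= !mul0r subr0 addr0 !eqxx.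
  - exact: continuous_Im.
  - exact: normr_Im_le.
  - by move=> a b; rewrite Im_mul /= mulr0 add0r.
  - by apply: ae_impl fg => t h /h[].
  - by move=> a b; rewrite Im_mul /= mul0r addr0.
  - exact: continuous_Re.
  - exact: normr_Re_le.
  - by move=> a b; rewrite Re_mul /= mulr0 subr0.
  - by apply: ae_impl fg => t h /h[].
  - by move=> a b; rewrite Re_mul /= mul0r subr0.
rewrite /poisson_integral key mulrA -rmorphM mulVf// mul1r.
by rewrite /F extend_diskE.
Unshelve. all: by end_near. Qed.

End boundary_function.

(** * Existence of radial limits *)

Section radial_limits.
Context {R : realType}.
Notation mu := (@lebesgue_measure R).
Notation C := R[i].
Notation T := (circle R).

(** The upper limits of the real and imaginary parts are defined and measurable on
    the whole circle, and agree with the limits wherever these exist. *)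
Lemma radial_limit_exists (f : Hinf R) (x : nat -> R) : (forall k, x k < 0) ->
  (forall k, \int[mu]_(t in `[- pi, pi]) normc (extend_disk f (polar (x k) t) -
     extend_disk f (polar (x k.+1) t)) ^+ 2 <= 4^-1 ^+ k) ->
  exists2 g : T -> C, measurable_cfun g & radial_limit (extend_disk f) x g.
Proof.
move=> x0 hx; set F := extend_disk f.
have npol k t : normc (polar (x k) t) < 1 by exact: normc_polar_lt1.
have cF k t : {for polar (x k) t, continuous F}.
  by apply: derivable_continuous; exact: Hinf_analytic.
have cFw k (w : C) : normc w = 1 -> {for (expR (x k))%:C * w, continuous F}.
  move=> w1; apply: derivable_continuous; apply: Hinf_analytic.
  by rewrite [normc (_ * _)]normcM w1 mulr1 normc_real gtr0_norm ?expR_gt0// -expR0 ltr_expR.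
have scal (a w : C) : {for w, continuous (fun w => a * w)}.
  exact: (continuousM (@cvg_cst _ _ _ _ _) (@cvg_id _ _)).
have main (p : C -> R) : (forall w, {for w, continuous p}) ->
    (forall w, `|p w| <= normc w) -> (forall a b, p (a - b) = p a - p b) ->
    exists2 h : T -> R, measurable_fun [set: T] h &
    {ae mu, forall t, `[- pi, pi]%classic t ->
      p (F (polar (x k) t)) @[k --> \oo] --> h (expi t)}.
  move=> cp pn pB.
  pose v k (z : T) := p (F ((expR (x k))%:C * val z)).
  have vb k z : `|v k z| <= Hinf_norm f.
    rewrite (le_trans (pn _))//; apply: extend_disk_le.
    rewrite [normc (_ * _)]normcM normc_circle mulr1 normc_real gtr0_norm ?expR_gt0//.
    by rewrite -expR0 ltr_expR.
  exists (fun z => limn_sup (v ^~ z)).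
    apply: measurable_fun_limn_sup => [z _|z _|k].
    - by exists (Hinf_norm f) => _ [k _ <-]; rewrite (le_trans (ler_norm _)).
    - exists (- Hinf_norm f) => _ [k _ <-].
      by have := vb k z; rewrite ler_norml => /andP[].
    - apply: (@measurable_circle_fun _ (fun w => p (F ((expR (x k))%:C * w)))) => w w1.
      have c1 : {for w, continuous (fun w => F ((expR (x k))%:C * w))}.
        exact: (@continuous_comp C C C (fun w => (expR (x k))%:C * w) F w
          (@scal _ _) (cFw k w w1)).
      exact: (@continuous_comp C C R _ p w c1 (cp _)).
  have := @ae_cvg_of_square_increments _ (fun k t => p (F (polar (x k) t))).
  move=> H; have {}H := H _ _; apply: ae_impl (H _ _) => [t h tpi|k t|k].
  - have /= cvt := h tpi.
    by rewrite (@cvg_limn_supE _ (fun k => p (F (polar (x k) t))) cvt).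
  - by have [] := continuous_comp_polar cp (@cF k t).
  - have c1 (q : C -> R) t : (forall w, {for w, continuous q}) ->
        {for t, continuous (fun t => (q (F (polar (x k) t)) - q (F (polar (x k.+1) t))) ^+ 2)}.
      move=> cq; have [_ d1] := continuous_comp_polar cq (@cF k t).
      have [_ d2] := continuous_comp_polar cq (@cF k.+1 t).
      have d12 : {for t, continuous
          (fun t => q (F (polar (x k) t)) - q (F (polar (x k.+1) t)))}.
        exact: (continuousB d1 d2).
      exact: (continuousM d12 d12).
    apply: le_trans (hx k); apply: le_Rintegral => //.
    + by apply: integrable_itvcc => t _; exact: c1.
    + rewrite (_ : (fun t => _) = (fun t =>
          (complex.Re (F (polar (x k) t)) - complex.Re (F (polar (x k.+1) t))) ^+ 2 +
          (complex.Im (F (polar (x k) t)) - complex.Im (F (polar (x k.+1) t))) ^+ 2)).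
        apply: integrable_fctD => //; apply: integrable_itvcc => t _.
          by apply: c1; exact: continuous_Re.
        by apply: c1; exact: continuous_Im.
      have key (z w : C) : normc (z - w) ^+ 2 =
          (complex.Re z - complex.Re w) ^+ 2 + (complex.Im z - complex.Im w) ^+ 2.
        by rewrite normc_sqrE; case: z; case: w.
      by apply/funext => t; exact: key.
    + move=> t _; rewrite -pB -[leLHS]real_normK ?num_real//.
      by rewrite ler_pXn2r// ?nnegrE ?normc_ge0.
have [h1 mh1 ae1] := main _ continuous_Re normr_Re_le
  (fun a b => raddfB (@complex.Re R : {additive C -> R}) a b).
have [h2 mh2 ae2] := main _ continuous_Im normr_Im_le
  (fun a b => raddfB (@complex.Im R : {additive C -> R}) a b).
exists (fun z => h1 z +i* h2 z); first by split.
by apply: ae_impl2 ae1 ae2 => t ht1 ht2 tpi; split; [exact: ht1|exact: ht2].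
Qed.

Lemma radial_limit_le (f : Hinf R) (x : nat -> R) (g : T -> C) (M : R) :
  (forall k, x k < 0) -> measurable_cfun g -> radial_limit (extend_disk f) x g ->
  (forall z, normc (f z) <= M) -> \forall z \ae (@arc_length R), normc (g z) <= M.
Proof.
move=> x0 mg fg fM.
have M0 : 0 <= M by apply: le_trans (fM point); exact: normc_ge0.
apply: ae_arc_length; first exact: measurable_normc_le.
apply: ae_impl fg => t h tpi; have [h1 h2] := h tpi => /=.
rewrite -ler_sqr ?nnegrE ?normc_ge0// normc_sqrE.
pose v k := extend_disk f (polar (x k) t).
have lim : complex.Re (v k) * complex.Re (v k) + complex.Im (v k) * complex.Im (v k)
    @[k --> \oo] --> complex.Re (g (expi t)) ^+ 2 + complex.Im (g (expi t)) ^+ 2.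
  by apply: cvgD; [exact: cvgM|exact: cvgM].
apply: (cvgr_to_le lim); apply: nearW => k.
rewrite -!expr2 -normc_sqrE ler_sqr ?nnegrE ?normc_ge0// /v.
have : normc (polar (x k) t) < 1 by exact: normc_polar_lt1.
by move=> /disk_of_normc[z <-]; rewrite extend_diskE.
Qed.

(** One sequence of radii serves two functions at once: apply the selection of
    radii to the sum of their square means. *)
Lemma common_radial_limits (f1 f2 : Hinf R) : exists (x : nat -> R) (g1 g2 : Linf_fun R),
  [/\ radii_to_one x, radial_limit (extend_disk f1) x g1 &
      radial_limit (extend_disk f2) x g2].
Proof.
have dF (f : Hinf R) (w : C) : normc w < 1 -> derivable (extend_disk f) w 1.
  exact: Hinf_analytic.
have FM (f : Hinf R) (w : C) : normc w < 1 -> normc (extend_disk f w) <= Hinf_norm f.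
  exact: extend_disk_le.
pose sm (f : Hinf R) := square_mean (extend_disk f).
have sm_mid f x y : x < 0 -> y < 0 -> 2 * sm f ((x + y) / 2) <= sm f x + sm f y.
  exact: (square_mean_midpoint (dF f)).
have smB f x : x < 0 -> sm f x <= 2 * pi * Hinf_norm f ^+ 2.
  exact: (square_mean_le (dF f) (FM f)).
pose phi x := sm f1 x + sm f2 x.
have phi_mid x y : x < 0 -> y < 0 -> 2 * phi ((x + y) / 2) <= phi x + phi y.
  move=> x0 y0; move: (sm_mid f1 _ _ x0 y0) (sm_mid f2 _ _ x0 y0); rewrite /phi.
  by move: (sm _ _) (sm _ _) (sm _ _) (sm _ _) (sm _ _) (sm _ _) => *; lra.
have phiB x : x < 0 -> phi x <= 2 * pi * Hinf_norm f1 ^+ 2 + 2 * pi * Hinf_norm f2 ^+ 2.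
  by move=> x0; apply: lerD; exact: smB.
have [x [hx dx]] := midpoint_convex_sequence phi_mid phiB.
have x0 k : x k < 0 by have /andP[] := hx k.
pose small f := forall k,
  sm f (x k) + sm f (x k.+1) - 2 * sm f ((x k + x k.+1) / 2) <= 4^-1 ^+ k.
have dist f k : small f ->
  \int[mu]_(t in `[- pi, pi]) normc (extend_disk f (polar (x k) t) -
     extend_disk f (polar (x k.+1) t)) ^+ 2 <= 4^-1 ^+ k.
  by move=> h; rewrite (square_distance (dF f) (x0 k) (x0 k.+1)); exact: h.
have lift f : small f -> exists g : Linf_fun R, radial_limit (extend_disk f) x g.
  move=> h; have [g mg fg] := @radial_limit_exists f x x0 (fun k => dist f k h).
  have gL : g \in @linf_fun R.
    apply/linf_funP; split=> //; apply/ess_boundedP; exists (Hinf_norm f).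
    exact: (radial_limit_le x0 mg fg (Hinf_norm_ub f)).
  by exists (MkLinf_fun gL).
have [g1 h1] : exists g : Linf_fun R, radial_limit (extend_disk f1) x g.
  apply: lift => k; move: (dx k) (sm_mid f2 _ _ (x0 k) (x0 k.+1)); rewrite /phi.
  by move: (sm _ _) (sm _ _) (sm _ _) (sm _ _) (sm _ _) (sm _ _) => *; lra.
have [g2 h2] : exists g : Linf_fun R, radial_limit (extend_disk f2) x g.
  apply: lift => k; move: (dx k) (sm_mid f1 _ _ (x0 k) (x0 k.+1)); rewrite /phi.
  by move: (sm _ _) (sm _ _) (sm _ _) (sm _ _) (sm _ _) (sm _ _) => *; lra.
by exists x, g1, g2.
Qed.

End radial_limits.

(** * Densities with vanishing Poisson integral *)

Section poisson_uniqueness.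
Context {R : realType}.
Notation mu := (@lebesgue_measure R).
Notation C := R[i].
Notation T := (circle R).
Notation RR := (measurableTypeR R).

Lemma poisson_denominator_ge (r t : R) : 0 <= r ->
  (1 - r) ^+ 2 <= 1 - 2 * r * cos t + r ^+ 2.
Proof.
move=> r0; have : 0 <= 2 * r * (1 - cos t).
  by rewrite mulr_ge0 ?mulr_ge0// subr_ge0 cos_le1.
by rewrite !expr2; lra.
Qed.

Lemma poisson_kernel_ge0 (r t : R) : 0 <= r -> r < 1 -> 0 <= poisson_kernel r t.
Proof.
move=> r0 r1; rewrite divr_ge0//; last first.
  by rewrite (le_trans _ (poisson_denominator_ge t r0))// sqr_ge0.
by rewrite subr_ge0 expr_le1// ltW.
Qed.

Lemma poisson_kernel_le (r t : R) : 0 <= r -> r < 1 ->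
  poisson_kernel r t <= (1 - r ^+ 2) / (1 - r) ^+ 2.
Proof.
move=> r0 r1; have d0 : 0 < (1 - r) ^+ 2 by rewrite exprn_gt0// subr_gt0.
rewrite ler_wpM2l//; first by rewrite subr_ge0 expr_le1// ltW.
rewrite lef_pV2 ?posrE//; first exact: poisson_denominator_ge.
by rewrite (lt_le_trans d0)// poisson_denominator_ge.
Qed.

Lemma poisson_kernelC (r s t : R) : poisson_kernel r (s - t) = poisson_kernel r (t - s).
Proof. by rewrite /poisson_kernel -cosN opprB. Qed.

(** The denominator is [(1 - r)^2 + 2 r (1 - cos t)] and [2 r >= 1], while the
    numerator is at most [2 (1 - r)]. *)
Lemma poisson_kernel_off (r t c : R) : 2^-1 <= r -> r < 1 -> c < 1 -> cos t <= c ->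
  poisson_kernel r t <= 2 * (1 - r) / (1 - c).
Proof.
move=> r2 r1 c1 tc; have c0 : 0 < 1 - c by rewrite subr_gt0.
have r0 : 0 <= r by rewrite (le_trans _ r2).
have dc : 1 - c <= 1 - 2 * r * cos t + r ^+ 2.
  have h1 : 0 <= (2 * r - 1) * (1 - c) by apply: mulr_ge0; [lra|exact: ltW].
  have h2 : 0 <= 2 * r * (c - cos t) by rewrite mulr_ge0 ?subr_ge0// mulr_ge0.
  have h3 : 0 <= (1 - r) ^+ 2 by rewrite sqr_ge0.
  by rewrite !expr2 in h3 *; lra.
have dp : 0 < 1 - 2 * r * cos t + r ^+ 2 by exact: lt_le_trans dc.
apply: ler_pM.
- by rewrite subr_ge0 expr_le1// ltW.
- by rewrite invr_ge0 ltW.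
- have : 0 <= (1 - r) ^+ 2 by rewrite sqr_ge0.
  by rewrite !expr2; lra.
- by rewrite lef_pV2 ?posrE.
Qed.

Lemma integrable_poisson (r s a b : R) : 0 <= r -> r < 1 ->
  mu.-integrable `[a, b] (EFin \o (fun t => poisson_kernel r (s - t))).
Proof. by move=> r0 r1; apply: integrable_itvcc => t _; exact: continuous_poisson_shift. Qed.

(** Poisson's formula for the constant function 1. *)
Lemma poisson_mass (r s : R) : 0 <= r -> r < 1 ->
  \int[mu]_(t in `[- pi, pi]) poisson_kernel r (s - t) = 2 * pi.
Proof.
move=> r0 r1.
have df (w : C) : normc w < expR 1 -> derivable (fun=> 1 : C) w 1.
  by move=> _; exact: cst_derivable.
have fM (w : C) : normc w < expR 1 -> normc (1 : C) <= 1 by rewrite normc1.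
have := @circle_poisson_formula _ (fun=> 1) 1 1 r s ltr01 df fM r0 r1.
move=> /(congr1 (@complex.Re R)); rewrite mulr1 => /= <-.
by apply: eq_Rintegral => t _; rewrite /= mul1r mul0r subr0.
Qed.

Lemma cos_lt1 (t : R) : 0 < t < 2 * pi -> cos t < 1.
Proof.
move=> /andP[t0 t2]; have : 0 < sin (t / 2).
  by apply: sin_gt0_pi; rewrite divr_gt0//= ltr_pdivrMr// mulrC.
move=> s0; rewrite (_ : t = (t / 2) *+ 2); last by rewrite -mulr_natr divfK.
have := cos2Dsin2 (t / 2); have : 0 < sin (t / 2) ^+ 2 by rewrite exprn_gt0.
by rewrite cos_mulr2n -mulr_natl; lra.
Qed.

(** By compactness [cos (s - t)] has a maximum below 1 on the interval, which makes
    the kernel uniformly small there as [r n] tends to 1. *)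
Lemma poisson_off_vanishes (r : nat -> R) (a b t : R) :
  (forall n, 2^-1 <= r n < 1) -> r n @[n --> \oo] --> (1 : R) ->
  a <= b -> (forall s, a <= s <= b -> cos (s - t) < 1) ->
  \int[mu]_(s in `[a, b]) poisson_kernel (r n) (s - t) @[n --> \oo] --> (0 : R).
Proof.
move=> hr cr ab cs.
have cc (s : R) : {for s, continuous (fun s => cos (s - t))}.
  have c1 : {for s, continuous (fun s => s - t)}.
    by apply: cvgB; [exact: cvg_id|exact: cvg_cst].
  exact: (@continuous_comp _ _ _ (fun s => s - t) (@cos R) s c1 (@continuous_cos _ _)).
have [|c cab cmax] := EVT_max ab (f := fun s => cos (s - t)).
  by apply: continuous_in_subspaceT => s _; exact: cc.
set k := cos (c - t) in cmax.
have k1 : k < 1 by apply: cs; move: cab; rewrite in_itv.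
apply: (@squeeze_cvgr _ _ _ _ (fun=> 0) (fun n => 2 * (1 - r n) / (1 - k) * (b - a))).
- apply: nearW => n; have /andP[r2 r1] := hr n.
  have r0 : 0 <= r n by rewrite (le_trans _ r2).
  rewrite Rintegral_ge0/=; last by move=> s _; exact: poisson_kernel_ge0.
  rewrite -Rintegral_cst_itv//; apply: le_Rintegral => //.
  + under [EFin \o _]eq_fun do rewrite /= poisson_kernelC.
    exact: integrable_poisson.
  + by apply: integrable_itvcc => s _; exact: cvg_cst.
  + by move=> s sab; apply: poisson_kernel_off => //; apply: cmax.
- exact: cvg_cst.
- rewrite -[X in _ --> X](_ : 2 * (1 - 1) / (1 - k) * (b - a) = 0); last first.
    by rewrite subrr !(mulr0, mul0r).
  apply: cvgM; last exact: cvg_cst.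
  apply: cvgM; last exact: cvg_cst.
  apply: cvgM; first exact: cvg_cst.
  by apply: cvgB; first exact: cvg_cst.
Qed.

(** Approximate identity: the mass of the kernel centred at [t] concentrates on
    the side of [x] where [t] lies. *)
Lemma poisson_arc_mass_cvg (r : nat -> R) (x t : R) :
  (forall n, 2^-1 <= r n < 1) -> r n @[n --> \oo] --> (1 : R) ->
  - pi < x < pi -> - pi < t < pi -> t != x ->
  \int[mu]_(s in `[- pi, x]) poisson_kernel (r n) (s - t) @[n --> \oo] -->
    2 * pi * (\1_`[- pi, x] t).
Proof.
move=> hr cr /andP[x1 x2] /andP[t1 t2] tx.
have [tltx|xltt] : t < x \/ x < t by apply/orP; rewrite -neq_lt.
- rewrite indicE mem_set/=; last by rewrite in_itv/= !ltW.
  rewrite mulr1.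
  have total n : \int[mu]_(s in `[- pi, x]) poisson_kernel (r n) (s - t) =
      2 * pi - \int[mu]_(s in `[x, pi]) poisson_kernel (r n) (s - t).
    have /andP[r2 r1] := hr n; have r0 : 0 <= r n by rewrite (le_trans _ r2).
    have -> : 2 * pi = \int[mu]_(s in `[- pi, pi]) poisson_kernel (r n) (s - t).
      rewrite -(poisson_mass t r0 r1).
      by apply: eq_Rintegral => s _; exact: poisson_kernelC.
    rewrite (@Rintegral_itv_split _ _ (- pi) x pi); [by rewrite addrK|exact: ltW|exact: ltW|].
    under [EFin \o _]eq_fun do rewrite /= poisson_kernelC.
    exact: integrable_poisson.
  under eq_fun do rewrite total.
  have c0 : \int[mu]_(s in `[x, pi]) poisson_kernel (r n) (s - t) @[n --> \oo] --> (0 : R).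
    apply: poisson_off_vanishes => //; first exact: ltW.
    by move=> s /andP[s1 s2]; apply: cos_lt1; lra.
  by have := cvgB (@cvg_cst _ (2 * pi : R) _ _ _) c0; rewrite subr0; exact.
- rewrite indicE memNset ?mulr0; last by rewrite /= in_itv/= => /andP[_]; rewrite leNgt xltt.
  apply: poisson_off_vanishes => //; first exact: ltW.
  by move=> s /andP[s1 s2]; rewrite -cosN opprB; apply: cos_lt1; lra.
Qed.

Lemma integrable_bounded_itv (a b K : R) (h : RR -> R) :
  measurable_fun [set: RR] h -> (forall t, `|h t| <= K) ->
  mu.-integrable `[a, b] (EFin \o h).
Proof.
move=> mh hK; apply: measurable_bounded_integrable => //.
- by rewrite /= lebesgue_measure_itv; case: ifP => _; rewrite -?EFinB ltry.
- exact: measurable_funTS.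
- exists K; split; first exact: num_real.
  by move=> y Ky t _ /=; rewrite (le_trans (hK t))// ltW.
Qed.

Lemma Fubini_itv (a b c d K : R) (h : RR * RR -> R) :
  measurable_fun [set: RR * RR] h -> (forall z, `|h z| <= K) ->
  \int[mu]_(s in `[a, b]) \int[mu]_(t in `[c, d]) h (s, t) =
  \int[mu]_(t in `[c, d]) \int[mu]_(s in `[a, b]) h (s, t).
Proof.
move=> mh hK; pose A : set RR := `[a, b]%classic; pose B : set RR := `[c, d]%classic.
have mA : measurable A by exact: measurable_itv.
have mB : measurable B by exact: measurable_itv.
have m1 s : measurable_fun [set: RR] (fun t => h (s, t)).
  by apply: (measurableT_comp mh); exact: pair1_measurable.
have m2 t : measurable_fun [set: RR] (fun s => h (s, t)).
  by apply: (measurableT_comp mh); exact: pair2_measurable.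
have muAB (u v : R) : (mu `[u, v]%classic < +oo)%E.
  by rewrite /= lebesgue_measure_itv; case: ifP => _; rewrite -?EFinB ltry.
have i0 : (mu \x mu)%E.-integrable (A `*` B) (EFin \o h).
  apply: measurable_bounded_integrable.
  - exact: measurableX.
  - rewrite [ltLHS](product_measure1E _ _ mA mB).
    apply: lte_mul_pinfty; [exact: measure_ge0| |exact: muAB].
    by rewrite ge0_fin_numE; [exact: muAB|exact: measure_ge0].
  - exact: measurable_funTS.
  - exists K; split; first exact: num_real.
    by move=> y Ky z _ /=; rewrite (le_trans (hK z))// ltW.
have i1 : (mu \x mu)%E.-integrable setT ((EFin \o h) \_ (A `*` B)).
  by have /(integrable_mkcond _ (measurableX mA mB)) := i0.
have := Fubini i1.
have e1 : (\int[mu]_s \int[mu]_t ((EFin \o h) \_ (A `*` B)) (s, t) =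
    \int[mu]_(s in A) \int[mu]_(t in B) (h (s, t))%:E)%E.
  rewrite [RHS]integral_mkcond; apply: eq_integral => s _.
  rewrite [RHS]patchE; case: ifPn => [sA|sA].
    rewrite [RHS]integral_mkcond; apply: eq_integral => t _.
    rewrite !patchE; congr (if _ then _ else _).
    by apply/idP/idP => /set_mem h'; apply/mem_set; [case: h'|split => //; exact: set_mem].
  apply: integral0_eq => t _; rewrite patchE memNset// => -[/= sA' _].
  by move: sA; rewrite mem_set.
have e2 : (\int[mu]_t \int[mu]_s ((EFin \o h) \_ (A `*` B)) (s, t) =
    \int[mu]_(t in B) \int[mu]_(s in A) (h (s, t))%:E)%E.
  rewrite [RHS]integral_mkcond; apply: eq_integral => t _.
  rewrite [RHS]patchE; case: ifPn => [tB|tB].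
    rewrite [RHS]integral_mkcond; apply: eq_integral => s _.
    rewrite !patchE; congr (if _ then _ else _).
    by apply/idP/idP => /set_mem h'; apply/mem_set; [case: h'|split => //; exact: set_mem].
  apply: integral0_eq => s _; rewrite patchE memNset// => -[/= _ tB'].
  by move: tB; rewrite mem_set.
rewrite e1 e2 => E; rewrite /Rintegral.
congr fine; transitivity (\int[mu]_(s in A) \int[mu]_(t in B) (h (s, t))%:E)%E.
  apply: eq_integral => s _; rewrite fineK//; apply: integrable_fin_num => //.
  exact: (integrable_bounded_itv _ _ (m1 s)).
rewrite E; apply: eq_integral => t _; rewrite fineK//; apply: integrable_fin_num => //.
exact: (integrable_bounded_itv _ _ (m2 t)).
Qed.

Lemma negligible_set1 (x : R) : mu.-negligible [set x].
Proof.
by exists [set x]; split=> //; exact: lebesgue_measure_set1.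
Qed.

(** Lebesgue differentiation: almost everywhere [u] is the derivative of its
    primitive from [- pi], which is constant. *)
Lemma ae_zero_of_primitive (u : RR -> R) :
  mu.-integrable `[- pi, pi] (EFin \o u) ->
  (forall x, - pi < x < pi -> \int[mu]_(t in `[- pi, x]) u t = 0) ->
  {ae mu, forall t, `[- pi, pi]%classic t -> u t = 0}.
Proof.
move=> iu u0; pose D : set RR := `[- pi, pi]%classic.
have mD : measurable D by exact: measurable_itv.
pose v : R -> R := u \_ D.
have iv : mu.-integrable setT (EFin \o v).
  by rewrite /v -restrict_EFin; have /(integrable_mkcond _ mD) := iu.
have ivS y : mu.-integrable [set` Interval (BLeft (- pi)) (BRight y)] (EFin \o v).
  by apply: integrableS iv.
have := FTC1 ivS (integrable_locally_restrict mD iu).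
have e1 := negligible_set1 (- pi); have e2 := negligible_set1 pi.
move=> ae; apply: negligibleS (negligibleU ae (negligibleU e1 e2)) => t /=.
move=> /not_implyP[]; rewrite in_itv /= => /andP[t1 t2] ut.
have [->|nt1] := eqVneq t (- pi); first by right; left.
have [->|nt2] := eqVneq t pi; first by right; right.
left => H; apply: ut.
have t1' : - pi < t by rewrite lt_neqAle eq_sym nt1.
have t2' : t < pi by rewrite lt_neqAle nt2.
have [|_ F't] := H; first by rewrite lte_fin.
have vt : v t = u t by rewrite /v patchE mem_set// /D /= in_itv/= t1 t2.
rewrite -vt -F't derive1E.
rewrite (@near_eq_derive _ _ _ _ (cst 0)) -?derive1E ?derive1_cst//.
near=> y.
have y1 : - pi < y by near: y; exact: lt_nbhsr.
have y2 : y < pi by near: y; exact: lt_nbhsl.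
rewrite -[RHS](u0 y) ?y1//; apply: eq_Rintegral => s /set_mem /=.
rewrite in_itv/= => /andP[s1 s2]; rewrite /v patchE mem_set//.
by rewrite /D /= in_itv/= s1 (le_trans s2 (ltW y2)).
Unshelve. all: by end_near. Qed.

(** Integrate the vanishing Poisson integral over an arc and exchange the
    integrals: the kernel's mass over the arc tends to the arc's indicator, so
    [u] integrates to zero over the arc. *)
Lemma poisson_zero_ae (u : RR -> R) (K : R) :
  measurable_fun [set: RR] u -> (forall t, `|u t| <= K) ->
  (forall r s, 0 <= r -> r < 1 ->
    \int[mu]_(t in `[- pi, pi]) (u t * poisson_kernel r (s - t)) = 0) ->
  {ae mu, forall t, `[- pi, pi]%classic t -> u t = 0}.
Proof.
move=> mu_ uK u0; apply: ae_zero_of_primitive.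
  exact: (integrable_bounded_itv _ _ mu_ uK).
(* the factor 1/2 keeps [r n >= 1/2], as the off-centre estimate requires *)
move=> x hx; pose r n : R := 1 - 2^-1 * n.+1%:R^-1.
have n0 n : 0 < 2^-1 * n.+1%:R^-1 :> R by rewrite mulr_gt0.
have hr n : 2^-1 <= r n < 1.
  rewrite /r gtrBl n0 andbT.
  have : 2^-1 * n.+1%:R^-1 <= 2^-1 :> R by rewrite ler_piMr// invf_le1// ler1n.
  by move: (2^-1 * n.+1%:R^-1 : R) => y; lra.
have cr : r n @[n --> \oo] --> (1 : R).
  rewrite /r -[X in _ --> X]subr0; apply: cvgB; first exact: cvg_cst.
  by rewrite -[X in _ --> X](mulr0 2^-1); apply: cvgM; [exact: cvg_cst|exact: cvg_harmonic].
have r01 n : 0 <= r n /\ r n < 1.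
  by have /andP[r2 ->] := hr n; rewrite (le_trans _ r2).
have x12 : - pi <= x /\ x <= pi by case/andP: hx => /ltW -> /ltW ->.
pose k n t := \int[mu]_(s in `[- pi, x]) poisson_kernel (r n) (s - t).
have cP n t : {for t, continuous (poisson_kernel (r n))}.
  by have [h1 h2] := r01 n; exact: continuous_poisson_kernel.
have iP n a b t : mu.-integrable `[a, b] (EFin \o (fun s => poisson_kernel (r n) (s - t))).
  have [h1 h2] := r01 n.
  under [EFin \o _]eq_fun do rewrite /= poisson_kernelC.
  exact: integrable_poisson.
have ck n t : {for t, continuous (k n)}.
  have [h1 h2] := r01 n.
  have tI : t \in `]t - 1, t + 1[%classic.
    by apply/mem_set; rewrite /= in_itv/= gtrBl ltrDl ltr01.
  apply: (@continuity_under_integral _ _ _ mu (fun t s => poisson_kernel (r n) (s - t))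
    `[- pi, x] _ (t - 1) (t + 1) _ _ (cst ((1 - r n ^+ 2) / (1 - r n) ^+ 2))) => //.
  - apply: aeW => s _ y _.
    have c1 : {for y, continuous (fun y => s - y)}.
      by apply: cvgB; [exact: cvg_cst|exact: cvg_id].
    exact: (@continuous_comp _ _ _ (fun y => s - y) (poisson_kernel (r n)) y c1 (cP _ _)).
  - by apply: integrable_itvcc => s _; exact: cvg_cst.
  - move=> y _; apply: aeW => s _ /=.
    by rewrite ger0_norm; [exact: poisson_kernel_le|exact: poisson_kernel_ge0].
have kB n t : `|k n t| <= 2 * pi.
  have [h1 h2] := r01 n; rewrite ger0_norm; last first.
    by apply: Rintegral_ge0 => s _; exact: poisson_kernel_ge0.
  rewrite -(poisson_mass t h1 h2).
  rewrite (@eq_Rintegral _ _ _ mu _ (fun s => poisson_kernel (r n) (s - t))); last first.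
    by move=> s _; exact: poisson_kernelC.
  rewrite (@Rintegral_itv_split _ _ (- pi) x pi (x12.1) (x12.2) (iP _ _ _ _)).
  by rewrite lerDl; apply: Rintegral_ge0 => s _; exact: poisson_kernel_ge0.
have k0 n : \int[mu]_(t in `[- pi, pi]) (k n t * u t) = 0.
  have [h1 h2] := r01 n.
  have mh : measurable_fun [set: RR * RR] (fun z => u z.2 * poisson_kernel (r n) (z.1 - z.2)).
    apply: measurable_funM; first exact: measurableT_comp.
    apply: (@measurableT_comp _ _ _ _ _ _ (poisson_kernel (r n))).
      by apply: continuous_measurable_fun => t; exact: cP.
    by apply: measurable_funB.
  have hK z : `|u z.2 * poisson_kernel (r n) (z.1 - z.2)| <=
      K * ((1 - r n ^+ 2) / (1 - r n) ^+ 2).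
    rewrite normrM ler_pM// ger0_norm; [exact: poisson_kernel_le|exact: poisson_kernel_ge0].
  have := Fubini_itv (- pi) x (- pi) pi mh hK => /=.
  rewrite (@eq_Rintegral _ _ _ mu _ (fun=> 0)); last by move=> s _; exact: u0.
  rewrite Rintegral_cst_itv ?x12.1// mul0r => E; rewrite [RHS]E.
  apply: eq_Rintegral => t _; rewrite mulrC RintegralZl//; exact: iP.
have lim := @cvg_Rintegral_dominated _ k (fun t => 2 * pi * \1_`[- pi, x] t) u (2 * pi)
  ck kB _ mu_ (integrable_bounded_itv _ _ mu_ uK) _.
have {lim} : (0 : R) @[_ --> \oo] --> \int[mu]_(t in `[- pi, pi]) (2 * pi * \1_`[- pi, x] t * u t).
  rewrite (_ : (fun=> 0) = (fun n : nat => \int[mu]_(t in `[- pi, pi]) (k n t * u t))); last first.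
    by apply/funext => n; rewrite k0.
  apply: lim.
    apply: measurable_funM; first exact: measurable_cst.
    by apply: measurable_indic; exact: measurable_itv.
  have e1 := negligible_set1 (- pi); have e2 := negligible_set1 pi.
  apply: negligibleS (negligibleU (negligible_set1 x) (negligibleU e1 e2)) => t /=.
  move=> /not_implyP[]; rewrite in_itv /= => /andP[t1 t2] nt.
  have [->|ntx] := eqVneq t x; first by left.
  have [->|nt1] := eqVneq t (- pi); first by right; left.
  have [->|nt2] := eqVneq t pi; first by right; right.
  exfalso; apply: nt; apply: poisson_arc_mass_cvg => //.
  by apply/andP; split; rewrite lt_neqAle ?t1 ?t2 ?andbT// eq_sym.
move=> lim; have : \int[mu]_(t in `[- pi, pi]) (2 * pi * \1_`[- pi, x] t * u t) = 0.
  by apply: (cvg_unique _ lim) => //; exact: cvg_cst.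
have -> : \int[mu]_(t in `[- pi, pi]) (2 * pi * \1_`[- pi, x] t * u t) =
    2 * pi * \int[mu]_(t in `[- pi, x]) u t.
  have E : `[- pi, x]%classic = `[- pi, pi]%classic `&` `[- pi, x]%classic :> set R.
    rewrite setIC; apply/esym/setIidl => t /=; rewrite !in_itv/= => /andP[-> /le_trans]; apply.
    exact: x12.2.
  have -> : \int[mu]_(t in `[- pi, x]) u t =
      \int[mu]_(t in `[- pi, pi] `&` `[- pi, x]) u t by rewrite -E.
  rewrite Rintegral_mkcondr.
  have i1u : mu.-integrable `[- pi, pi] (EFin \o (fun t => \1_`[- pi, x] t * u t)).
    apply: (@integrable_bounded_itv _ _ K).
      apply: measurable_funM; last exact: mu_.
      by apply: measurable_indic; exact: measurable_itv.
    move=> t; rewrite normrM indicE; case: (_ \in _); first by rewrite normr1 mul1r.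
    by rewrite normr0 mul0r (le_trans _ (uK t)).
  rewrite (@eq_Rintegral _ _ _ mu _ (fun t => 2 * pi * (\1_`[- pi, x] t * u t))); last first.
    by move=> t _; rewrite mulrA.
  rewrite RintegralZl//; congr (_ * _).
  by apply: eq_Rintegral => t _; rewrite patchE indicE; case: ifP; rewrite ?mul1r ?mul0r.
move=> /eqP; rewrite mulf_eq0 gt_eqF ?mulr_gt0 ?pi_gt0//= => /eqP.
by [].
Qed.

End poisson_uniqueness.

(** * Boundary functions in the quotient algebra *)

Section poisson_Linf.
Context {R : realType}.
Notation mu := (@lebesgue_measure R).
Notation C := R[i].
Notation T := (circle R).
Notation RR := (measurableTypeR R).

Lemma arc_length_ae_ex (P : T -> Prop) : (\forall z \ae (@arc_length R), P z) ->
  exists z, P z.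
Proof.
move=> [A [mA A0 sA]]; apply: contrapT => nP.
have AT : A = [set: T].
  by apply/seteqP; split=> // z _; apply: sA => /= Pz; apply: nP; exists z.
have := arc_lengthT R; rewrite -AT A0 => -[] /eqP.
by rewrite lt_eqF// mulr_gt0 ?pi_gt0.
Qed.

(** A representative bounded everywhere allows integrals to be compared
    pointwise. *)
Lemma truncation (g : T -> C) (M : R) : measurable_cfun g ->
  (\forall z \ae (@arc_length R), normc (g z) <= M) ->
  exists g' : T -> C, [/\ measurable_cfun g', forall z, normc (g' z) <= M &
    \forall z \ae (@arc_length R), g' z = g z].
Proof.
move=> [mg1 mg2] gM.
have [z0 z0M] := arc_length_ae_ex gM.
have M0 : 0 <= M by apply: le_trans z0M; exact: normc_ge0.
have mb : measurable_fun [set: T] (fun z => normc (g z) <= M).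
  apply: (measurable_fun_bool true); rewrite setTI.
  rewrite (_ : _ @^-1` _ = [set z | normc (g z) <= M]); last first.
    by apply/seteqP; split => z.
  exact: measurable_normc_le.
exists (fun z => if normc (g z) <= M then g z else 0); split.
- split.
    rewrite (_ : (fun z => _) = (fun z => if normc (g z) <= M then complex.Re (g z) else 0)).
      by apply: measurable_fun_ifT => //; exact: measurable_cst.
    by apply/funext => z; case: ifP.
  rewrite (_ : (fun z => _) = (fun z => if normc (g z) <= M then complex.Im (g z) else 0)).
    by apply: measurable_fun_ifT => //; exact: measurable_cst.
  by apply/funext => z; case: ifP.
- by move=> z; case: ifP => //; rewrite normc0.
- by apply: filterS gM => z ->.
Qed.

Lemma integrable_bounded_poisson (h : T -> R) (M r s : R) : 0 <= r -> r < 1 ->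
  measurable_fun [set: T] h -> (forall z, `|h z| <= M) ->
  mu.-integrable `[- pi, pi] (EFin \o (fun t => h (expi t) * poisson_kernel r (s - t))).
Proof.
move=> r0 r1 mh hM.
apply: (@integrable_bounded_itv _ _ _ (M * ((1 - r ^+ 2) / (1 - r) ^+ 2))).
  apply: measurable_funM; first exact: (measurableT_comp mh (@measurable_expi R)).
  by apply: continuous_measurable_fun => t; exact: continuous_poisson_shift.
move=> t; rewrite normrM ler_pM// ger0_norm; last exact: poisson_kernel_ge0.
exact: poisson_kernel_le.
Qed.

Lemma Re_mulr (a : C) (b : R) : complex.Re (a * b%:C) = complex.Re a * b.
Proof. by rewrite Re_mul /= mulr0 subr0. Qed.

Lemma Im_mulr (a : C) (b : R) : complex.Im (a * b%:C) = complex.Im a * b.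
Proof. by rewrite Im_mul /= mulr0 add0r. Qed.

Lemma poisson_integralE (g : T -> C) (r s : R) :
  (2 * pi)%:C * poisson_integral g r s =
  (\int[mu]_(t in `[- pi, pi]) (complex.Re (g (expi t)) * poisson_kernel r (s - t))) +i*
  (\int[mu]_(t in `[- pi, pi]) (complex.Im (g (expi t)) * poisson_kernel r (s - t))).
Proof.
rewrite /poisson_integral mulrA -rmorphM divff ?rmorph1 ?mul1r; last first.
  by rewrite gt_eqF// mulr_gt0// pi_gt0.
by congr (_ +i* _); apply: eq_Rintegral => t _; rewrite (Re_mulr, Im_mulr).
Qed.

(** Uniqueness of densities applies to the real and imaginary parts of the
    difference of two bounded representatives. *)
Lemma poisson_integral_inj (g1 g2 : Linf_fun R) :
  (forall r s, 0 <= r -> r < 1 -> poisson_integral g1 r s = poisson_integral g2 r s) ->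
  \forall z \ae (@arc_length R), g1 z = g2 z.
Proof.
move=> g12.
have /linf_funP[mg1 /ess_boundedP[M1 gM1]] := valP g1.
have /linf_funP[mg2 /ess_boundedP[M2 gM2]] := valP g2.
have [h1 [mh1 hM1 ae1]] := truncation mg1 gM1.
have [h2 [mh2 hM2 ae2]] := truncation mg2 gM2.
have h12 r s : 0 <= r -> r < 1 -> poisson_integral h1 r s = poisson_integral h2 r s.
  move=> r0 r1; rewrite (poisson_integral_ae s r0 r1 mh1 mg1 ae1).
  by rewrite (poisson_integral_ae s r0 r1 mh2 mg2 ae2); exact: g12.
have part (p : C -> R) : (forall w, `|p w| <= normc w) ->
    measurable_fun [set: T] (fun z => p (h1 z)) ->
    measurable_fun [set: T] (fun z => p (h2 z)) ->
    (forall r s, 0 <= r -> r < 1 ->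
      \int[mu]_(t in `[- pi, pi]) (p (h1 (expi t)) * poisson_kernel r (s - t)) =
      \int[mu]_(t in `[- pi, pi]) (p (h2 (expi t)) * poisson_kernel r (s - t))) ->
    {ae mu, forall t, `[- pi, pi]%classic t -> p (h1 (expi t)) - p (h2 (expi t)) = 0}.
  move=> pn m1 m2 E.
  have b1 z : `|p (h1 z)| <= M1 by exact: le_trans (pn _) (hM1 z).
  have b2 z : `|p (h2 z)| <= M2 by exact: le_trans (pn _) (hM2 z).
  apply: (@poisson_zero_ae _ (fun t => p (h1 (expi t)) - p (h2 (expi t))) (M1 + M2)).
  - apply: measurable_funB.
      exact: (measurableT_comp m1 (@measurable_expi R)).
    exact: (measurableT_comp m2 (@measurable_expi R)).
  - by move=> t; rewrite (le_trans (ler_normB _ _))// lerD.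
  - move=> r s r0 r1.
    have i1 := integrable_bounded_poisson s r0 r1 m1 b1.
    have i2 := integrable_bounded_poisson s r0 r1 m2 b2.
    have := E r s r0 r1 => /eqP; rewrite -subr_eq0 -RintegralB// => /eqP <-.
    by apply: eq_Rintegral => t _; rewrite mulrBl.
have E r s (r0 : 0 <= r) (r1 : r < 1) := etrans (esym (poisson_integralE h1 r s))
  (etrans (congr1 (fun w => (2 * pi)%:C * w) (h12 r s r0 r1)) (poisson_integralE h2 r s)).
have aeR := part _ normr_Re_le mh1.1 mh2.1 (fun r s r0 r1 =>
  congr1 (@complex.Re R) (E r s r0 r1)).
have aeI := part _ normr_Im_le mh1.2 mh2.2 (fun r s r0 r1 =>
  congr1 (@complex.Im R) (E r s r0 r1)).
have ae12 : \forall z \ae (@arc_length R), h1 z = h2 z.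
  apply: ae_arc_length; first exact: measurable_cfun_eq.
  apply: ae_impl2 aeR aeI => t hR hI tpi.
  apply/eqP; rewrite eq_complex -subr_eq0 -[X in _ && X]subr_eq0.
  by rewrite hR// hI// !eqxx.
by apply: filterS3 ae1 ae2 ae12 => z <- <-.
Qed.

(** With [A] the integral to be bounded, [|A|^2] is the integral of the real part
    of [conj A * h] against the kernel, which is nonnegative of total mass 2 pi. *)
Lemma poisson_integral_le (g : T -> C) (M r s : R) : 0 <= r -> r < 1 ->
  measurable_cfun g -> (\forall z \ae (@arc_length R), normc (g z) <= M) ->
  normc (poisson_integral g r s) <= M.
Proof.
move=> r0 r1 mg gM; have [h [mh hM aeh]] := truncation mg gM.
rewrite -(poisson_integral_ae s r0 r1 mh mg aeh).
have pi2 : 0 < 2 * pi :> R by rewrite mulr_gt0// pi_gt0.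
rewrite -(ler_pM2l pi2).
have -> : 2 * pi * normc (poisson_integral h r s) =
    normc ((2 * pi)%:C * poisson_integral h r s).
  by rewrite [RHS]normcM normc_real ger0_norm ?ltW.
rewrite poisson_integralE.
set A1 := Rintegral _ _ _; set A2 := Rintegral _ _ _; set A := A1 +i* A2.
have [A0|A0] := eqVneq (normc A) 0.
  rewrite A0; apply: mulr_ge0; first exact: ltW.
  by have [z zM] := arc_length_ae_ex gM; exact: le_trans (normc_ge0 _) zM.
have A0' : 0 < normc A by rewrite lt_neqAle eq_sym A0 normc_ge0.
rewrite -(ler_pM2l A0') -expr2 normc_sqrE /= !expr2.
have b1 z : `|complex.Re (h z)| <= M by exact: le_trans (normr_Re_le _) (hM z).
have b2 z : `|complex.Im (h z)| <= M by exact: le_trans (normr_Im_le _) (hM z).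
have i1 := integrable_bounded_poisson s r0 r1 mh.1 b1.
have i2 := integrable_bounded_poisson s r0 r1 mh.2 b2.
have iP := integrable_poisson s (- pi) pi r0 r1.
have -> : normc A * (2 * pi * M) =
    \int[mu]_(t in `[- pi, pi]) (normc A * M * poisson_kernel r (s - t)).
  by rewrite RintegralZl// poisson_mass//; ring.
have -> : A1 * A1 + A2 * A2 = \int[mu]_(t in `[- pi, pi])
    (A1 * (complex.Re (h (expi t)) * poisson_kernel r (s - t)) +
     A2 * (complex.Im (h (expi t)) * poisson_kernel r (s - t))).
  by rewrite RintegralD ?RintegralZl//; exact: integrable_fctZ.
apply: le_Rintegral => //.
- by apply: integrable_fctD => //; exact: integrable_fctZ.
- exact: integrable_fctZ.
move=> t _; rewrite (mulrA A1 (complex.Re _)) (mulrA A2 (complex.Im _)) -mulrDl.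
apply: ler_wpM2r; first exact: poisson_kernel_ge0.
apply: (@le_trans _ _ (normc A * normc (h (expi t)))); last first.
  by rewrite ler_wpM2l// normc_ge0.
(* Cauchy-Schwarz: the left-hand side is the real part of conj A * h *)
rewrite -(normc_conjc A) -normcM; apply: le_trans (normr_Re_le _).
apply: le_trans (ler_norm _); rewrite Re_mul /=.
by rewrite mulNr opprK.
Qed.

Lemma disk_polar (r s : R) : 0 <= r -> r < 1 ->
  exists z : disk R, val z = r%:C * val (expi s).
Proof.
move=> r0 r1; apply: disk_of_normc; rewrite [normc (_ * _)]normcM normc_real ger0_norm//.
by rewrite /= cos2Dsin2 sqrtr1 mulr1.
Qed.

Lemma polar_of_disk (z : disk R) : exists r s : R,
  [/\ 0 <= r, r < 1 & val z = r%:C * val (expi s)].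
Proof.
have z1 := normc_disk z; move: (val z) z1 => w w1.
have [w0|w0] := eqVneq (normc w) 0.
  by exists 0, 0; split=> //; rewrite mul0r (eq0_normc w0).
pose a := complex.Re w / normc w; pose b := complex.Im w / normc w.
have ab : a ^+ 2 + b ^+ 2 = 1.
  by rewrite !expr_div_n -mulrDl -normc_sqrE divff// expf_neq0.
have a1 : -1 <= a <= 1.
  rewrite -ler_norml -(@expr_le1 _ 2)// real_normK ?num_real// -ab.
  by rewrite lerDl sqr_ge0.
have cosa : cos (acos a) = a by rewrite acosK// in_itv.
have sina : sin (acos a) = `|b|.
  by rewrite sin_acos// -sqrtr_sqr; congr (Num.sqrt _); rewrite -ab addrAC subrr add0r.
have [s [cs ss]] : exists s, cos s = a /\ sin s = b.
  have [b0|b0] := leP 0 b; first by exists (acos a); rewrite cosa sina ger0_norm.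
  by exists (- acos a); rewrite cosN sinN cosa sina ltr0_norm// opprK.
exists (normc w), s; split => //; first exact: normc_ge0.
apply/eqP; rewrite eq_complex Re_mul Im_mul /= cs ss !mul0r subr0 addr0.
by rewrite /a /b !(mulrC (normc w)) !divfK// !eqxx.
Qed.

Lemma is_boundary_function_pi (f : Hinf R) (g : Linf_fun R) :
  (forall (r s : R) (z : disk R), 0 <= r -> r < 1 ->
    val z = r%:C * val (expi s) -> f z = poisson_integral g r s) ->
  is_boundary_function f (\pi_(Linf R) g).
Proof.
move=> fg r s z r0 r1 zE; rewrite (fg r s z)//.
have /linf_funP[mg _] := valP g; have /linf_funP[mg' _] := valP (repr (\pi_(Linf R) g)).
apply: poisson_integral_ae => //.
by apply: filterS (repr_Linf_pi g) => w ->.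
Qed.

Lemma is_boundary_function_inj (f : Hinf R) (u v : Linf R) :
  is_boundary_function f u -> is_boundary_function f v -> u = v.
Proof.
move=> fu fv; rewrite -[u]reprK -[v]reprK; apply/Linf_piP.
apply: poisson_integral_inj => r s r0 r1.
have [z zE] := disk_polar s r0 r1.
by rewrite -(fu r s z)// -(fv r s z).
Qed.

Lemma radial_boundary (f : Hinf R) (x : nat -> R) (g : Linf_fun R) :
  radii_to_one x -> radial_limit (extend_disk f) x g ->
  is_boundary_function f (\pi_(Linf R) g).
Proof.
move=> hx fg; apply: is_boundary_function_pi.
have /linf_funP[mg _] := valP g.
exact: poisson_of_radial_limit hx mg fg.
Qed.

Lemma radial_limitP (a : C) (F G : C -> C) (x : nat -> R) (f g : T -> C) :
  radial_limit F x f -> radial_limit G x g ->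
  radial_limit (a *: F + G) x (a *: f + g).
Proof.
apply: ae_impl2 => t hf hg tpi; have [f1 f2] := hf tpi; have [g1 g2] := hg tpi.
split.
  rewrite (_ : complex.Re _ = complex.Re a * complex.Re (f (expi t)) -
    complex.Im a * complex.Im (f (expi t)) + complex.Re (g (expi t))); last first.
    by rewrite -Re_mul -Re_add.
  rewrite (_ : (fun k => _) = (fun k => complex.Re a * complex.Re (F (polar (x k) t)) -
    complex.Im a * complex.Im (F (polar (x k) t)) + complex.Re (G (polar (x k) t)))).
    by apply: cvgD => //; apply: cvgB; apply: cvgM => //; exact: cvg_cst.
  by apply/funext => k; rewrite -Re_mul -Re_add.
rewrite (_ : complex.Im _ = complex.Re a * complex.Im (f (expi t)) +
  complex.Im a * complex.Re (f (expi t)) + complex.Im (g (expi t))); last first.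
  by rewrite -Im_mul -Im_add.
rewrite (_ : (fun k => _) = (fun k => complex.Re a * complex.Im (F (polar (x k) t)) +
  complex.Im a * complex.Re (F (polar (x k) t)) + complex.Im (G (polar (x k) t)))).
  by apply: cvgD => //; apply: cvgD; apply: cvgM => //; exact: cvg_cst.
by apply/funext => k; rewrite -Im_mul -Im_add.
Qed.

Lemma radial_limitM (F G : C -> C) (x : nat -> R) (f g : T -> C) :
  radial_limit F x f -> radial_limit G x g -> radial_limit (F * G) x (f * g).
Proof.
apply: ae_impl2 => t hf hg tpi; have [f1 f2] := hf tpi; have [g1 g2] := hg tpi.
split.
  rewrite (_ : complex.Re _ = complex.Re (f (expi t)) * complex.Re (g (expi t)) -
    complex.Im (f (expi t)) * complex.Im (g (expi t))); last by rewrite -Re_mul.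
  rewrite (_ : (fun k => _) = (fun k => complex.Re (F (polar (x k) t)) *
    complex.Re (G (polar (x k) t)) - complex.Im (F (polar (x k) t)) *
    complex.Im (G (polar (x k) t)))).
    by apply: cvgB; apply: cvgM.
  by apply/funext => k; rewrite -Re_mul.
rewrite (_ : complex.Im _ = complex.Re (f (expi t)) * complex.Im (g (expi t)) +
  complex.Im (f (expi t)) * complex.Re (g (expi t))); last by rewrite -Im_mul.
rewrite (_ : (fun k => _) = (fun k => complex.Re (F (polar (x k) t)) *
  complex.Im (G (polar (x k) t)) + complex.Im (F (polar (x k) t)) *
  complex.Re (G (polar (x k) t)))).
  by apply: cvgD; apply: cvgM.
by apply/funext => k; rewrite -Im_mul.
Qed.

(** Along common radii both functions have almost everywhere limits, which
    represent [u] and [v] by uniqueness; limits commute with the operations. *)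
Lemma is_boundary_functionP (a : C) (f g : Hinf R) (u v : Linf R) :
  is_boundary_function f u -> is_boundary_function g v ->
  is_boundary_function (a *: f + g) (a *: u + v).
Proof.
move=> fu gv; have [x [h1 [h2 [hx fh gh]]]] := common_radial_limits f g.
rewrite (is_boundary_function_inj fu (radial_boundary hx fh)).
rewrite (is_boundary_function_inj gv (radial_boundary hx gh)).
have -> : a *: \pi_(Linf R) h1 + \pi_(Linf R) h2 = \pi_(Linf R) (a *: h1 + h2).
  by rewrite rmorphD; congr (_ + _); apply/esym; exact: pi_LinfZ.
apply: (radial_boundary hx).
by have := radial_limitP a fh gh; rewrite -extend_diskP.
Qed.

Lemma is_boundary_functionM (f g : Hinf R) (u v : Linf R) :
  is_boundary_function f u -> is_boundary_function g v ->
  is_boundary_function (f * g) (u * v).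
Proof.
move=> fu gv; have [x [h1 [h2 [hx fh gh]]]] := common_radial_limits f g.
rewrite (is_boundary_function_inj fu (radial_boundary hx fh)).
rewrite (is_boundary_function_inj gv (radial_boundary hx gh)).
have -> : \pi_(Linf R) h1 * \pi_(Linf R) h2 = \pi_(Linf R) (h1 * h2).
  by rewrite rmorphM.
apply: (radial_boundary hx).
by have := radial_limitM fh gh; rewrite -extend_diskM.
Qed.

Lemma is_boundary_function1 : is_boundary_function (1 : Hinf R) 1.
Proof.
have [x [_ [_ [hx _ _]]]] := common_radial_limits (1 : Hinf R) 1.
have -> : (1 : Linf R) = \pi_(Linf R) 1 by rewrite rmorph1.
apply: (radial_boundary hx).
apply: aeW => t _.
have E k : extend_disk (1 : Hinf R) (polar (x k) t) = 1.
  have : normc (polar (x k) t) < 1.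
    by apply: normc_polar_lt1; have /andP[] := hx k.
  by move=> /disk_of_normc[z <-]; rewrite extend_diskE.
by split; under eq_fun do rewrite E; exact: cvg_cst.
Qed.

(** The boundary values are limits of values of [f], hence at most its norm;
    conversely the values of [f] are averages of the boundary values. *)
Lemma Linf_norm_boundary (f : Hinf R) (u : Linf R) :
  is_boundary_function f u -> Linf_norm u = Hinf_norm f.
Proof.
move=> fu; have [x [g [_ [hx fg _]]]] := common_radial_limits f f.
have fg' := radial_boundary hx fg.
rewrite (is_boundary_function_inj fu fg').
rewrite Linf_norm_pi.
have x0 k : x k < 0 by have /andP[] := hx k.
have /linf_funP[mg _] := valP g.
have le1 : (ess_sup (@arc_length R) (fun z => (normc (g z))%:E) <= (Hinf_norm f)%:E)%E.
  by apply/ess_supP; exact: (radial_limit_le x0 mg fg (Hinf_norm_ub f)).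
have ge m : (\forall z \ae (@arc_length R), normc (g z) <= m) -> Hinf_norm f <= m.
  move=> gm; apply: ge_sup; first by exists (normc (f point)); exists point.
  move=> _ [z _ <-]; have [r [s [r0 r1 zE]]] := polar_of_disk z.
  have := @poisson_of_radial_limit _ f x g hx mg fg r s z r0 r1 zE => ->.
  exact: poisson_integral_le.
have := @ess_sup_ge _ _ _ (@arc_length R) (fun z => (normc (g z))%:E).
case: (ess_sup _ _) le1 => [m||] //=.
- by rewrite lee_fin => le1 ae; apply/eqP; rewrite eq_le le1 ge.
- move=> _ ae; have : Hinf_norm f <= -1.
    by apply: ge; apply: filterS ae => z; rewrite leeNy_eq.
  move=> /(le_trans (Hinf_norm_ub f point)) /(le_trans (normc_ge0 _)).
  by rewrite oppr_ge0 ler10.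
Qed.

End poisson_Linf.

Theorem theorem1 (R : realType) :
  (forall f : Hinf R, exists! fstar : Linf R, is_boundary_function f fstar) /\
  (exists Phi : {lrmorphism Hinf R -> Linf R},
    (forall f : Hinf R, is_boundary_function f (Phi f)) /\
    (forall f : Hinf R, Linf_norm (Phi f) = Hinf_norm f)).
Proof.
have ex (f : Hinf R) : exists u : Linf R, is_boundary_function f u.
  have [x [g [_ [hx fg _]]]] := common_radial_limits f f.
  by exists (\pi_(Linf R) g); exact: radial_boundary hx fg.
split=> [f|].
  have [u fu] := ex f; exists u; split=> // v; exact: is_boundary_function_inj.
pose Phi (f : Hinf R) : Linf R := projT1 (cid (ex f)).
have PhiP f : is_boundary_function f (Phi f) := projT2 (cid (ex f)).
have PhiE f u : is_boundary_function f u -> Phi f = u.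
  by move=> fu; exact: is_boundary_function_inj (PhiP f) fu.
have lin : linear Phi by move=> a f g; apply: PhiE; exact: is_boundary_functionP.
have mul : monoid_morphism Phi.
  split; first by apply: PhiE; exact: is_boundary_function1.
  by move=> f g; apply: PhiE; exact: is_boundary_functionM.
pose L := GRing.isLinear.Build _ _ _ _ Phi lin.
pose M := GRing.isMonoidMorphism.Build _ _ Phi mul.
pose PhiM : {lrmorphism Hinf R -> Linf R} := HB.pack Phi L M.
exists PhiM; split=> f; first exact: PhiP.
exact: Linf_norm_boundary (PhiP f).
Qed.
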